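(* Let $D\subset\mathbb R^n$ be the unit ball and $\varphi\equiv1$ on $\partial D$. Then Problem (P) has a unique solution $u$, and $u$ is radially symmetric. In particular, the free boundary $\partial\{u>0\}$ is a sphere.
   Context: Fix $1<p<\infty$. For a bounded domain $D\subset\mathbb R^n$ with smooth boundary and a positive continuous function $\varphi$ on $\partial D$, let $D^C$ denote the exterior $\mathbb R^n\setminus\overline D$ and $$V:=\{u\in W^{1,p}(D^C) : u=\varphi \text{ on }\partial D\}$$ (boundary values in the sense of traces). Problem (P) is: minimize $J(u):=\int_{D^C}|\nabla u|^p\,dx$ among all functions $u\in V$ such that $\Delta_p u:=\mathrm{div}(|\nabla u|^{p-2}\nabla u)=0$ (weakly) in the open set $\{u>0\}$ and $|\{u>0\}|=1$, where $|\cdot|$ is Lebesgue measure. A solution of Problem (P) is a minimizer of $J$ in this class (identified with its continuous representative), and its free boundary is $\partial\{u>0\}$, the boundary of $\{u>0\}$ relative to $D^C$. *)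

(* Defs.v *)
From HB Require Import structures.
From mathcomp Require Import all_boot all_order all_algebra.
From mathcomp Require Import all_classical all_reals all_analysis.
From mathcomp Require Import measurable_realfun.

Set Implicit Arguments.
Unset Strict Implicit.
Unset Printing Implicit Defensive.
Import Order.TTheory GRing.Theory Num.Theory.
Import numFieldNormedType.Exports.
Local Open Scope classical_set_scope.
Local Open Scope ring_scope.

(** The norm of the library on ['rV[R]_n] is the sup norm: it is only used for
    the topology, and [enorm] is the Euclidean norm. *)
Definition enorm {R : realType} {n : nat} (x : 'rV[R]_n) : R :=
  Num.sqrt (\sum_(i < n) x ord0 i ^+ 2).

Definition edot {R : realType} {n : nat} (x y : 'rV[R]_n) : R :=
  \sum_(i < n) x ord0 i * y ord0 i.


Fact rV_display : measure_display. Proof. exact: default_measure_display. Qed.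

(** Product sigma-algebra of the Borel sets of [R], as for tuples in the
    library; it is the Borel sigma-algebra of ['rV[R]_n]. *)
Section measurable_rV.
Context {R : realType} {n : nat}.

Definition coors (i : 'I_n) (x : 'rV[R]_n) : R := x ord0 i.

Let rV_set0 : g_sigma_preimage coors set0.
Proof. exact: sigma_algebra0. Qed.

Let rV_setC A : g_sigma_preimage coors A -> g_sigma_preimage coors (~` A).
Proof. exact: sigma_algebraC. Qed.

Let rV_bigcup (F : (set 'rV[R]_n)^nat) :
  (forall i, g_sigma_preimage coors (F i)) ->
  g_sigma_preimage coors (\bigcup_i (F i)).
Proof. exact: sigma_algebra_bigcup. Qed.

HB.instance Definition _ := @isMeasurable.Build rV_display
  'rV[R]_n (g_sigma_preimage coors) rV_set0 rV_setC rV_bigcup.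

Lemma measurable_coors (i : 'I_n) : measurable_fun [set: 'rV[R]_n] (coors i).
Proof.
move=> _ Y mY; rewrite setTI; apply: sub_sigma_algebra => /=.
rewrite -bigcup_seq/=; exists i => /=; first by rewrite mem_index_enum.
by exists Y => //; rewrite setTI.
Qed.

Lemma measurable_fun_rV d (T : measurableType d) (f : T -> 'rV[R]_n) :
  (forall i, measurable_fun setT (coors i \o f)) -> measurable_fun setT f.
Proof.
move=> mf _ A mA; rewrite setTI.
suff : <<s \big[setU/set0]_(i < n)
    preimage_set_system setT (coors i) measurable >> `<=`
    [set B | measurable (f @^-1` B)] by exact.
apply: smallest_sub => [|B].
  split => /=.
  - by rewrite preimage_set0.
  - by move=> B mB; rewrite setTD -preimage_setC; exact: measurableC.
  - by move=> F mF; rewrite preimage_bigcup; exact: bigcup_measurable.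
rewrite -bigcup_seq => -[i _ [C mC <-]] /=.
by rewrite setTI -comp_preimage -[X in measurable X]setTI; exact: mf.
Qed.

End measurable_rV.

Section lebesgue_step.
Context {R : realType} {n : nat}.

Definition cons_rV (z : R * 'rV[R]_n) : 'rV[R]_n.+1 :=
  row_mx (z.1%:M : 'rV_1) z.2.

Definition uncons_rV (x : 'rV[R]_n.+1) : R * 'rV[R]_n :=
  (x ord0 ord0, rsubmx (x : 'rV_(1 + n))).

Lemma measurable_cons_rV : measurable_fun setT cons_rV.
Proof.
apply: measurable_fun_rV => i.
rewrite (_ : _ \o _ = fun z => match fintype.split (i : 'I_(1 + n)) with
   inl _ => z.1 | inr k => coors k z.2 end).
  case: fintype.split => [_|k]; first exact: measurable_fst.
  by apply: measurableT_comp => //; exact: measurable_coors.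
apply/funext => -[a x]; rewrite /coors /= /cons_rV mxE.
by case: fintype.split => // k; rewrite mxE !ord1 eqxx.
Qed.

Lemma measurable_uncons_rV : measurable_fun setT uncons_rV.
Proof.
apply/measurable_fun_pair => /=; first exact: measurable_coors.
apply: measurable_fun_rV => i.
rewrite (_ : _ \o _ = coors (rshift 1 i : 'I_n.+1)); first exact: measurable_coors.
by apply/funext => x; rewrite /coors /= mxE.
Qed.

Lemma cons_rVK : cancel cons_rV uncons_rV.
Proof.
case=> a x; rewrite /uncons_rV /cons_rV /= row_mxKr; congr pair.
have -> : ord0 = lshift n (ord0 : 'I_1) :> 'I_(1 + n) by exact/val_inj.
by rewrite (@row_mxEl _ 1 1 n) mxE eqxx.
Qed.

Variable m : {sigma_finite_measure set 'rV[R]_n -> \bar R}.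

Definition lebesgue_step (A : set 'rV[R]_n.+1) : \bar R :=
  (@lebesgue_measure R \x m)%E (cons_rV @^-1` A).

Let step0 : lebesgue_step set0 = 0%E.
Proof. by rewrite /lebesgue_step preimage_set0 measure0. Qed.

Let step_ge0 A : (0 <= lebesgue_step A)%E.
Proof. exact: measure_ge0. Qed.

Let step_sigma_additive : semi_sigma_additive lebesgue_step.
Proof.
have mpre B : measurable B -> measurable (cons_rV @^-1` B).
  by move=> mB; rewrite -[X in measurable X]setTI; exact: measurable_cons_rV.
move=> F mF tF mUF; rewrite /lebesgue_step preimage_bigcup.
apply: measure_semi_sigma_additive => [k||]; first exact: mpre.
  apply/trivIsetP => /= i j _ _ ij; rewrite -preimage_setI.
  by move/trivIsetP : tF => /(_ _ _ _ _ ij) ->//; rewrite preimage_set0.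
by rewrite -preimage_bigcup; exact: mpre.
Qed.

HB.instance Definition _ := isMeasure.Build _ _ _
  lebesgue_step step0 step_ge0 step_sigma_additive.

Let step_sigma_finite : sigma_finite setT lebesgue_step.
Proof.
have /sigma_finiteP[F [TF ndF Foo]] := sigma_finiteT (@lebesgue_measure R).
have /sigma_finiteP[G [TG ndG Goo]] := sigma_finiteT m.
exists (fun k => uncons_rV @^-1` (F k `*` G k)).
  rewrite -preimage_bigcup (_ : \bigcup_k _ = setT) ?preimage_setT//.
  apply/seteqP; split => // -[x y] _.
  have [j _ Fjx] : (\bigcup_k F k) x by rewrite -TF.
  have [k _ Gky] : (\bigcup_k G k) y by rewrite -TG.
  exists (maxn j k) => //; split.
  - by move: x Fjx; exact/subsetPset/ndF/leq_maxl.
  - by move: y Gky; exact/subsetPset/ndG/leq_maxr.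
move=> k; have [mFk Fkoo] := Foo k; have [mGk Gkoo] := Goo k; split.
  rewrite -[X in measurable X]setTI; apply: measurable_uncons_rV => //.
  exact: measurableX.
rewrite /lebesgue_step -comp_preimage (_ : _ \o _ = id).
  by rewrite preimage_id product_measure1E// lte_mul_pinfty// ge0_fin_numE.
by apply/funext => z; rewrite /= cons_rVK.
Qed.

HB.instance Definition _ := @Measure_isSigmaFinite.Build _ _ _
  lebesgue_step step_sigma_finite.

End lebesgue_step.

Fixpoint lebesgue_rV {R : realType} (n : nat) :
    {sigma_finite_measure set 'rV[R]_n -> \bar R} :=
  match n with
  | 0 => \d_(0 : 'rV[R]_0)
  | k.+1 => lebesgue_step (lebesgue_rV k)
  end.


Definition unit_ball {R : realType} {n : nat} : set 'rV[R]_n :=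
  [set x | enorm x < 1].

Definition unit_sphere {R : realType} {n : nat} : set 'rV[R]_n :=
  [set x | enorm x = 1].

Section surface_measure.
Context {R : realType} {n : nat}.

Definition normalize (x : 'rV[R]_n) : 'rV[R]_n := (enorm x)^-1 *: x.

Lemma measurable_enorm : measurable_fun setT (@enorm R n).
Proof.
rewrite (_ : @enorm R n = fun x => (\sum_(i < n) (coors i x) ^+ 2) `^ 2^-1).
  apply: (@measurableT_comp _ _ _ _ _ _ _ _ _ (measurable_powR _)) => //.
  by apply: measurable_sum => i; apply: measurable_funX; exact: measurable_coors.
by apply/funext => x; rewrite powR12_sqrt// sumr_ge0// => i _; rewrite sqr_ge0.
Qed.

Lemma measurable_normalize : measurable_fun setT normalize.
Proof.
apply: measurable_fun_rV => i.
rewrite (_ : _ \o _ = fun x => (enorm x) `^ (-1) * coors i x).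
  apply: measurable_funM; last exact: measurable_coors.
  by apply: (@measurableT_comp _ _ _ _ _ _ _ _ _ (measurable_powR _)); exact: measurable_enorm.
by apply/funext => x; rewrite powR_inv1 ?sqrtr_ge0// /coors /= mxE.
Qed.

Lemma measurable_unit_ball : measurable (@unit_ball R n).
Proof.
rewrite (_ : unit_ball = enorm @^-1` `]-oo, 1[).
  by rewrite -[X in measurable X]setTI; exact: measurable_enorm.
by apply/seteqP; split => x /=; rewrite in_itv.
Qed.

Definition cone_measure (A : set 'rV[R]_n) : \bar R :=
  lebesgue_rV n (unit_ball `&` normalize @^-1` A).

Let mcone A : measurable A -> measurable (unit_ball `&` normalize @^-1` A).
Proof.
move=> mA; apply: measurableI; first exact: measurable_unit_ball.
by rewrite -[X in measurable X]setTI; exact: measurable_normalize.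
Qed.

Let cone0 : cone_measure set0 = 0%E.
Proof. by rewrite /cone_measure preimage_set0 setI0 measure0. Qed.

Let cone_ge0 A : (0 <= cone_measure A)%E.
Proof. exact: measure_ge0. Qed.

Let cone_sigma_additive : semi_sigma_additive cone_measure.
Proof.
move=> F mF tF mUF; rewrite /cone_measure preimage_bigcup setI_bigcupr.
apply: measure_semi_sigma_additive => [k||]; first exact: mcone.
  apply/trivIsetP => /= i j _ _ ij; rewrite setIACA -preimage_setI.
  by move/trivIsetP : tF => /(_ _ _ _ _ ij) ->//; rewrite preimage_set0 setI0.
by rewrite -setI_bigcupr -preimage_bigcup; exact: mcone.
Qed.

HB.instance Definition _ := isMeasure.Build _ _ _
  cone_measure cone0 cone_ge0 cone_sigma_additive.

(** Polar coordinates: the area of [A `<=` unit_sphere] is [n] times the volume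
    of the cone [{t x | 0 < t < 1, x in A}]. *)
Definition surface_measure : {measure set 'rV[R]_n -> \bar R} :=
  mscale (n%:R%:nng) cone_measure.

End surface_measure.


Section sobolev.
Context {R : realType} {n : nat}.
Implicit Types (Omega : set 'rV[R]_n) (f u : 'rV[R]_n -> R)
  (G : 'rV[R]_n -> 'rV[R]_n).

Definition partial (i : 'I_n) f : 'rV[R]_n -> R :=
  fun x => 'D_(delta_mx ord0 i) f x.

Definition gradient f : 'rV[R]_n -> 'rV[R]_n :=
  fun x => \row_(i < n) partial i f x.

Definition smooth f := forall s : seq 'I_n,
  continuous (foldr partial f s) /\
  forall i x, derivable (foldr partial f s) x (delta_mx ord0 i).

Definition support f : set 'rV[R]_n := closure [set x | f x != 0].

Definition test_function Omega f :=
  [/\ smooth f, compact (support f) & support f `<=` Omega].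

Definition loc_integrable Omega f := forall K, compact K -> K `<=` Omega ->
  (lebesgue_rV n).-integrable K (EFin \o f).

Definition weak_gradient Omega u G :=
  [/\ loc_integrable Omega u,
      forall i, loc_integrable Omega (coors i \o G) &
      forall f i, test_function Omega f ->
        \int[lebesgue_rV n]_(x in Omega) (u x * partial i f x) =
        - \int[lebesgue_rV n]_(x in Omega) (G x ord0 i * f x)].

(** A choice of the weak gradient, which is unique almost everywhere. *)
Definition wgrad Omega u : 'rV[R]_n -> 'rV[R]_n :=
  xget (fun=> 0) [set G | weak_gradient Omega u G].

(** [Lp] functions on [Omega] and [Lp] convergence on [Omega]: only the values
    on [Omega] matter. *)
Definition Lp_on (p : R) Omega f := f \_ Omega \in Lfun (lebesgue_rV n) p%:E.

Definition Lp_cvg (mu : {measure set 'rV[R]_n -> \bar R}) (p : R) Omega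
    (f_ : nat -> 'rV[R]_n -> R) f :=
  ('N[mu]_p%:E[EFin \o ((f_ k \- f)%R \_ Omega)])%E @[k --> \oo] --> 0%E.

Definition sobolev (p : R) Omega u :=
  Lp_on p Omega u /\ exists2 G, weak_gradient Omega u G &
    forall i, Lp_on p Omega (coors i \o G).

(** [div (|grad u|^(p-2) grad u) = 0] weakly in [Omega] *)
Definition p_harmonic (p : R) Omega u := forall f, test_function Omega f ->
  \int[lebesgue_rV n]_(x in Omega)
    (enorm (wgrad Omega u x) `^ (p - 2) *
     edot (wgrad Omega u x) (gradient f x)) = 0.

End sobolev.


Section problem.
Context {R : realType} {n : nat}.
Implicit Types (phi u v : 'rV[R]_n -> R).

Definition exterior : set 'rV[R]_n := ~` closure unit_ball.

(** The trace operator is the continuous extension, from [W^{1,p}(exterior)] to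
    [L^p(unit_sphere)], of the restriction to the sphere of functions that are
    smooth up to the boundary. *)
Definition has_trace (p : R) u phi :=
  exists v_ : nat -> 'rV[R]_n -> R,
  [/\ forall k, test_function setT (v_ k),
      Lp_cvg (lebesgue_rV n) p exterior v_ u,
      forall i, Lp_cvg (lebesgue_rV n) p exterior
        (fun k => partial i (v_ k)) (coors i \o wgrad exterior u) &
      Lp_cvg surface_measure p unit_sphere v_ phi].

Definition positivity_set u : set 'rV[R]_n := exterior `&` [set x | 0 < u x].

Definition admissible (p : R) phi u :=
  [/\ sobolev p exterior u, has_trace p u phi,
      open (positivity_set u), p_harmonic p (positivity_set u) u &
      lebesgue_rV n (positivity_set u) = 1%E].

Definition energy (p : R) u : \bar R :=
  (\int[lebesgue_rV n]_(x in exterior)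
    (enorm (wgrad exterior u x) `^ p)%:E)%E.

Definition is_minimizer (p : R) phi u :=
  admissible p phi u /\
  forall v, admissible p phi v -> (energy p u <= energy p v)%E.

Definition is_solution (p : R) phi u :=
  is_minimizer p phi u /\ {within exterior, continuous u}.

Definition radially_symmetric u :=
  exists g : R -> R, forall x, exterior x -> u x = g (enorm x).

(** [exterior] is open, so this is the boundary relative to [exterior]. *)
Definition free_boundary u : set 'rV[R]_n :=
  exterior `&` (closure (positivity_set u) `\` interior (positivity_set u)).

Definition sphere (c : 'rV[R]_n) (r : R) : set 'rV[R]_n :=
  [set x | enorm (x - c) = r].

End problem.

(* Main.v *)
Require Import Defs.
From HB Require Import structures.
From mathcomp Require Import all_boot all_order all_algebra.
From mathcomp Require Import all_classical all_reals all_analysis.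
From mathcomp Require Import measurable_realfun.
From mathcomp Require Import ring lra.
Set Implicit Arguments.
Unset Strict Implicit.
Unset Printing Implicit Defensive.
Import Order.TTheory GRing.Theory Num.Theory.
Import numFieldNormedType.Exports.
Local Open Scope classical_set_scope.
Local Open Scope ring_scope.

(** The comparison function is the radial p-harmonic function vanishing on the
    sphere of radius [r], where the ball of radius [r] minus the unit ball has
    volume 1.  Its gradient is [- h(|x|) x/|x|] with [h^(p-1)] proportional to
    [|x|^(1-n)], so that [h^(p-1) x/|x|] is a multiple of the divergence free
    field [x/|x|^n]: this is a calibration.  For an admissible [v] with
    positivity set [A], the flux of this field against [grad v] over [A] depends
    only on the boundary values.  Integrating over [A] the tangent line inequality
    [|grad v|^p >= p h^(p-1) s - (p-1) h^p], with [s] the inward radial derivative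
    of [v], bounds the energy from below by a constant minus
    [(p-1) int_A h^p], and since [h] is radially nonincreasing this last integral
    is largest when [A] is the annulus.  In the equality case the radial
    derivative of [v] is [-h] on [A] and 0 elsewhere; testing the flux identity
    with truncations of [u - v], and then of [v - u], gives [v = u]. *)

(** * Euclidean balls and Lebesgue measure *)

(** The flux identity carries the weight of the proof and is reached without a surface integral.
    Along a ray, x . grad w at l x is l times the derivative of l |-> w(l x). Weight the pairs (l,
    x) with |x| < 1 < l|x| by 1/l: integrating in l leaves the boundary value w(x/|x|), while
    substituting y = l x at fixed l and then integrating in l leaves x . grad w / (n |x|^n). The
    sphere is thus seen through the unit ball. A competitor is merely Sobolev and its positivity set
    A has no regular boundary, so the identity is applied to chi m(v), with m a C^1 truncation of
    the positive part and chi a radial cutoff; A appears as m sharpens and chi widens. A Lipschitz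
    m' lets L^1 approximation pass through the nonlinearity. For n = 1 the weight h is constant, so
    comparing integrals of h^p cannot identify A. It is recovered from U <= v, proved first, and
    from |A| = |N| = 1, where N is the annulus. Both comparisons use a cutoff with x . grad chi
    negative up to its edge: a function of zero trace whose radial derivative is nonpositive
    wherever it is positive must be nonpositive. *)

Section euclidean.
Context {R : realType} {n : nat}.
Implicit Types x y : 'rV[R]_n.

Lemma sqr_enorm x : enorm x ^+ 2 = \sum_(i < n) x ord0 i ^+ 2.
Proof. by rewrite sqr_sqrtr// sumr_ge0// => i _; rewrite sqr_ge0. Qed.

Lemma enorm_ge0 x : 0 <= enorm x.
Proof. exact: sqrtr_ge0. Qed.

Lemma enormZ (t : R) x : enorm (t *: x) = `|t| * enorm x.
Proof.
rewrite /enorm (_ : \sum_(i < n) _ = t ^+ 2 * \sum_(i < n) x ord0 i ^+ 2).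
  by rewrite sqrtrM ?sqr_ge0// sqrtr_sqr.
by rewrite mulr_sumr; apply: eq_bigr => i _; rewrite mxE exprMn.
Qed.

Lemma edotxx x : edot x x = enorm x ^+ 2.
Proof. by rewrite sqr_enorm; apply: eq_bigr => i _; rewrite expr2. Qed.

Lemma edotDr x y z : edot x (y + z) = edot x y + edot x z.
Proof. by rewrite /edot -big_split; apply: eq_bigr => i _; rewrite mxE mulrDr. Qed.

Lemma edotZr (t : R) x y : edot x (t *: y) = t * edot x y.
Proof. by rewrite /edot mulr_sumr; apply: eq_bigr => i _; rewrite mxE mulrCA. Qed.

Lemma edotZl (t : R) x y : edot (t *: x) y = t * edot x y.
Proof. by rewrite /edot mulr_sumr; apply: eq_bigr => i _; rewrite mxE mulrA. Qed.

Lemma edotC x y : edot x y = edot y x.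
Proof. by apply: eq_bigr => i _; rewrite mulrC. Qed.

Lemma edotBr x y z : edot x (y - z) = edot x y - edot x z.
Proof. by rewrite edotDr -scaleN1r edotZr mulN1r. Qed.

Lemma enorm_gt0 x : (0 < enorm x) = (x != 0).
Proof.
rewrite lt_neqAle enorm_ge0 andbT eq_sym -sqrf_eq0 sqr_enorm.
rewrite psumr_eq0; last by move=> i _; rewrite sqr_ge0.
congr (~~ _); apply/allP/eqP => [h|-> i _]; last by rewrite mxE expr0n/= eqxx.
apply/rowP => i; rewrite mxE; apply/eqP.
by have := h i (mem_index_enum i); rewrite sqrf_eq0.
Qed.

Lemma enorm0 : enorm (0 : 'rV[R]_n) = 0.
Proof. by rewrite -[X in enorm X](scale0r 0) enormZ normr0 mul0r. Qed.

(** Cauchy-Schwarz: with a = |x|^2, b = |y|^2 and c = x . y, the square |a y - c x|^2 equals a (a b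
    - c^2). *)
Lemma edot_le x y : `|edot x y| <= enorm x * enorm y.
Proof.
have [->|x0] := eqVneq x 0.
  by rewrite -[X in edot X _](scale0r 0) edotZl mul0r normr0 mulr_ge0// enorm_ge0.
have a0 : 0 < enorm x ^+ 2 by rewrite exprn_gt0// enorm_gt0.
rewrite -ler_sqr ?nnegrE ?mulr_ge0 ?enorm_ge0// real_normK ?num_real// exprMn.
pose a := enorm x ^+ 2; pose b := enorm y ^+ 2; pose c := edot x y.
have E : enorm (a *: y - c *: x) ^+ 2 = a * (a * b - c ^+ 2).
  rewrite -edotxx edotBr !edotZr ![edot (_ - _) _]edotC !edotBr !edotZr !edotxx.
  by rewrite (edotC y x) -/a -/b -/c; ring.
have := sqr_ge0 (enorm (a *: y - c *: x)).
by rewrite E pmulr_rge0// subr_ge0.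
Qed.

Lemma coor_le_enorm x i : `|x ord0 i| <= enorm x.
Proof.
rewrite -ler_sqr ?nnegrE ?enorm_ge0// real_normK ?num_real// sqr_enorm.
by rewrite (bigD1 i)//= lerDl sumr_ge0// => j _; rewrite sqr_ge0.
Qed.

Lemma norm_le_enorm x : `|x| <= enorm x.
Proof.
rewrite [leLHS]mx_normrE; elim/big_ind: _ => /=; first exact: enorm_ge0.
  by move=> a b; rewrite ge_max => -> ->.
by move=> [i j] _ /=; rewrite ord1; exact: coor_le_enorm.
Qed.

Lemma coor_le_norm x i : `|x ord0 i| <= `|x|.
Proof.
rewrite [leRHS]mx_normrE.
exact: (@le_bigmax _ _ _ 0 (fun i : 'I_1 * 'I_n => `|x i.1 i.2|) (ord0, i)).
Qed.

Lemma enorm_le_norm x : enorm x <= n%:R * `|x|.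
Proof.
rewrite -ler_sqr ?nnegrE ?enorm_ge0 ?mulr_ge0// sqr_enorm exprMn.
apply: (@le_trans _ _ (n%:R * `|x| ^+ 2)); last first.
  by rewrite ler_wpM2r ?sqr_ge0// -natrX ler_nat; case: n => // m; rewrite -mulnn leq_pmulr.
rewrite (_ : n%:R * _ = \sum_(i < n) `|x| ^+ 2); last by rewrite sumr_const card_ord mulr_natl.
apply: ler_sum => i _.
by rewrite -real_normK ?num_real// lerXn2r ?nnegrE// coor_le_norm.
Qed.

Lemma coors_continuous i : continuous (coors i : 'rV[R]_n -> R).
Proof. exact: coord_continuous. Qed.

Lemma sqr_enorm_continuous : continuous (fun x => enorm x ^+ 2).
Proof.
rewrite (_ : (fun x => _) = fun x => \sum_(i < n) (coors i x) ^+ 2); last first.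
  by apply/funext => x; rewrite sqr_enorm.
apply: (@continuous_big R) => [|i _ x]; first exact: add_continuous.
apply: (@continuous_comp _ _ _ (coors i) (fun t : R => t ^+ 2)); first exact: coors_continuous.
exact: exprn_continuous.
Qed.

Lemma enorm_continuous : continuous (@enorm R n).
Proof.
rewrite (_ : @enorm R n = Num.sqrt \o (fun x => enorm x ^+ 2)); last first.
  by apply/funext => x /=; rewrite sqrtr_sqr ger0_norm// enorm_ge0.
move=> x; apply: continuous_comp; first exact: sqr_enorm_continuous.
exact: sqrt_continuous.
Qed.

Definition box (a b : 'rV[R]_n) : set 'rV[R]_n :=
  [set x | forall i, a ord0 i < x ord0 i < b ord0 i].

Definition cbox (a b : 'rV[R]_n) : set 'rV[R]_n :=
  [set x | forall i, a ord0 i <= x ord0 i <= b ord0 i].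

Lemma measurable_itv_coor i (J : interval R) :
  measurable [set x : 'rV[R]_n | x ord0 i \in J].
Proof.
have := @measurable_coors R n i measurableT _ (measurable_itv J).
by rewrite setTI.
Qed.

Lemma measurable_box a b : measurable (box a b).
Proof.
rewrite (_ : box a b = \bigcap_(i in [set: 'I_n]) [set x | x ord0 i \in `]a ord0 i, b ord0 i[]).
  by apply: fin_bigcap_measurable => // i _; exact: measurable_itv_coor.
apply/seteqP; split => x /= h i; first by move=> _; rewrite /= in_itv/= h.
by have := h i I; rewrite /= in_itv.
Qed.

Lemma measurable_cbox a b : measurable (cbox a b).
Proof.
rewrite (_ : cbox a b = \bigcap_(i in [set: 'I_n]) [set x | x ord0 i \in `[a ord0 i, b ord0 i]]).
  by apply: fin_bigcap_measurable => // i _; exact: measurable_itv_coor.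
apply/seteqP; split => x /= h i; first by move=> _; rewrite /= in_itv/= h.
by have := h i I; rewrite /= in_itv.
Qed.

(** The boxes have rational centres and half-widths 1/(m+1), enumerated by [pickle]; [P] keeps those
    whose closed box stays in [A]. The closed boxes are compact subsets of [A], where local
    integrability can be used. *)
Lemma open_bigcup_box (A : set 'rV[R]_n) : open A ->
  exists (P : set nat) (a b : nat -> 'rV[R]_n),
    A = \bigcup_(k in P) box (a k) (b k) /\
    forall k, P k -> cbox (a k) (b k) `<=` A.
Proof.
move=> oA.
pose a k : 'rV[R]_n := if @unpickle ('rV[rat]_n * nat)%type k is Some (q, m) then
  \row_i (ratr (q ord0 i) - m.+1%:R^-1) else 0.
pose b k : 'rV[R]_n := if @unpickle ('rV[rat]_n * nat)%type k is Some (q, m) then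
  \row_i (ratr (q ord0 i) + m.+1%:R^-1) else 0.
pose P := [set k | cbox (a k) (b k) `<=` A].
exists P, a, b; split=> //; apply/seteqP; split; last first.
  by move=> x [k Pk bx]; apply: Pk => i; have /andP[/ltW -> /ltW ->] := bx i.
move=> x Ax.
have : nbhs x A by exact: open_nbhs_nbhs.
move=> /nbhs_ballP[e /= e0 xe].
(* A box of half-width 1/(m+1) < e/2 that contains x has all its points within e of x. *)
have [m me] : exists m : nat, m.+1%:R^-1 < e / 2.
  have := @near_infty_natSinv_lt R (PosNum (divr_gt0 e0 (@ltr0Sn R 1))).
  by move=> [m _ /(_ m (leqnn m)) mm]; exists m.
have m0 : 0 < m.+1%:R^-1 :> R by rewrite invr_gt0 ltr0Sn.
have q_ (i : 'I_n) : {q : rat | ratr q \in `]x ord0 i - m.+1%:R^-1, x ord0 i + m.+1%:R^-1[}.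
  apply: cid; have [|q qx] := @rat_in_itvoo R (x ord0 i - m.+1%:R^-1) (x ord0 i + m.+1%:R^-1).
    by rewrite ltrD2l gtrN.
  by exists q.
pose q : 'rV[rat]_n := \row_i sval (q_ i).
exists (pickle (q, m)) => [y|i]; rewrite /a /b pickleK.
  move=> h; apply: xe; rewrite -ball_normE /=.
  rewrite (_ : `|x - y| = \big[Num.max/0]_ij `|(x - y) ij.1 ij.2|); last exact: mx_normrE.
  apply: (big_ind (fun z => z < e)) => // [z t ze te|[i j] _ /=]; first by rewrite gt_max ze.
  rewrite ord1 !mxE.
  have := h j; rewrite !mxE; case: (q_ j) => r /=; rewrite in_itv/= => /andP[h1 h2] /andP[h3 h4].
  move: me h1 h2 h3 h4; set r' := m.+1%:R^-1 => *.
  by rewrite ltr_norml; apply/andP; split; lra.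
rewrite !mxE; case: (q_ i) => r /=; rewrite in_itv/= => /andP[h1 h2].
by move: h1 h2; set r' := m.+1%:R^-1 => *; apply/andP; split; lra.
Qed.

End euclidean.

(** * Open sets and continuous functions are measurable *)

Section borel.
Context {R : realType} {n : nat}.

Lemma open_measurable_rV (A : set 'rV[R]_n) : open A -> measurable A.
Proof.
move=> /open_bigcup_box[P [a [b [-> _]]]].
by apply: bigcup_measurable => k _; exact: measurable_box.
Qed.

Lemma closed_measurable_rV (A : set 'rV[R]_n) : closed A -> measurable A.
Proof.
move=> cA; rewrite -[A]setCK; apply: measurableC; apply: open_measurable_rV.
exact: closed_openC.
Qed.

Lemma compact_measurable_rV (A : set 'rV[R]_n) : compact A -> measurable A.
Proof.
by move=> cA; apply: closed_measurable_rV; apply: compact_closed.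
Qed.

Lemma continuous_measurable_rV (f : 'rV[R]_n -> R) :
  continuous f -> measurable_fun setT f.
Proof.
move=> /continuousP cf; apply: (measurability _ (RGenOpens.measurableE R)).
move=> _ [_ [a [b ->] <-]]; rewrite setTI; apply: open_measurable_rV.
exact/cf/interval_open.
Qed.

Lemma measurable_scale : measurable_fun setT (fun z : R * 'rV[R]_n => z.1 *: z.2).
Proof.
apply: measurable_fun_rV => i.
rewrite (_ : _ \o _ = fun z => z.1 * coors i z.2).
  apply: measurable_funM; first exact: measurable_fst.
  by apply: measurableT_comp; [exact: measurable_coors|exact: measurable_snd].
by apply/funext => z; rewrite /coors/= mxE.
Qed.

Lemma measurable_scalel (t : R) : measurable_fun setT ( *:%R t : 'rV[R]_n -> 'rV[R]_n).
Proof. exact: (measurable_fun_pair2 t measurable_scale). Qed.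

End borel.

(** * Iterated integrals, splitting off the first coordinate *)

Section tonelli_fubini.
Local Open Scope ereal_scope.
Context {R : realType} {n : nat}.
Local Notation leb := (@lebesgue_measure R).

(** [lebesgue_rV n.+1] unfolds to the image under [cons_rV] of a product measure, so a change of
    variables followed by Tonelli suffices. *)
Lemma ge0_integral_rVS (f : 'rV[R]_n.+1 -> \bar R) :
  measurable_fun setT f -> (forall x, 0 <= f x) ->
  \int[lebesgue_rV n.+1]_x f x =
  \int[leb]_a \int[lebesgue_rV n]_y f (cons_rV (a, y)).
Proof.
move=> mf f0.
have mc := @measurable_cons_rV R n.
have mfc : measurable_fun setT (f \o cons_rV) by exact: measurableT_comp.
transitivity (\int[leb \x lebesgue_rV n]_z (f \o cons_rV) z).
  transitivity (\int[pushforward (leb \x lebesgue_rV n) cons_rV]_x f x); first by [].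
  by rewrite ge0_integral_pushforward// preimage_setT.
by rewrite (@fubini_tonelli1 _ _ _ _ R leb (lebesgue_rV n) (f \o cons_rV) mfc (fun z => f0 _)).
Qed.

Lemma integral_rVS (f : 'rV[R]_n.+1 -> \bar R) :
  (lebesgue_rV n.+1).-integrable setT f ->
  \int[lebesgue_rV n.+1]_x f x =
  \int[leb]_a \int[lebesgue_rV n]_y f (cons_rV (a, y)).
Proof.
move=> /integrableP[mf foo].
have mc := @measurable_cons_rV R n.
have mfc : measurable_fun setT (f \o cons_rV) by exact: measurableT_comp.
have ic : (leb \x lebesgue_rV n).-integrable setT (f \o cons_rV).
  apply/integrableP; split; first exact: measurableT_comp.
  rewrite ge0_integral_rVS// in foo; last exact: measurableT_comp.
  apply: le_lt_trans foo; rewrite le_eqVlt; apply/orP; left; apply/eqP.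
  have mfc' : measurable_fun setT (fun z => `|f (cons_rV z)|) by exact: measurableT_comp.
  by rewrite (@fubini_tonelli1 _ _ _ _ R leb (lebesgue_rV n) (fun z => `|f (cons_rV z)|) mfc' (fun z => abse_ge0 _)).
transitivity (\int[leb \x lebesgue_rV n]_z (f \o cons_rV) z).
  transitivity (\int[pushforward (leb \x lebesgue_rV n) cons_rV]_x f x); first by [].
  by rewrite integral_pushforward// preimage_setT.
by rewrite -(@integral12_prod_meas1 _ _ _ _ R leb (lebesgue_rV n) (f \o cons_rV) ic).
Qed.

End tonelli_fubini.

(** * Lebesgue measure under dilations *)

Section scaling.
Local Open Scope ereal_scope.
Context {R : realType}.

(** By uniqueness of Lebesgue measure: t times its image under multiplication by t has the right
    value on half-open intervals. *)
Lemma ge0_integral_scale1 (t : R) (f : R -> \bar R) : (0 < t)%R ->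
  measurable_fun setT f -> (forall x, 0 <= f x) ->
  \int[@lebesgue_measure R]_x f (t * x)%R =
  t^-1%:E * \int[@lebesgue_measure R]_x f x.
Proof.
move=> t0 mf f0.
have mt : measurable_fun setT ( *%R t : measurableTypeR R -> measurableTypeR R).
  exact: mulrl_measurable.
have t1 : (0 <= t)%R by exact: ltW.
pose nu := mscale (NngNum t1) (pushforward (@lebesgue_measure R) ( *%R t : measurableTypeR R -> measurableTypeR R)).
have nuE A : measurable A -> lebesgue_measure A = nu mt A.
  apply: lebesgue_measure_unique => _ [[a b]] _ <-.
  transitivity (t%:E * lebesgue_measure ( *%R t @^-1` `]a, b]))%E; last by [].
  rewrite (_ : _ @^-1` _ = `](a / t)%R, (b / t)%R]%classic); last first.
    apply/seteqP; split => x /=; rewrite !in_itv/= ltr_pdivrMr// ler_pdivlMr//;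
    by rewrite [(x * t)%R]mulrC.
  rewrite !lebesgue_measure_itv/= !lte_fin ltr_pM2r ?invr_gt0//.
  case: ifPn; rewrite ?mule0// => ab; rewrite -!EFinD -EFinM; congr EFin.
  by field; rewrite gt_eqF.
transitivity (\int[pushforward (@lebesgue_measure R) ( *%R t : measurableTypeR R -> measurableTypeR R)]_x f x).
  by rewrite ge0_integral_pushforward// preimage_setT.
rewrite [in RHS](eq_measure_integral (nu mt)); last by move=> A mA _; exact: nuE.
rewrite ge0_integral_mscale// muleA -EFinM mulVf ?gt_eqF// mul1e.
by [].
Qed.

Lemma ge0_integral_scale n (t : R) (f : 'rV[R]_n -> \bar R) : (0 < t)%R ->
  measurable_fun setT f -> (forall x, 0 <= f x) ->
  \int[lebesgue_rV n]_x f (t *: x)%R = (t ^- n)%:E * \int[lebesgue_rV n]_x f x.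
Proof.
move=> t0; elim: n f => [|n IH] f mf f0.
  rewrite expr0 invr1 mul1e; apply: eq_integral => x _; congr (f _).
  by apply/rowP; case.
have mft : measurable_fun setT (fun x : 'rV[R]_n.+1 => f (t *: x)%R).
  by apply: (measurableT_comp mf); exact: measurable_scalel.
rewrite !ge0_integral_rVS//.
have cE a y : (t *: cons_rV (a, y) = cons_rV (t * a, t *: y) :> 'rV[R]_n.+1)%R.
  by rewrite /cons_rV /= [LHS](@scale_row_mx _ 1 1 n) scale_scalar_mx.
have mc := @measurable_cons_rV R n.
have mfc a : measurable_fun setT (fun y : 'rV[R]_n => f (cons_rV (a, y))).
  apply: measurableT_comp => //.
  exact: (measurable_fun_pair2 a mc).
have mF : measurable_fun setT (fun a => \int[lebesgue_rV n]_y f (cons_rV (a, y))).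
  apply: (measurable_fun_fubini_tonelli_F (f \o cons_rV)) => [|z]; last exact: f0.
  exact: measurableT_comp.
transitivity (\int[lebesgue_measure]_a ((t ^- n)%:E *
    (fun a => \int[lebesgue_rV n]_y f (cons_rV (a, y))) (t * a)%R)).
  apply: eq_integral => a _ /=.
  rewrite -(IH (fun y => f (cons_rV ((t * a)%R, y))))//.
  by apply: eq_integral => y _; rewrite cE.
move: mF; set F := (F in measurable_fun _ F) => mF.
have F0 a : 0 <= F a by exact: integral_ge0.
rewrite (@ge0_integralZl _ _ _ lebesgue_measure setT measurableT (fun a => F (t * a)%R)).
- by rewrite (ge0_integral_scale1 t0 mF)// muleA -EFinM -invfM -exprSr.
- by apply: (measurableT_comp mF); exact: mulrl_measurable.
- by move=> a _; exact: F0.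
- by rewrite lee_fin invr_ge0 exprn_ge0// ltW.
Qed.

Lemma lebesgue_rV_scale n (t : R) (A : set 'rV[R]_n) : (0 < t)%R -> measurable A ->
  lebesgue_rV n ( *:%R t @^-1` A) = (t ^- n)%:E * lebesgue_rV n A.
Proof.
move=> t0 mA; have mtA : measurable ( *:%R t @^-1` A : set 'rV[R]_n).
  by rewrite -[X in measurable X]setTI; exact: measurable_scalel.
have mI : measurable_fun setT (fun x : 'rV[R]_n => (\1_A x)%:E : \bar R).
  by apply/measurable_EFinP; exact: measurable_indic.
have := ge0_integral_scale t0 mI ltac:(by move=> x; rewrite lee_fin).
rewrite [X in _ * X](integral_indic (lebesgue_rV n) measurableT mA) setIT => <-.
by rewrite -[in LHS](setIT (_ @^-1` _)) -integral_indic.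
Qed.

End scaling.

(** * Euclidean balls and their volumes *)

Section balls.
Local Open Scope ereal_scope.
Context {R : realType} {n : nat}.
Local Notation mu := (@lebesgue_rV R n).

Definition eball (r : R) : set 'rV[R]_n := [set x | (enorm x < r)%R].
Definition ecball (r : R) : set 'rV[R]_n := [set x | (enorm x <= r)%R].

Lemma open_eball r : open (eball r).
Proof.
rewrite (_ : eball r = enorm @^-1` [set x | (x < r)%R])//.
by move/continuousP : (@enorm_continuous R n); apply; exact: open_lt.
Qed.

Lemma closed_ecball r : closed (ecball r).
Proof.
rewrite (_ : ecball r = enorm @^-1` [set x | (x <= r)%R])//.
move/continuous_closedP : (@enorm_continuous R n); apply; exact: closed_le.
Qed.

Lemma measurable_eball r : measurable (eball r).
Proof. by apply: open_measurable_rV; exact: open_eball. Qed.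

Lemma measurable_ecball r : measurable (ecball r).
Proof. by apply: closed_measurable_rV; exact: closed_ecball. Qed.

Lemma compact_ecball r : compact (ecball r).
Proof.
apply: bounded_closed_compact; last exact: closed_ecball.
exists r; split; first exact: num_real.
by move=> x rx y yr /=; apply: le_trans (norm_le_enorm y) (le_trans yr (ltW rx)).
Qed.

Lemma compact_sub_ecball (K : set 'rV[R]_n) : compact K ->
  exists2 r, (0 < r)%R & K `<=` ecball r.
Proof.
move=> /compact_bounded[M [_ KM]].
exists (n%:R * (`|M| + 1) + 1)%R => [|x Kx].
  by rewrite ltr_wpDl// mulr_ge0// addr_ge0.
apply: le_trans (enorm_le_norm x) _; rewrite ler_wpDr// ler_wpM2l//.
by apply: KM => //; rewrite (le_lt_trans (ler_norm M))// ltrDl.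
Qed.

End balls.

Section ball_measure.
Local Open Scope ereal_scope.
Context {R : realType}.

Lemma lebesgue_rV_cbox n (a b : 'rV[R]_n) : lebesgue_rV n (cbox a b) < +oo.
Proof.
elim: n a b => [|n IH] a b /=.
  by rewrite diracE ltry.
rewrite /lebesgue_step.
pose A := `[a ord0 ord0, b ord0 ord0]%classic.
pose B := cbox (rsubmx (a : 'rV_(1 + n))) (rsubmx (b : 'rV_(1 + n))).
rewrite (_ : _ @^-1` _ = A `*` B).
  rewrite product_measure1E; [|exact: measurable_itv|exact: measurable_cbox].
  have Af : @lebesgue_measure R A \is a fin_num by rewrite /A lebesgue_measure_itv/=; case: ifP.
  by rewrite lte_mul_pinfty ?IH.
apply/seteqP; split=> [[t y] /= h|[t y] /= [hA hB] i].
  split; rewrite /A /B /=.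
    have := h ord0; rewrite in_itv/= /cons_rV.
    have -> : ord0 = lshift n (ord0 : 'I_1) :> 'I_(1 + n) by exact/val_inj.
    by rewrite (@row_mxEl _ 1 1 n) mxE eqxx mulr1n.
  by move=> i; have := h (rshift 1 i); rewrite /cons_rV (@row_mxEr _ 1 1 n) !mxE.
rewrite /cons_rV.
case: (splitP (i : 'I_(1 + n))) => j ij.
  have -> : i = lshift n (ord0 : 'I_1) :> 'I_(1 + n) by apply/val_inj; rewrite /= ij ord1.
  rewrite (@row_mxEl _ 1 1 n) mxE eqxx mulr1n; move: hA; rewrite /A/= in_itv/=.
  by have -> : ord0 = lshift n (ord0 : 'I_1) :> 'I_(1 + n) by exact/val_inj.
have -> : i = rshift 1 j :> 'I_(1 + n) by exact/val_inj.
by have := hB j; rewrite (@row_mxEr _ 1 1 n) !mxE.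
Qed.

Lemma lebesgue_rVT_gt0 n : 0 < lebesgue_rV n [set: 'rV[R]_n].
Proof.
elim: n => [|n IH] /=; first by rewrite diracT.
rewrite /lebesgue_step preimage_setT -setXTT product_measure1E//.
rewrite mule_gt0//.
apply: (@lt_le_trans _ _ (@lebesgue_measure R setT)) => //.
by rewrite -set_itvNyy lebesgue_measure_itv/=; exact: (ltry 0).
Qed.

Section fixed_dim.
Variable n : nat.
Local Notation mu := (@lebesgue_rV R n).

Lemma lebesgue_rV_ecball (r : R) : mu (ecball r) < +oo.
Proof.
apply: le_lt_trans (@lebesgue_rV_cbox n (const_mx (- r)%R) (const_mx r)).
apply: le_measure; rewrite ?inE//; [exact: measurable_ecball|exact: measurable_cbox|].
by move=> x /= xr i; rewrite !mxE -ler_norml (le_trans (coor_le_enorm x i)).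
Qed.

Lemma eball_scale (r : R) : (0 < r)%R -> eball 1 = *:%R r @^-1` eball r :> set 'rV[R]_n.
Proof.
move=> r0; by apply/seteqP; split => x; rewrite /eball /= enormZ gtr0_norm// gtr_pMr.
Qed.

Lemma lebesgue_eball (r : R) : (0 < r)%R -> mu (eball r) = (r ^+ n)%:E * mu (eball 1).
Proof.
move=> r0; rewrite (eball_scale r0) lebesgue_rV_scale//; last exact: measurable_eball.
by rewrite muleA -EFinM mulfV ?mul1e// expf_neq0// gt_eqF.
Qed.

(** If the unit ball were null, so would be all its dilates, and countably many of them cover the
    whole space, which has positive measure. *)
Lemma lebesgue_eball1_gt0 : 0 < mu (eball 1).
Proof.
rewrite lt_neqAle measure_ge0 andbT; apply/negP => /eqP b0.
have := lebesgue_rVT_gt0 n; rewrite (_ : setT = \bigcup_k eball k.+1%:R).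
  rewrite ltNge => /negP; apply.
  apply: (@le_trans _ _ (\sum_(k <oo) mu (eball k.+1%:R))).
    apply: measure_sigma_subadditive => //; first by move=> k; exact: measurable_eball.
    by apply: bigcup_measurable => k _; exact: measurable_eball.
  by rewrite eseries0// => k _ _; rewrite lebesgue_eball// -b0 mule0.
apply/seteqP; split => // x _.
exists (Num.truncn (enorm x)) => //=.
by rewrite /eball/=; have /andP[] := truncn_itv (enorm_ge0 x).
Qed.

Lemma lebesgue_eball1_lty : mu (eball 1) < +oo.
Proof.
apply: le_lt_trans (lebesgue_rV_ecball 1).
apply: le_measure; rewrite ?inE; [exact: measurable_eball|exact: measurable_ecball|].
by move=> x /ltW.
Qed.

Definition vball : R := fine (mu (eball 1)).

Lemma vballE : mu (eball 1) = vball%:E.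
Proof. by rewrite /vball fineK// ge0_fin_numE// lebesgue_eball1_lty. Qed.

Lemma vball_gt0 : (0 < vball)%R.
Proof. by rewrite -lte_fin -vballE lebesgue_eball1_gt0. Qed.

(** The closed ball lies in every open ball of radius r > 1, of volume r^n [vball]; let r tend to 1.
    In other words, the sphere has no volume. *)
Lemma lebesgue_ecball1 : mu (ecball 1) = vball%:E.
Proof.
apply/eqP; rewrite eq_le; apply/andP; split; last first.
  rewrite -vballE; apply: le_measure; rewrite ?inE.
  - exact: measurable_eball.
  - exact: measurable_ecball.
  - by move=> x /ltW.
have h (r : R) : (1 < r)%R -> mu (ecball 1) <= (r ^+ n * vball)%:E.
  move=> r1; rewrite EFinM -vballE -lebesgue_eball ?(lt_trans ltr01)//.
  apply: le_measure; rewrite ?inE; [exact: measurable_ecball|exact: measurable_eball|].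
  by move=> x /= /le_lt_trans; apply.
have f : mu (ecball 1) \is a fin_num by rewrite ge0_fin_numE// lebesgue_rV_ecball.
move: h; rewrite -(fineK f); set m := fine _ => h; rewrite lee_fin.
have c : (r ^+ n * vball)%R @[r --> (1:R)^'+] --> (1 ^+ n * vball)%R.
  apply: cvgMl; apply: cvg_at_right_filter; exact: exprn_continuous.
rewrite expr1n mul1r in c.
rewrite -(cvg_lim _ c)//; apply: limr_ge; first by apply/cvg_ex; exists vball.
by near=> r; rewrite -lee_fin; apply: h; near: r; exact: nbhs_right_gt.
Unshelve. all: by end_near. Qed.

Lemma lebesgue_annulus (r : R) : (1 < r)%R ->
  mu (eball r `\` ecball 1) = ((r ^+ n - 1) * vball)%:E.
Proof.
move=> r1; rewrite measureD; [|exact: measurable_eball|exact: measurable_ecball|].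
  rewrite setIidr; last by move=> x /= /le_lt_trans; apply.
  rewrite mulrBl mul1r EFinB; congr (_ - _); last exact: lebesgue_ecball1.
  by rewrite EFinM -vballE -lebesgue_eball// (lt_trans ltr01).
by apply: le_lt_trans (lebesgue_rV_ecball r); apply: le_measure;
  rewrite ?inE; [exact: measurable_eball|exact: measurable_ecball|move=> x /ltW].
Qed.

End fixed_dim.
End ball_measure.

(** * Directional derivatives and integration by parts *)

Section directional.
Context {R : realType}.

(** A difference quotient only sees the values on one line. This is the bridge between directional
    derivatives, derivatives of slices and derivatives in one variable. *)
Lemma is_derive_line (V V' : normedModType R) (f : V -> R) (g : V' -> R)
    x v y w (d : R) :
  (forall h : R, f (h *: v + x) = g (h *: w + y)) ->
  is_derive y w g d -> is_derive x v f d.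
Proof.
move=> fg [dg <-].
have E : (fun h : R => h^-1 *: ((f \o shift x) (h *: v) - f x)) =
         (fun h => h^-1 *: ((g \o shift y) (h *: w) - g y)).
  apply/funext => h /=; rewrite fg; congr (_ *: (_ - _)).
  by have := fg 0; rewrite !scale0r !add0r.
by split; rewrite /derivable /derive E.
Qed.

Context {V : normedModType R}.
Implicit Types f : V -> R.

Lemma is_derive_cvg f x v (d : R) :
  (fun h => h^-1 *: ((f \o shift x) (h *: v) - f x)) @ 0^' --> d ->
  is_derive x v f d.
Proof.
by move=> h; split; [apply/cvg_ex; exists d|exact: cvg_lim h].
Qed.

Lemma line_MVT f v y (s : R) : (forall z, derivable f z v) ->
  exists t, `|t| <= `|s| /\ f (s *: v + y) - f y = s * 'D_v f (t *: v + y).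
Proof.
move=> df; pose phi (t : R) := f (t *: v + y).
have dphi (t : R) : is_derive t (1 : R) phi ('D_v f (t *: v + y)).
  apply: (is_derive_line _ (derivableP (df _))) => h.
  by rewrite /phi scalerDl -addrA [_ *: 1]mulr1.
have cphi (a b : R) : {within `[a, b], continuous phi}.
  apply: continuous_subspaceT => t; apply: differentiable_continuous.
  by apply/derivable1_diffP; have [] := dphi t.
have phi0 : phi 0 = f y by rewrite /phi scale0r add0r.
have [s0|s0] := leP 0 s.
  have [t] := MVT_segment s0 (fun t _ => dphi t) (cphi 0 s).
  rewrite in_itv/= subr0 phi0 => /andP[t0 ts] E; exists t.
  by rewrite !ger0_norm// E mulrC.
have [t] := MVT_segment (ltW s0) (fun t _ => dphi t) (cphi s 0).
rewrite in_itv/= sub0r phi0 => /andP[t0 ts] E; exists t; split.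
  by rewrite !ler0_norm ?lerN2// ltW.
by rewrite -[LHS]opprB E mulrN opprK mulrC.
Qed.

(** The increment along [c *: v] is handled by the mean value theorem; its intermediate point tends
    to x, where ['D_v f] is continuous. Adding basis vectors one at a time yields linearity in the
    direction, [C1_derive]. *)
Lemma is_derive_add f x w v (d c : R) : is_derive x w f d ->
  (forall y, derivable f y v) -> continuous ('D_v f) ->
  is_derive x (w + c *: v) f (d + c * 'D_v f x).
Proof.
move=> dw df cD; apply: is_derive_cvg.
have [t tP] := choice (fun h : R => line_MVT (h *: w + x) (h * c) df).
have t0 : t h @[h --> (0 : R)^'] --> (0 : R).
  apply: norm_cvg0.
  apply: (@squeeze_cvgr _ _ _ _ (cst 0) (fun h => `|h * c|)); last 2 first.
  - exact: cvg_cst.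
  - rewrite -[X in _ --> X](normr0 R) -[X in `|X|](mul0r c).
    apply: cvg_norm; apply: cvgMl; exact: cvg_within.
  by apply: nearW => h; rewrite normr_ge0/=; have [] := tP h.
have P : t h *: v + (h *: w + x) @[h --> (0 : R)^'] --> x.
  rewrite -[X in _ --> X]add0r -[X in _ --> X + _](scale0r v).
  apply: cvgD; first exact: cvgZr_tmp.
  rewrite -[X in _ --> X]add0r -[X in _ --> X + _](scale0r w).
  apply: cvgD; last exact: cvg_cst.
  by apply: cvgZr_tmp; exact: cvg_within.
have B : c * 'D_v f (t h *: v + (h *: w + x)) @[h --> (0 : R)^'] --> c * 'D_v f x.
  apply: cvgMr; apply: (cvg_comp (fun h => t h *: v + (h *: w + x)) ('D_v f) P).
  exact: cD.
have A : h^-1 *: ((f \o shift x) (h *: w) - f x) @[h --> (0 : R)^'] --> d.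
  by have [dA <-] := dw.
apply: (cvg_trans _ (cvgD A B)); apply: near_eq_cvg.
near=> h => /=.
have h0 : h != 0 by near: h; exact: nbhs_dnbhs_neq.
have [_ Eh] := tP h.
have E1 : h *: (w + c *: v) + x = (h * c) *: v + (h *: w + x).
  by rewrite scalerDr scalerA addrA; congr (_ + _); exact: addrC.
rewrite E1 (_ : f ((h * c) *: v + _) - f x = h * c * 'D_v f (t h *: v + (h *: w + x)) +
  (f (h *: w + x) - f x)); last by rewrite -Eh [RHS]addrA subrK.
rewrite scalerDr addrC; congr (_ + _).
by rewrite /GRing.scale/= !mulrA mulVf// mul1r.
Unshelve. all: by end_near. Qed.

Lemma is_derive_near0 f (O : set V) x v : open O -> O x -> (forall y, O y -> f y = 0) ->
  is_derive x v f 0.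
Proof.
move=> oO Ox f0; apply: is_derive_cvg.
apply: (@cvg_trans _ (cst (0 : R) @ (0 : R)^')); last exact: cvg_cst.
apply: near_eq_cvg; near=> h => /=.
rewrite f0; last first.
  near: h; apply: cvg_within.
  have : (fun h : R => h *: v + x) @ (0 : R) --> x.
    rewrite -[X in _ --> X]add0r -[X in _ --> X + _](scale0r v).
    by apply: cvgD; [apply: cvgZr_tmp; exact: cvg_id|exact: cvg_cst].
  by apply; exact: open_nbhs_nbhs.
by rewrite f0// subr0 scaler0.
Unshelve. all: by end_near. Qed.

End directional.

(** * C^1 functions and bounded support *)

Section C1.
Context {R : realType} {n : nat}.
Implicit Types f : 'rV[R]_n -> R.

Definition C1 f := continuous f /\
  forall i, continuous (partial i f) /\ forall x, derivable f x (delta_mx ord0 i).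

Definition bsupp f := exists2 r : R, 0 < r & forall x, r <= enorm x -> f x = 0.

Lemma C1_derive f x w : C1 f -> is_derive x w f (edot w (gradient f x)).
Proof.
move=> [_ Cf].
have E (s : seq 'I_n) : is_derive x (\sum_(i <- s) w ord0 i *: delta_mx ord0 i) f
    (\sum_(i <- s) w ord0 i * partial i f x).
  elim: s => [|i s IH]; first by rewrite !big_nil; exact: is_derive0.
  rewrite !big_cons addrC [X in is_derive _ _ _ X]addrC.
  by have [ci di] := Cf i; apply: is_derive_add.
have := E (index_enum 'I_n); rewrite -row_sum_delta => H.
apply: is_derive_eq; apply: eq_bigr => i _; by rewrite mxE.
Qed.

Lemma continuous_bsupp_bounded f : continuous f -> bsupp f ->
  exists2 M : R, 0 < M & forall x, `|f x| <= M.
Proof.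
move=> cf [r r0 fr].
have c0 : continuous (fun x => `|f x|).
  by move=> x; exact: (cvg_norm (cf x)).
have e0 : (ecball r : set 'rV[R]_n) !=set0 by exists (0 : 'rV[R]_n); rewrite /ecball/= enorm0 ltW.
have [x _ xM] := @EVT_max_rV R n (fun x => `|f x|) (ecball r) e0
  (@compact_ecball R n r) (continuous_subspaceT c0).
exists (`|f x| + 1) => [|y]; first by rewrite ltr_wpDl.
rewrite ler_wpDr//; have [ry|yr] := leP r (enorm y); first by rewrite fr// normr0.
by apply: xM; rewrite inE /ecball/= ltW.
Qed.

Lemma bounded_integrable (D : set 'rV[R]_n) (f : 'rV[R]_n -> R) (M : R) :
  measurable D -> (lebesgue_rV n D < +oo)%E -> measurable_fun D f ->
  (forall x, D x -> `|f x| <= M) -> (lebesgue_rV n).-integrable D (EFin \o f).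
Proof.
move=> mD Doo mf fM; apply: measurable_bounded_integrable => //.
by exists M; split; [exact: num_real|move=> N MN x Dx /=; rewrite (le_trans (fM _ Dx))// ltW].
Qed.

Lemma continuous_bsupp_integrable f : continuous f -> bsupp f ->
  (lebesgue_rV n).-integrable setT (EFin \o f).
Proof.
move=> cf bf; have [M M0 fM] := continuous_bsupp_bounded cf bf.
have [r r0 fr] := bf.
have I : (lebesgue_rV n).-integrable (ecball r) (EFin \o f).
  apply: (@bounded_integrable _ _ M); first exact: measurable_ecball.
  - exact: lebesgue_rV_ecball.
  - by apply: measurable_funTS; exact: continuous_measurable_rV.
  - by move=> x _.
rewrite (_ : EFin \o f = (EFin \o f) \_ (ecball r)).
  apply/integrable_restrict => //; first exact: measurable_ecball.
  by rewrite setTI.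
apply/funext => x; rewrite patchE; case: ifPn => // /negP xr /=.
by rewrite fr// leNgt; apply/negP => h; apply: xr; rewrite inE /ecball/= ltW.
Qed.

Lemma edot_gradient_continuous f : C1 f -> continuous (fun x => edot x (gradient f x)).
Proof.
move=> [_ Cf].
rewrite (_ : (fun x => _) = fun x => \sum_(i < n) coors i x * partial i f x); last first.
  by apply/funext => x; apply: eq_bigr => i _; rewrite mxE.
apply: (@continuous_big R) => [|i _ x]; first exact: add_continuous.
exact: (cvgM (@coors_continuous R n i x) ((Cf i).1 x)).
Qed.

Lemma bsupp_gradient f : bsupp f -> exists2 r : R, 0 < r &
  forall x, r <= enorm x -> f x = 0 /\ gradient f x = 0.
Proof.
move=> bf; have [r r0 fr] := bf; exists (r + 1) => [|x rx]; first by rewrite addr_gt0.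
have rx' : r < enorm x by rewrite (lt_le_trans _ rx)// ltrDl.
split; first by rewrite fr// ltW.
apply/rowP => i; rewrite !mxE.
have oO : open [set y : 'rV[R]_n | r < enorm y].
  rewrite (_ : [set y | _] = enorm @^-1` [set t | r < t])//.
  by move/continuousP : (@enorm_continuous R n); apply; exact: open_gt.
have := @is_derive_near0 _ _ f _ x (delta_mx ord0 i) oO rx'.
by case => // y yr; rewrite fr// ltW.
Qed.

End C1.

(** * The integral of a partial derivative vanishes *)

Section integral_partial.
Context {R : realType}.

Lemma C1_1d_integral0 (g : R -> R) (r : R) : 0 < r ->
  (forall t, derivable g t 1) -> continuous ('D_1 g) ->
  (forall t, r <= `|t| -> g t = 0 /\ 'D_1 g t = 0) ->
  (\int[@lebesgue_measure R]_t ('D_1 g t)%:E = 0)%E.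
Proof.
move=> r0 dg cg gr.
have cg0 : continuous g.
  by move=> t; apply: differentiable_continuous; apply/derivable1_diffP.
transitivity (\int[@lebesgue_measure R]_(t in `[(- r)%R, r]) ('D_1 g t)%:E)%E.
  rewrite [RHS]integral_mkcond; apply: eq_integral => t _.
  rewrite patchE; case: ifPn => // /negP tr.
  have [|_ ->//] := gr t.
  rewrite leNgt; apply/negP; rewrite ltr_norml => /andP[h1 h2]; apply: tr.
  by rewrite inE/= in_itv/= !ltW.
rewrite (@continuous_FTC2 _ ('D_1 g) g)//.
- have [|-> _] := gr r; first exact: ler_norm.
  have [|-> _] := gr (- r); first by rewrite normrN ler_norm.
  by rewrite subee.
- by rewrite (lt_trans _ r0)// oppr_lt0.
- exact: continuous_subspaceT.
- split.
  + by move=> t _.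
  + by apply: cvg_at_right_filter; exact: cg0.
  + by apply: cvg_at_left_filter; exact: cg0.
- by move=> t _; rewrite derive1E.
Qed.

Local Notation cons1 a y := (cons_rV (a, y)).

Lemma cons_rVE n (a : R) (y : 'rV[R]_n) (i : 'I_n.+1) :
  cons1 a y ord0 i = oapp (y ord0) a (unlift ord0 i).
Proof.
rewrite /cons_rV !mxE.
case: (splitP (i : 'I_(1 + n))) => j ij /=.
  rewrite (_ : i = ord0) ?unlift_none/=; last by apply/val_inj; rewrite /= ij ord1.
  by rewrite mxE (ord1 j) eqxx mulr1n.
by rewrite (_ : i = lift ord0 j) ?liftK//; apply/val_inj; rewrite /= ij.
Qed.

Lemma cons_rVD n (h a : R) (v y : 'rV[R]_n) (b : R) :
  cons1 (h * b + a) (h *: v + y) = h *: cons1 b v + cons1 a y.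
Proof.
apply/rowP => i; rewrite [RHS]mxE [X in _ = X + _]mxE !cons_rVE.
by case: unlift => [j|]//=; rewrite !mxE.
Qed.

Lemma cons_rV_delta0 n : cons1 1 0 = delta_mx ord0 ord0 :> 'rV[R]_n.+1.
Proof.
apply/rowP => i; rewrite cons_rVE mxE eqxx/=; case: unliftP => [j ->|->] /=.
  by rewrite mxE.
by [].
Qed.

Lemma cons_rV_deltaS n (k : 'I_n) :
  cons1 0 (delta_mx ord0 k) = delta_mx ord0 (lift ord0 k) :> 'rV[R]_n.+1.
Proof.
apply/rowP => i; rewrite cons_rVE [RHS]mxE eqxx/=; case: unliftP => [j ->|->] /=.
  by rewrite mxE eqxx (inj_eq lift_inj).
by [].
Qed.

Lemma cons_rVB n (a b : R) (y z : 'rV[R]_n) : cons1 a y - cons1 b z = cons1 (a - b) (y - z).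
Proof.
apply/rowP => i; rewrite [LHS]mxE [X in _ + X = _]mxE !cons_rVE.
by case: unlift => [j|]//=; rewrite !mxE.
Qed.

Lemma cons_rV_continuousr n (a : R) : continuous (fun y : 'rV[R]_n => cons1 a y).
Proof.
move=> y; apply/(@cvgrPdist_lt _ _ _ (nbhs y) (nbhs_filter y)) => e e0.
suff H : nbhs (y : 'rV[R]_n) [set t | `|cons1 a y - cons1 a t| < e] by exact: H.
apply/nbhs_ballP; exists e => //= z; rewrite -ball_normE /= => yz.
rewrite cons_rVB [ltLHS]mx_normrE.
apply: (big_ind (fun z => z < e)) => // [s t se te|[i j] _ /=]; first by rewrite gt_max se.
rewrite ord1 cons_rVE; case: unlift => [k|]/=; last by rewrite subrr normr0.
exact: le_lt_trans (coor_le_norm _ k) _.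
Qed.

Lemma cons_rV_continuousl n (y : 'rV[R]_n) : continuous (fun a : R => cons1 a y).
Proof.
move=> a; apply/cvgrPdist_lt => e e0; near=> b.
rewrite cons_rVB [ltLHS]mx_normrE.
apply: (big_ind (fun z => z < e)) => // [s t se te|[i j] _ /=]; first by rewrite gt_max se.
rewrite ord1 cons_rVE; case: unlift => [k|]/=; first by rewrite subrr mxE normr0.
by near: b; apply: cvgr_dist_lt => //; exact: cvg_id.
Unshelve. all: by end_near. Qed.

Lemma sqr_enorm_cons n (a : R) (y : 'rV[R]_n) :
  enorm (cons1 a y) ^+ 2 = a ^+ 2 + enorm y ^+ 2.
Proof.
rewrite !sqr_enorm big_ord_recl cons_rVE unlift_none/=; congr (_ + _).
by apply: eq_bigr => i _; rewrite cons_rVE liftK.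
Qed.

Lemma enorm_consl n (a : R) (y : 'rV[R]_n) : `|a| <= enorm (cons1 a y).
Proof.
rewrite -ler_sqr ?nnegrE ?enorm_ge0// sqr_enorm_cons real_normK ?num_real//.
by rewrite lerDl sqr_ge0.
Qed.

Lemma enorm_consr n (a : R) (y : 'rV[R]_n) : enorm y <= enorm (cons1 a y).
Proof. by rewrite -ler_sqr ?nnegrE ?enorm_ge0// sqr_enorm_cons lerDr sqr_ge0. Qed.

Lemma integral_rVS' n (f : 'rV[R]_n.+1 -> \bar R) :
  (lebesgue_rV n.+1).-integrable setT f ->
  (\int[lebesgue_rV n.+1]_x f x =
  \int[lebesgue_rV n]_y \int[@lebesgue_measure R]_a f (cons1 a y))%E.
Proof.
move=> fi; rewrite integral_rVS//; move: fi => /integrableP[mf foo].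
have mc := @measurable_cons_rV R n.
have mfc : measurable_fun setT (f \o cons_rV) by exact: measurableT_comp.
apply: (@Fubini _ _ _ _ R lebesgue_measure (lebesgue_rV n) (f \o cons_rV)).
apply/integrable12ltyP => //=.
by rewrite ge0_integral_rVS// in foo; exact: measurableT_comp.
Qed.

(** Fubini with the order of integration chosen by [i]: for the first coordinate the inner integral
    vanishes by the fundamental theorem of calculus on a line, for any other coordinate by induction
    applied to the slice. *)
Lemma integral_partial n (f : 'rV[R]_n -> R) (i : 'I_n) :
  C1 f -> bsupp f -> (\int[lebesgue_rV n]_x (partial i f x)%:E = 0)%E.
Proof.
elim: n f i => [|n IH] f i; first by case: i.
move=> C1f bf; have [cf Cf] := C1f.
have [ci di] := Cf i; have [r r0 fr] := bsupp_gradient bf.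
have pr x j : r <= enorm x -> partial j f x = 0.
  by move=> /fr[_ /rowP/(_ j)]; rewrite !mxE.
have Ii : (lebesgue_rV n.+1).-integrable setT (EFin \o partial i f).
  by apply: continuous_bsupp_integrable => //; exists r => // x /pr.
case: (unliftP ord0 i) => [k ik|i0].
  rewrite integral_rVS // integral0_eq// => a _.
  have L j y : is_derive y (delta_mx ord0 j) (fun y => f (cons1 a y)) (partial (lift ord0 j) f (cons1 a y)).
    apply: (is_derive_line _ (derivableP ((Cf _).2 _))) => h.
    by rewrite -cons_rV_deltaS -cons_rVD mulr0 add0r.
  have Lp j : partial j (fun y => f (cons1 a y)) = fun y => partial (lift ord0 j) f (cons1 a y).
    by apply/funext => y; have [] := L j y.
  rewrite -[RHS](IH (fun y => f (cons1 a y)) k).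
  - by apply: eq_integral => y _; rewrite Lp ik.
  - split=> [y|j].
      by apply: (@continuous_comp _ _ _ (fun y => cons1 a y) f); [exact: cons_rV_continuousr|exact: cf].
    split=> [|y]; last by have [] := L j y.
    rewrite Lp => y; apply: (@continuous_comp _ _ _ (fun y => cons1 a y) (partial (lift ord0 j) f)); first exact: cons_rV_continuousr.
    exact: (Cf _).1.
  - exists r => // y yr; apply: (fr _ _).1.
    by apply: le_trans yr _; exact: enorm_consr.
rewrite integral_rVS' // integral0_eq// => y _.
have L a : is_derive a (1 : R) (fun a => f (cons1 a y)) (partial i f (cons1 a y)).
  apply: (is_derive_line _ (derivableP ((Cf _).2 _))) => h.
  by rewrite i0 -cons_rV_delta0 -cons_rVD scaler0 add0r.
have Lp : 'D_1 (fun a => f (cons1 a y)) = fun a => partial i f (cons1 a y).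
  by apply/funext => a; have [] := L a.
under eq_integral => a _.
  rewrite (_ : partial i f (cons1 a y) = 'D_1 (fun a => f (cons1 a y)) a); last exact: (esym (congr1 (fun g => g a) Lp)).
  over.
apply: (C1_1d_integral0 r0) => [a||a ra]; first by have [] := L a.
  rewrite Lp => a; apply: (@continuous_comp _ _ _ (fun a => cons1 a y) (partial i f)); first exact: cons_rV_continuousl.
  exact: ci.
have ra' : r <= enorm (cons1 a y) by apply: le_trans ra _; exact: enorm_consl.
split; first exact: (fr _ ra').1.
by rewrite (congr1 (fun g => g a) Lp) pr.
Qed.

End integral_partial.

(** * The flux of x/|x|^n *)

Section power_tail.
Context {R : realType}.

(** The primitive is -(1/n) l^-n. In [radial_tonelli] this integral produces the weight 1/(n
    |x|^n). *)
Lemma integral_power_tail (n : nat) (s : R) : (0 < n)%N -> 0 < s ->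
  (\int[@lebesgue_measure R]_l (\1_(`]s, +oo[) l * l `^ (- n%:R - 1))%:E =
   (n%:R^-1 * s ^- n)%:E)%E.
Proof.
move=> n0 s0; have nR0 : 0 < n%:R :> R by rewrite ltr0n.
pose f (l : R) := l `^ (- n%:R - 1); pose F (l : R) := - n%:R^-1 * l `^ (- n%:R).
have dF (x : R) : 0 < x -> is_derive x (1 : R) F (f x).
  move=> x0; rewrite (_ : f x = - n%:R^-1 *: (- n%:R * x `^ (- n%:R - 1))).
    exact: (is_deriveZ (- n%:R^-1) (is_derive1_powR (- n%:R) x0)).
  rewrite /f /GRing.scale/= mulrA mulrNN mulVf ?mul1r//.
  by rewrite gt_eqF.
have cpow (a x : R) : 0 < x -> {for x, continuous (fun l => l `^ a)}.
  move=> x0; apply: differentiable_continuous; apply/derivable1_diffP.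
  by have [] := is_derive1_powR a x0.
transitivity (\int[@lebesgue_measure R]_(l in `]s, +oo[) (f l)%:E)%E.
  rewrite [RHS]integral_mkcond; apply: eq_integral => l _.
  by rewrite patchE indicE; case: ifPn => _; rewrite ?mul1r ?mul0r.
rewrite integral_itv_obnd_cbnd; last first.
  by apply/measurable_EFinP; apply: measurable_funTS; exact: measurable_powR.
rewrite (@ge0_continuous_FTC2y _ f F s 0).
- by rewrite /F powR_invn ?ltW// sub0e -EFinN mulNr opprK.
- by move=> x _; exact: powR_ge0.
- apply: continuous_in_subspaceT => x; rewrite inE/= in_itv/= andbT => sx.
  by apply: cpow; exact: lt_le_trans sx.
- rewrite -[X in _ --> X](mulr0 (- n%:R^-1)); apply: cvgMr.
  have e : {near +oo%R, (fun l : R => (l ^+ n)^-1) =1 (fun l => l `^ (- n%:R))}.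
    by near=> l; rewrite powR_invn//; near: l; exact: nbhs_pinfty_ge.
  apply: cvg_trans (near_eq_cvg e) _.
  apply/(@gtr0_cvgV0 R _ _ _ (fun l : R => l ^+ n)).
    by near=> l; rewrite exprn_gt0//; near: l; exact: nbhs_pinfty_gt.
  apply/cvgryPge => M; near=> l.
  have l1 : 1 <= l by near: l; exact: nbhs_pinfty_ge.
  apply: (@le_trans _ _ l); first by near: l; apply: nbhs_pinfty_ge; exact: num_real.
  by rewrite -[leLHS]expr1 ler_weXn2l.
- by move=> x sx; have [] := dF _ (lt_trans s0 sx).
- apply: cvg_at_right_filter; apply: cvgMr; exact: cpow.
- move=> x; rewrite in_itv/= andbT => sx; rewrite derive1E.
  by have [] := dF _ (lt_trans s0 sx).
Unshelve. all: by end_near. Qed.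

End power_tail.

Lemma continuous_max0 {R : realType} (T : topologicalType) (f : T -> R) :
  continuous f -> continuous (fun x => Num.max (f x) 0).
Proof.
move=> cf x.
have E y : Num.max (f y) 0 = (f y + `|f y|) / 2 by rewrite maxr_absE addr0 subr0.
rewrite (_ : (fun x => _) = fun y => (f y + `|f y|) / 2); last exact/funext.
by apply: cvgMl; apply: (cvgD (cf x) (cvg_norm (cf x))).
Qed.

Lemma max0M {R : realType} (k x : R) : 0 <= k -> Num.max (k * x) 0 = k * Num.max x 0.
Proof. by move=> k0; rewrite maxr_pMr// mulr0. Qed.

(** * The divergence identity for x/|x|^n by integration along rays *)

Section radial.
Context {R : realType} {n : nat} (n_gt0 : (0 < n)%N).
Local Notation mu := (@lebesgue_rV R n).
Local Notation leb := (@lebesgue_measure R).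

Lemma lebesgue_rV_set0 : mu [set 0] = 0%E.
Proof.
apply/eqP; rewrite eq_le measure_ge0 andbT.
apply/lee_addgt0Pr => e e0; rewrite add0e.
have v0 := vball_gt0 (R := R) n.
(* With r <= 1 and n >= 1, the volume r^n [vball n] is at most r [vball n]. *)
pose r := Num.min 1 (e / vball n).
have r0 : 0 < r by rewrite lt_min ltr01 divr_gt0.
apply: (@le_trans _ _ (mu (eball r))).
  apply: le_measure; rewrite ?inE; last 2 first.
  - exact: measurable_eball.
  - by move=> x ->; rewrite /eball/= enorm0.
  apply: closed_measurable_rV; rewrite (_ : [set 0] = ecball 0); first exact: closed_ecball.
  apply/seteqP; split => x; first by move=> ->; rewrite /ecball/= enorm0.
  by rewrite /ecball/= => x0; apply/eqP; rewrite -[_ == _]negbK -enorm_gt0 -leNgt.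
rewrite lebesgue_eball// vballE -EFinM lee_fin.
apply: (@le_trans _ _ (r * vball n)); last first.
  by rewrite -ler_pdivlMr// ge_min lexx orbT.
rewrite ler_wpM2r ?(ltW v0)//; case: n n_gt0 => // m _.
by rewrite exprS ler_piMr ?exprn_ile1 ?(ltW r0)// ge_min lexx.
Qed.

(** Pairs (l, x) with x in the unit ball and l x outside it, weighted by 1/l. The weight cancels the
    factor l in (l x) . grad w(l x), so that on each ray [K] leaves exactly the derivative of l |->
    w(l x) beyond the unit sphere. *)
Let A := [set z : R * 'rV[R]_n | [&& 0 < z.1, enorm z.2 < 1 & 1 < z.1 * enorm z.2]].
Let K (z : R * 'rV[R]_n) : R := \1_A z * z.1 `^ (-1).

Let mA : measurable A.
Proof.
have mb : measurable_fun setT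
    (fun z : R * 'rV[R]_n => [&& 0 < z.1, enorm z.2 < 1 & 1 < z.1 * enorm z.2]).
  have me : measurable_fun setT (fun z : R * 'rV[R]_n => enorm z.2).
    by apply: measurableT_comp; [exact: measurable_enorm|exact: measurable_snd].
  have m1 : measurable_fun setT (fun z : R * 'rV[R]_n => z.1) by exact: measurable_fst.
  apply: measurable_and; first by apply: measurable_fun_ltr => //; exact: measurable_cst.
  apply: measurable_and; first by apply: measurable_fun_ltr => //; exact: measurable_cst.
  by apply: measurable_fun_ltr => //; exact: measurable_funM.
by have := mb measurableT [set true] I; rewrite setTI.
Qed.

Let mK : measurable_fun setT K.
Proof.
apply: measurable_funM; first exact: measurable_indic.
by apply: (measurableT_comp (measurable_powR _)); exact: measurable_fst.
Qed.

Let K_ge0 z : 0 <= K z.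
Proof. by rewrite mulr_ge0// powR_ge0. Qed.

Let mKg (g : 'rV[R]_n -> R) : measurable_fun setT g ->
  measurable_fun setT (fun z => (K z * g (z.1 *: z.2))%:E).
Proof.
move=> mg; apply/measurable_EFinP; apply: measurable_funM => //.
by apply: (measurableT_comp mg); exact: measurable_scale.
Qed.

(** Polar coordinates, with the ray through [x] parametrized by [l *: x]. *)
Lemma radial_tonelli (g : 'rV[R]_n -> R) : measurable_fun setT g -> (forall x, 0 <= g x) ->
  (\int[mu]_x \int[leb]_l (K (l, x) * g (l *: x))%:E =
   \int[mu]_x (n%:R^-1 * (\1_(~` ecball 1) x * (enorm x) ^- n * g x))%:E)%E.
Proof.
move=> mg g0.
have f0 z : (0 <= (K z * g (z.1 *: z.2))%:E)%E by rewrite lee_fin mulr_ge0.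
rewrite -(@fubini_tonelli _ _ _ _ R leb mu (fun z => (K z * g (z.1 *: z.2))%:E)) //; last exact: mKg.
(* The region and the weight after substituting y = l x at fixed l: |x| < 1 < l|x| becomes 1 < |y| <
   l, and 1/l times the Jacobian l^-n gives the exponent -n-1. *)
pose A' := [set z : R * 'rV[R]_n | 1 < enorm z.2 < z.1].
pose K' (z : R * 'rV[R]_n) : R := \1_A' z * z.1 `^ (- n%:R - 1).
have mA' : measurable A'.
  have mb : measurable_fun setT (fun z : R * 'rV[R]_n => 1 < enorm z.2 < z.1).
    have me : measurable_fun setT (fun z : R * 'rV[R]_n => enorm z.2).
      by apply: measurableT_comp; [exact: measurable_enorm|exact: measurable_snd].
    have m1 : measurable_fun setT (fun z : R * 'rV[R]_n => z.1) by exact: measurable_fst.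
    apply: measurable_and; apply: measurable_fun_ltr => //; exact: measurable_cst.
  by have := mb measurableT [set true] I; rewrite setTI.
have mK'g : measurable_fun setT (fun z => (K' z * g z.2)%:E).
  apply/measurable_EFinP; apply: measurable_funM.
    apply: measurable_funM; first exact: measurable_indic.
    by apply: (measurableT_comp (measurable_powR _)); exact: measurable_fst.
  by apply: (measurableT_comp mg); exact: measurable_snd.
have K'0 z : 0 <= K' z by rewrite mulr_ge0// powR_ge0.
transitivity (\int[leb]_l \int[mu]_x (K' (l, x) * g x)%:E)%E.
  apply: eq_integral => l _.
  have [l0|l0] := ltP 0 l; last first.
    rewrite !integral0_eq// => x _.
      rewrite /K' indicE memNset ?mul0r// => /= /andP[h1 h2].
      by move: (lt_trans (lt_trans ltr01 h1) h2); rewrite ltNge l0.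
    by rewrite /K indicE memNset ?mul0r// => /= /and3P[]; rewrite ltNge l0.
  pose G (y : 'rV[R]_n) := ((l `^ (-1) * \1_[set y | 1 < enorm y < l] y) * g y)%:E.
  have mb : measurable [set y : 'rV[R]_n | 1 < enorm y < l].
    have mb : measurable_fun setT (fun y : 'rV[R]_n => 1 < enorm y < l).
      by apply: measurable_and; apply: measurable_fun_ltr => //;
        [exact: measurable_enorm|exact: measurable_enorm].
    by have := mb measurableT [set true] I; rewrite setTI.
  have mG : measurable_fun setT G.
    apply/measurable_EFinP; apply: measurable_funM => //.
    by apply: measurable_funM => //; exact: measurable_indic.
  have G0 y : (0 <= G y)%E by rewrite lee_fin mulr_ge0// mulr_ge0// powR_ge0.
  transitivity (\int[mu]_x (G (l *: x)))%E.
    apply: eq_integral => x _; rewrite /G /K; congr (_ * _)%:E.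
    rewrite mulrC; congr (_ * _); rewrite !indicE; congr (_%:R); congr (nat_of_bool _).
    apply/idP/idP; rewrite !inE /A/= enormZ gtr0_norm//.
      by move=> /and3P[_ x1 ->]/=; rewrite gtr_pMr.
    by move=> /andP[->]; rewrite gtr_pMr// l0 => ->.
  rewrite (ge0_integral_scale l0 mG G0) -ge0_integralZl//; last first.
    by rewrite lee_fin invr_ge0 exprn_ge0// ltW.
  apply: eq_integral => x _; rewrite /G /K' -EFinM; congr EFin.
  rewrite !mulrA; congr (_ * _); rewrite [RHS]mulrC [X in _ = X * _]powRD; last first.
    by apply/implyP => _; rewrite gt_eqF.
  rewrite (powR_invn _ (ltW l0)) indicE; congr (_ * _); rewrite indicE; congr (_%:R).
rewrite (@fubini_tonelli _ _ _ _ R leb mu (fun z => (K' z * g z.2)%:E)) //; last first.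
  by move=> z; rewrite lee_fin mulr_ge0.
apply: eq_integral => x _.
have [x1|x1] := leP (enorm x) 1.
  rewrite integral0_eq => [|l _].
    by rewrite [\1_(~` _) x]indicE memNset ?mul0r ?mulr0// => /(_ x1).
  by rewrite /K' indicE memNset ?mul0r// => /= /andP[]; rewrite ltNge x1.
rewrite [\1_(~` _) x]indicE mem_set ?mul1r; last by rewrite /ecball/=; apply/negP; rewrite -ltNge.
have H := integral_power_tail n_gt0 (lt_trans ltr01 x1).
rewrite mulrA EFinM -H -ge0_integralZr//.
- apply: eq_integral => l _; rewrite -EFinM /K'; congr ((_ * _) * _)%:E.
  by rewrite !indicE; congr (_%:R); congr (nat_of_bool _); apply/idP/idP;
    rewrite !inE /A'/= in_itv/= x1 andbT.
- apply/measurable_EFinP; apply: measurable_funM; last exact: measurable_powR.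
  exact: measurable_indic.
- by move=> l _; rewrite lee_fin mulr_ge0// powR_ge0.
- by rewrite lee_fin.
Qed.

(** The fundamental theorem of calculus on the ray through x, from the unit sphere to a point beyond
    the support of w. *)
Lemma C1_ray (w : 'rV[R]_n -> R) (x : 'rV[R]_n) : C1 w -> bsupp w -> x != 0 ->
  (\int[leb]_l (K (l, x) * edot (l *: x) (gradient w (l *: x)))%:E =
   (- (\1_(eball 1) x * w (normalize x)))%:E)%E.
Proof.
move=> Cw bw x0; have e0 : 0 < enorm x by rewrite enorm_gt0.
have [x1|x1] := ltP (enorm x) 1; last first.
  rewrite integral0_eq => [|l _].
    by rewrite indicE memNset ?mul0r ?oppr0// /eball/= ltNge x1.
  by rewrite /K indicE memNset ?mul0r// => /= /and3P[_]; rewrite ltNge x1.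
rewrite indicE mem_set// mul1r.
have [r r0 wr] := bsupp_gradient bw.
pose phi (l : R) := w (l *: x); pose dphi (l : R) := edot x (gradient w (l *: x)).
have dP (l : R) : is_derive l (1 : R) phi (dphi l).
  apply: (is_derive_line _ (C1_derive (l *: x) x Cw)) => h.
  by rewrite /phi scalerDl [_ *: 1]mulr1.
have cphi : continuous phi.
  by move=> l; apply: differentiable_continuous; apply/derivable1_diffP; have [] := dP l.
have cs : continuous (fun l : R => l *: x).
  by move=> l; apply: cvgZr_tmp; exact: cvg_id.
have cdphi : continuous dphi.
  rewrite (_ : dphi = fun l => \sum_(i < n) x ord0 i * partial i w (l *: x)); last first.
    by apply/funext => l; apply: eq_bigr => i _; rewrite mxE.
  apply: (@continuous_big R) => [|i _ l]; first exact: add_continuous.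
  apply: cvgMr.
  by apply: (@continuous_comp _ _ _ (fun l : R => l *: x) (partial i w)); [exact: cs|exact: (Cw.2 i).1].
(* The ray meets the unit sphere at l = a, and at l = b it has left the support, since |b x| = 1 +
   r. *)
pose a := (enorm x)^-1; pose b := (1 + r) / enorm x.
have a0 : 0 < a by rewrite invr_gt0.
have ab : a < b by rewrite /b -[ltLHS]mul1r ltr_pM2r// ltrDl.
have phib : phi b = 0.
  by apply: (wr _ _).1; rewrite enormZ gtr0_norm ?divr_gt0 ?addr_gt0// divfK ?gt_eqF// lerDr.
transitivity (\int[leb]_(l in `[a, b]) (dphi l)%:E)%E; last first.
  rewrite (@continuous_FTC2 _ dphi phi)//.
  - by rewrite phib sub0e -EFinN.
  - exact: continuous_subspaceT.
  - split; first by move=> l _; have [] := dP l.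
      by apply: cvg_at_right_filter; exact: cphi.
    by apply: cvg_at_left_filter; exact: cphi.
  - by move=> l _; rewrite derive1E; have [] := dP l.
rewrite -integral_itv_obnd_cbnd; last first.
  by apply/measurable_EFinP; apply: measurable_funTS; exact: continuous_measurable_fun.
rewrite [RHS]integral_mkcond; apply: eq_integral => l _; rewrite patchE.
have lE : (l \in `]a, b]) = (1 < l * enorm x) && (l <= b).
  by rewrite in_itv/= /a -div1r ltr_pdivrMr.
rewrite /K indicE; case: ifPn => [|/negP lab].
  rewrite inE/= lE => /andP[l1 lb].
  have l0 : 0 < l by rewrite -(pmulr_lgt0 _ e0) (lt_trans ltr01).
  rewrite mem_set ?mul1r/=; last by rewrite /A/= l0 x1 l1.
  by rewrite powR_inv1 ?(ltW l0)// edotZl mulrA mulVf ?mul1r// gt_eqF.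
have [l1|l1] := ltP 1 (l * enorm x); last first.
  by rewrite memNset ?mul0r// => /= /and3P[_ _]; rewrite ltNge l1.
have bl : b < l by rewrite ltNge; apply/negP => lb; apply: lab; rewrite inE/= lE l1 lb.
have lr : r <= enorm (l *: x).
  rewrite enormZ gtr0_norm; last by rewrite (lt_trans a0)// (lt_trans ab).
  by rewrite -ler_pdivrMr//; apply: le_trans (ltW bl); rewrite /b ler_pM2r ?invr_gt0// lerDr.
rewrite (wr _ lr).2 /edot big1 ?mulr0// => i _.
by rewrite [X in _ * X]mxE mulr0.
Qed.

Lemma integrable_radial (g : 'rV[R]_n -> R) : continuous g -> bsupp g ->
  mu.-integrable setT (fun x => (\1_(~` ecball 1) x * (enorm x) ^- n * g x)%:E).
Proof.
move=> cg bg; have Ig := continuous_bsupp_integrable cg bg.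
have mw : measurable_fun setT (fun x : 'rV[R]_n => (enorm x) ^- n).
  rewrite (_ : (fun x => _) = fun x => enorm x `^ (- n%:R)).
    by apply: (measurableT_comp (measurable_powR _)); exact: measurable_enorm.
  by apply/funext => x; rewrite powR_invn// enorm_ge0.
apply: le_integrable Ig => //.
  apply/measurable_EFinP; apply: measurable_funM; last exact: continuous_measurable_rV.
  apply: measurable_funM => //; apply: measurable_indic; apply: measurableC.
  exact: measurable_ecball.
move=> x _; rewrite lee_fin/= normrM -[leRHS]mul1r ler_wpM2r//.
rewrite indicE; case: (boolP (_ \in _)) => [|_]; last by rewrite mul0r normr0.
rewrite inE /ecball/= => /negP; rewrite -ltNge => x1.
rewrite mul1r ger0_norm ?invr_ge0 ?exprn_ge0 ?enorm_ge0//.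
by rewrite invf_le1 ?exprn_ege1 ?(ltW x1)// exprn_gt0// (lt_trans ltr01).
Qed.

(** The field x/|x|^n is divergence free off the origin, so only a boundary term survives: n times
    the integral of [w (normalize x)] over the ball is the integral of w over the unit sphere in
    polar coordinates. It follows by integrating [C1_ray] over x and evaluating the other side with
    [radial_tonelli]. *)
Lemma radial_divergence (w : 'rV[R]_n -> R) : C1 w -> bsupp w ->
  \int[mu]_(x in ~` ecball 1) (edot x (gradient w x) / enorm x ^+ n) =
  - n%:R * \int[mu]_(x in eball 1) w (normalize x).
Proof.
move=> Cw bw; pose P x := edot x (gradient w x).
have cP : continuous P by exact: edot_gradient_continuous.
have bP : bsupp P.
  have [r r0 wr] := bsupp_gradient bw; exists r => // x /wr[_ g0].
  by rewrite /P g0 /edot big1// => i _; rewrite mxE mulr0.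
(* [radial_tonelli] requires a sign, so the two parts are treated apart and recombined once their
   integrability is known. *)
pose Pp := P^\+; pose Pn : 'rV[R]_n -> R := P^\-.
have cPp : continuous Pp by exact: continuous_max0.
have cPn : continuous Pn.
  by apply: (@continuous_max0 _ _ (fun x => - P x)) => x; exact: (cvgN (cP x)).
have bPp : bsupp Pp by case: bP => r r0 Pr; exists r => // x /Pr h; rewrite /Pp/funrpos h maxxx.
have bPn : bsupp Pn by case: bP => r r0 Pr; exists r => // x /Pr h; rewrite /Pn/funrneg h oppr0 maxxx.
have Pp0 x : 0 <= Pp x by rewrite /Pp /funrpos le_max lexx orbT.
have Pn0 x : 0 <= Pn x by rewrite /Pn /funrneg le_max lexx orbT.
pose W (x : 'rV[R]_n) : R := \1_(~` ecball 1) x * (enorm x) ^- n.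
have W0 (x : 'rV[R]_n) : 0 <= W x by rewrite mulr_ge0// invr_ge0 exprn_ge0// enorm_ge0.
have Fin (g : 'rV[R]_n -> R) : continuous g -> bsupp g -> (forall x, 0 <= g x) ->
    mu.-integrable setT (fun x => (\int[leb]_l (K (l, x) * g (l *: x))%:E)%E).
  move=> cg bg g0; have mg := continuous_measurable_rV cg.
  have /integrableP[mI foo] := integrable_radial cg bg.
  apply/integrableP; split.
    apply: (@measurable_fun_fubini_tonelli_G _ _ _ _ _ leb (fun z => (K z * g (z.1 *: z.2))%:E)).
      exact: mKg.
    by move=> z; rewrite lee_fin mulr_ge0.
  under eq_integral => x _.
    rewrite gee0_abs; last by apply: integral_ge0 => l _; rewrite lee_fin mulr_ge0.
    over.
  rewrite radial_tonelli//; under eq_integral do rewrite EFinM.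
  rewrite ge0_integralZl//.
  - apply: lte_mul_pinfty; [by rewrite lee_fin invr_ge0|by []|].
    apply: le_lt_trans foo; apply: ge0_le_integral => //.
    + by move=> x _; rewrite lee_fin mulr_ge0//; exact: W0.
    + by apply: measurableT_comp mI.
    + by move=> x _; rewrite lee_abs.
  - by move=> x _; rewrite lee_fin mulr_ge0//; exact: W0.
have Ip := Fin _ cPp bPp Pp0; have In := Fin _ cPn bPn Pn0.
have E1 : (\int[mu]_x (n%:R^-1 * (W x * P x))%:E =
   \int[mu]_x (- (\1_(eball 1) x * w (normalize x)))%:E)%E.
  transitivity ((\int[mu]_x \int[leb]_l (K (l, x) * Pp (l *: x))%:E) -
     \int[mu]_x \int[leb]_l (K (l, x) * Pn (l *: x))%:E)%E.
    rewrite !radial_tonelli//; try exact: continuous_measurable_rV.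
    rewrite [LHS]integralE; congr (_ - _)%E; apply: eq_integral => x _.
      by rewrite funeposE -EFin_max !max0M ?invr_ge0//; exact: W0.
    by rewrite funenegE -EFinN -EFin_max -!mulrN !max0M ?invr_ge0//; exact: W0.
  rewrite -integralB//; apply: ae_eq_integral => //.
  - exact: emeasurable_funB (measurable_int _ Ip) (measurable_int _ In).
  - apply/measurable_EFinP; apply: measurable_funN; apply: measurable_funM.
      by apply: measurable_indic; exact: measurable_eball.
    apply: measurableT_comp; first exact: continuous_measurable_rV Cw.1.
    exact: measurable_normalize.
  (* The origin spans no ray and is excluded from [C1_ray]; it is a null set. *)
  - exists [set 0]; split; [|exact: lebesgue_rV_set0|].
      rewrite (_ : [set 0] = ecball 0); first exact: measurable_ecball.
      apply/seteqP; split => x; first by move=> ->; rewrite /ecball/= enorm0.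
      by rewrite /ecball/= => x0; apply/eqP; rewrite -[_ == _]negbK -enorm_gt0 -leNgt.
    move=> x /= /not_implyP[_ hx]; apply: contrapT => x0; apply: hx.
    rewrite -C1_ray//; last exact/eqP.
    rewrite [RHS]integralE; congr (_ - _)%E; apply: eq_integral => l _.
      by rewrite funeposE -EFin_max max0M.
    by rewrite funenegE -EFinN -EFin_max -mulrN max0M.
have IW := integrable_radial cP bP.
have -> : \int[mu]_(x in ~` ecball 1) (edot x (gradient w x) / enorm x ^+ n) =
    \int[mu]_x (W x * P x).
  rewrite Rintegral_mkcond; apply: eq_Rintegral => x _; rewrite patchE /W indicE.
  by case: ifP => _; rewrite ?mul1r ?mul0r// mulrC.
have -> : \int[mu]_(x in eball 1) w (normalize x) =
    \int[mu]_x (\1_(eball 1) x * w (normalize x)).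
  rewrite Rintegral_mkcond; apply: eq_Rintegral => x _; rewrite patchE indicE.
  by case: ifP => _; rewrite ?mul1r ?mul0r.
have I2 : mu.-integrable setT (EFin \o (fun x => \1_(eball 1) x * w (normalize x))).
  have [M M0 wM] := continuous_bsupp_bounded Cw.1 bw.
  rewrite (_ : EFin \o _ = (EFin \o (w \o normalize)) \_ (eball 1)); last first.
    apply/funext => x; rewrite patchE /= indicE.
    by case: ifP => _; rewrite ?mul1r ?mul0r.
  apply/integrable_restrict => //; first exact: measurable_eball.
  rewrite setTI; apply: (@bounded_integrable _ _ _ _ M); first exact: measurable_eball.
  - exact: lebesgue_eball1_lty.
  - apply: measurable_funTS; apply: measurableT_comp; first exact: continuous_measurable_rV Cw.1.
    exact: measurable_normalize.
  - by move=> x _; exact: wM.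
have {}E1 : n%:R^-1 * \int[mu]_x (W x * P x) = - \int[mu]_x (\1_(eball 1) x * w (normalize x)).
  rewrite -RintegralZl// -mulN1r -RintegralZl// /Rintegral; congr fine.
  by rewrite E1; apply: eq_integral => x _; rewrite mulN1r.
by rewrite mulNr -mulrN -E1 mulrA mulfV ?mul1r// pnatr_eq0 -lt0n.
Qed.

End radial.

(** * Test functions and the fundamental lemma *)

Section flat_function.
Context {R : realType}.
Implicit Types y : R.

(** [flat 0] is the classical exp(-1/y) extended by 0. The factors y^-j close the family under
    differentiation, see [is_derive_flat]. *)
Definition flat (j : nat) y : R := if 0 < y then y ^- j * expR (- y^-1) else 0.

Lemma flat_ge0 j y : 0 <= flat j y.
Proof.
rewrite /flat; case: ifPn => // y0.
by rewrite mulr_ge0 ?expR_ge0// invr_ge0 exprn_ge0// ltW.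
Qed.

(** The exponential series at 1/y dominates its term of order j+2. A quadratic bound is what gives
    the derivative 0 at the origin. *)
Lemma flat_le j y : flat j y <= (j.+2)`!%:R * y ^+ 2.
Proof.
rewrite /flat; case: ifPn => [y0|_]; last by rewrite mulr_ge0// sqr_ge0.
have yV0 : 0 <= y^-1 by rewrite invr_ge0 ltW.
have H : y^-1 ^+ j.+2 / (j.+2)`!%:R <= expR y^-1.
  by apply: le_trans (expR_ge1Dxn j.+1 yV0); rewrite lerDr.
have f0 : 0 < (j.+2)`!%:R :> R by rewrite ltr0n fact_gt0.
rewrite mulrC ler_pdivrMr ?exprn_gt0// -mulrA -exprD add2n expRN.
have P0 : 0 < (j.+2)`!%:R * y ^+ j.+2 by rewrite mulr_gt0// exprn_gt0.
rewrite -[leRHS]invrK lef_pV2 ?posrE ?expR_gt0 ?invr_gt0//.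
by rewrite invfM mulrC -exprVn.
Qed.

Lemma is_derive_flat j y : is_derive y 1 (flat j) (flat j.+2 y - j%:R * flat j.+1 y).
Proof.
have [y0|y0|y0] := ltgtP 0 y.
- have D : is_derive y 1 (fun t : R => t ^- j * expR (- t^-1)) (flat j.+2 y - j%:R * flat j.+1 y).
    have yn0 : y != 0 by rewrite gt_eqF.
    have D1 : is_derive y 1 (fun t : R => - t^-1) (y ^- 2).
      have := is_deriveN (is_deriveV yn0 (is_derive_id y (1 : R))).
      by move=> h; apply: (is_derive_eq h); rewrite /GRing.scale/= mulr1 opprK.
    have D2 : is_derive y 1 (expR \o (fun t : R => - t^-1)) (expR (- y^-1) * y ^- 2).
      by apply: is_derive1_comp; exact: is_derive_expR.
    have D3 : is_derive y 1 (fun t : R => t ^- j) (- j%:R * y ^- j.+1).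
      have h0 : (id ^+ j : R -> R) y != 0 by rewrite exprfctE expf_neq0.
      have := is_deriveV h0 (is_deriveX j (is_derive_id y (1 : R))).
      rewrite exprfctE => h; apply: (is_derive_eq h).
      rewrite /GRing.scale/= mulr1.
      case: j {h h0} => [|j]; first by rewrite !mul0r mulr0 oppr0 mul0r.
      rewrite /= !exprS expr0; have z0 : y ^+ j != 0 by exact: expf_neq0.
      by field; rewrite yn0 z0.
    have := is_deriveM D3 D2; move=> h; apply: (is_derive_eq h).
    rewrite /flat y0 /GRing.scale/= !exprS expr0; have z0 : y ^+ j != 0 by exact: expf_neq0.
    by field; rewrite yn0 z0.
  apply: near_eq_is_derive D; near=> z; rewrite /flat ifT//.
  by near: z; exact: lt_nbhsr.
- rewrite /flat !ifF; try by rewrite ltNge ltW.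
  rewrite mulr0 subr0.
  apply: (near_eq_is_derive _ (is_derive_cst (0 : R) y (1 : R))).
  near=> z; rewrite /flat ifF//; apply/negbTE; rewrite -leNgt ltW//.
  by near: z; exact: lt_nbhsl.
rewrite -y0 /flat !ltxx mulr0 subr0.
apply: is_derive_cvg; apply: norm_cvg0.
apply: (@squeeze_cvgr _ _ _ _ (cst 0) (fun h : R => (j.+2)`!%:R * `|h|)).
- near=> h; rewrite normr_ge0/= ltxx subr0 addr0 [_ *: 1]mulr1.
  have h0 : h != 0 by near: h; exact: nbhs_dnbhs_neq.
  rewrite /GRing.scale/= normrM normfV ler_pdivrMl ?normr_gt0//.
  rewrite -/(flat j h) ger0_norm ?flat_ge0//; apply: le_trans (flat_le j h) _.
  by rewrite [leRHS]mulrCA -expr2 real_normK ?num_real.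
- exact: cvg_cst.
- rewrite -[X in _ --> X](mulr0 (j.+2)`!%:R) -[X in _ * X](normr0 R).
  apply: cvgMr; apply: cvg_norm; exact: cvg_within.
Unshelve. all: by end_near. Qed.

Lemma flat0_le1 y : flat 0 y <= 1.
Proof.
rewrite /flat; case: ifPn => // y0; rewrite expr0 invr1 mul1r.
by rewrite -expR0 ler_expR oppr_le0 invr_ge0 ltW.
Qed.

End flat_function.

(** * A calculus of smooth functions *)

Section smooth_class.
Context {R : realType} {n : nat}.
Local Notation V := 'rV[R]_n.

(** A class of functions that is closed under partial derivatives, whence
    [sm_smooth]. *)
Inductive sm : (V -> R) -> Prop :=
| sm_cst c : sm (fun=> c)
| sm_coor i : sm (fun x => x ord0 i)
| sm_D f g : sm f -> sm g -> sm (fun x => f x + g x)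
| sm_M f g : sm f -> sm g -> sm (fun x => f x * g x)
| sm_flat j f : sm f -> sm (fun x => flat j (f x))
| sm_pow a f : sm f -> (forall x, 0 < f x) -> sm (fun x => f x `^ a)
| sm_ln f : sm f -> (forall x, 0 < f x) -> sm (fun x => ln (f x)).

Lemma is_derive_comp1 (F : R -> R) (f : V -> R) x v (a b : R) :
  is_derive (f x) (1 : R) F a -> is_derive x v f b ->
  is_derive x v (fun x => F (f x)) (a * b).
Proof.
move=> dF df.
have dl : is_derive (0 : R) (1 : R) (fun t : R => f (t *: v + x)) b.
  apply: (is_derive_line _ df) => h.
  by rewrite addr0 [_ *: 1]mulr1.
have dF' : is_derive (f (0 *: v + x)) (1 : R) F a by rewrite scale0r add0r.
apply: (is_derive_line _ (@is_derive1_comp _ F (fun t : R => f (t *: v + x)) 0 a b dF' dl)) => h.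
by rewrite /= addr0 [_ *: 1]mulr1.
Qed.

Lemma sm_derive f : sm f -> forall i, exists2 g, sm g &
  forall x, is_derive x (delta_mx ord0 i) f (g x).
Proof.
elim=> {f} [c|k|f g sf If sg Ig|f g sf If sg Ig|j f sf If|a f sf If f0|f sf If f0] i.
- by exists (fun=> 0); [exact: sm_cst|move=> x; exact: is_derive_cst].
- exists (fun=> (k == i)%:R); first exact: sm_cst.
  move=> x; apply: is_derive_cvg.
  apply: (@cvg_trans _ (cst ((k == i)%:R : R) @ (0 : R)^')); last exact: cvg_cst.
  apply: near_eq_cvg; near=> h => /=.
  have h0 : h != 0 by near: h; exact: nbhs_dnbhs_neq.
  by rewrite !mxE eqxx/= addrK /GRing.scale/= mulKf.
- have [f' sf' df] := If i; have [g' sg' dg] := Ig i.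
  by exists (fun x => f' x + g' x); [exact: sm_D|move=> x; exact: is_deriveD].
- have [f' sf' df] := If i; have [g' sg' dg] := Ig i.
  exists (fun x => f x * g' x + g x * f' x).
    by apply: sm_D; apply: sm_M.
  by move=> x; exact: is_deriveM.
- have [f' sf' df] := If i.
  exists (fun x => (flat j.+2 (f x) + (- j%:R) * flat j.+1 (f x)) * f' x).
    apply: sm_M => //; apply: sm_D; first exact: sm_flat.
    by apply: sm_M; [exact: sm_cst|exact: sm_flat].
  move=> x; apply: (is_derive_comp1 (F := flat j) _ (df x)).
  by rewrite mulNr; exact: is_derive_flat.
- have [f' sf' df] := If i.
  exists (fun x => (a * f x `^ (a - 1)) * f' x).
    by apply: sm_M => //; apply: sm_M; [exact: sm_cst|exact: sm_pow].
  by move=> x; exact: (is_derive_comp1 (is_derive1_powR a (f0 x)) (df x)).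
have [f' sf' df] := If i.
exists (fun x => f x `^ (-1) * f' x); first by apply: sm_M => //; exact: sm_pow.
move=> x; apply: (is_derive_comp1 (F := @ln R) _ (df x)).
by rewrite powR_inv1 ?ltW//; exact: is_derive1_ln.
Unshelve. all: by end_near. Qed.

Lemma sm_continuous f : sm f -> continuous f.
Proof.
have cont1 (F : R -> R) (t a : R) : is_derive t (1 : R) F a -> {for t, continuous F}.
  by move=> [d _]; apply: differentiable_continuous; exact/derivable1_diffP.
elim=> {f} [c|k|f g sf If sg Ig|f g sf If sg Ig|j f sf If|a f sf If f0|f sf If f0] x.
- exact: (@cst_continuous V R c x).
- exact: (@coors_continuous R n k x).
- exact: (cvgD (If x) (Ig x)).
- exact: (cvgM (If x) (Ig x)).
- by apply: (@continuous_comp _ _ _ f (flat j)); [exact: If|exact: cont1 (is_derive_flat j (f x))].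
- have c := cont1 _ _ _ (is_derive1_powR a (f0 x)).
  exact: (continuous_comp (If x) c).
have c := cont1 _ _ _ (is_derive1_ln (f0 x)).
exact: (continuous_comp (If x) c).
Qed.

Lemma sm_partial f i : sm f -> sm (partial i f).
Proof.
move=> /sm_derive/(_ i)[g sg dg].
rewrite (_ : partial i f = g)//; apply/funext => x.
by have [] := dg x.
Qed.

Lemma sm_smooth f : sm f -> smooth f.
Proof.
move=> sf s; have {sf}sf : sm (foldr partial f s) by elim: s => //= i s; exact: sm_partial.
split=> [|i x]; first exact: sm_continuous.
by have [g _ dg] := sm_derive sf i; have [] := dg x.
Qed.

Lemma smooth_C1 (f : V -> R) : smooth f -> C1 f.
Proof.
move=> sf; split; first exact: (sf [::]).1.
by move=> i; split; [exact: (sf [:: i]).1|move=> x; exact: (sf [::]).2].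
Qed.

Lemma support_out (f : V -> R) x : ~ Defs.support f x -> f x = 0.
Proof.
move=> h; apply/eqP; apply: contrapT => /negP fx; apply: h.
by apply: (@subset_closure _ [set x | f x != 0]).
Qed.

Lemma compact_support_bsupp (f : V -> R) : compact (Defs.support f) -> bsupp f.
Proof.
move=> /compact_sub_ecball[r r0 fr]; exists (r + 1) => [|x rx]; first by rewrite addr_gt0.
apply: support_out => /fr; rewrite /ecball/= leNgt => /negP; apply.
by rewrite (lt_le_trans _ rx)// ltrDl.
Qed.

Lemma test_bsupp (Omega : set V) (f : V -> R) : test_function Omega f -> bsupp f.
Proof.
by move=> [_ cf _]; exact: compact_support_bsupp.
Qed.

Lemma test_C1 (Omega : set V) (f : V -> R) : test_function Omega f -> C1 f.
Proof. by move=> [sf _ _]; exact: smooth_C1. Qed.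

End smooth_class.

(** * Boxes as a generating pi-system *)

Section boxes_generate.
Context {R : realType} {n : nat}.
Local Notation V := 'rV[R]_n.

Definition boxes : set (set V) := [set A | exists a b, A = box a b].

Lemma box_setI (a b c d : V) : box a b `&` box c d =
  box (\row_i Num.max (a ord0 i) (c ord0 i)) (\row_i Num.min (b ord0 i) (d ord0 i)).
Proof.
apply/seteqP; split => [x [h1 h2] i|x h].
  by rewrite !mxE gt_max lt_min; have /andP[-> ->] := h1 i; have /andP[-> ->] := h2 i.
by split => i; have := h i; rewrite !mxE gt_max lt_min => /andP[/andP[? ?] /andP[? ?]]; apply/andP.
Qed.

Lemma boxes_setI : setI_closed boxes.
Proof. by move=> _ _ [a [b ->]] [c [d ->]]; rewrite box_setI; eexists; eexists. Qed.

Lemma measurable_boxes : @measurable _ V = <<s boxes >>.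
Proof.
have so (O : set V) : open O -> <<s boxes >> O.
  move=> /open_bigcup_box[P [a [b [-> _]]]]; rewrite bigcup_mkcond.
  apply: sigma_algebra_bigcup => k; case: ifPn => _; last exact: sigma_algebra0.
  by apply: sub_sigma_algebra; exists (a k), (b k).
apply/seteqP; split => [A mA|]; last first.
  apply: smallest_sub; first exact: sigma_algebra_measurable.
  by move=> _ [a [b ->]]; exact: measurable_box.
suff : <<s \big[setU/set0]_(i < n) preimage_set_system setT (@coors R n i) measurable >>
    `<=` <<s boxes >> by apply.
apply: smallest_sub; first exact: smallest_sigma_algebra.
rewrite -bigcup_seq => B [i _ [C mC <-]]; rewrite setTI.
have {}mC : (@RGenOpens.G R).-sigma.-measurable C.
  by rewrite -RGenOpens.measurableE; exact: mC.
suff : <<s @RGenOpens.G R >> `<=` [set C | <<s boxes >> (coors i @^-1` C)] by apply.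
apply: smallest_sub => [|_ [x [y ->]] /=].
  split => /=.
  - by rewrite preimage_set0; exact: sigma_algebra0.
  - by move=> D mD; rewrite setTD -preimage_setC; exact: sigma_algebraC.
  - by move=> F mF; rewrite preimage_bigcup; exact: sigma_algebra_bigcup.
apply: so; move/continuousP : (@coors_continuous R n i); apply.
exact: interval_open.
Qed.

End boxes_generate.

(** * The fundamental lemma of the calculus of variations *)

Section fundamental_lemma.
Context {R : realType} {n : nat}.
Local Notation V := 'rV[R]_n.
Local Notation mu := (@lebesgue_rV R n).

(** Dynkin's argument: boxes are stable under intersection and generate the measurable sets, and the
    sets whose trace on [box c d] has zero integral form a Dynkin class. Hence w integrates to 0
    over every measurable subset of the box. *)
Lemma integral_boxes_eq0 (c d : V) (w : V -> R) :
  mu.-integrable (box c d) (EFin \o w) ->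
  (forall a b : V, (forall i, c ord0 i <= a ord0 i /\ b ord0 i <= d ord0 i) -> (\int[mu]_(x in box a b) (w x)%:E = 0)%E) ->
  ae_eq mu (box c d) (EFin \o w) (cst 0%E).
Proof.
move=> Iw w0; have mD := measurable_box c d.
have IwS A : measurable A -> mu.-integrable (A `&` box c d) (EFin \o w).
  by move=> mA; apply: integrableS Iw => //; exact: measurableI.
have Iall A : <<s boxes >> A -> (\int[mu]_(x in A `&` box c d) (w x)%:E = 0)%E.
  move: A; apply: (@dynkin_induction _ V boxes
    (fun A => (\int[mu]_(x in A `&` box c d) (w x)%:E = 0)%E)).
  - exact: measurable_boxes.
  - exact: boxes_setI.
  - by rewrite setTI; exact: w0.
  - move=> _ [a [b ->]].
    by rewrite box_setI; apply: w0 => i; rewrite !mxE le_max ge_min !lexx !orbT.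
  - move=> A mA A0.
    have := w0 c d (fun i => conj (lexx _) (lexx _)).
    rewrite -[X in integral _ X](setTI (box c d)) -(setvU A) setIUl integral_setU//=.
    + by rewrite A0 adde0.
    + exact: measurableI (measurableC mA) mD.
    + exact: measurableI.
    + apply: measurable_int; rewrite -setIUl setvU setTI; exact: Iw.
    + by apply/disj_setPS => x [[h _] [h' _]].
  - move=> F mF tF F0; rewrite setI_bigcupl integral_bigcup.
    + by rewrite eseries0// => k _ _; exact: F0.
    + apply/trivIsetP => i j _ _ ij; rewrite setIACA.
      by move/trivIsetP : tF => /(_ _ _ I I ij) ->; rewrite set0I.
    + by move=> k; exact: measurableI.
    + by rewrite -setI_bigcupl; apply: IwS; exact: bigcup_measurable.
apply: integral_ae_eq => //.
move=> E Ecd mE; rewrite integral0 -(Iall E).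
  by rewrite (setIidl Ecd).
by rewrite -measurable_boxes.
Qed.

Lemma compact_cbox (a b : V) : compact (cbox a b).
Proof.
apply: (@subclosed_compact _ _ (ecball (n%:R * (`|a| + `|b|)))).
- rewrite (_ : cbox _ _ = \bigcap_(i in [set: 'I_n])
    (@coors R n i @^-1` `[a ord0 i, b ord0 i]%classic)).
    apply: closed_bigI => i _.
    move/continuous_closedP : (@coors_continuous R n i); apply.
    exact: interval_closed.
  apply/seteqP; split => x h i; first by move=> _; rewrite /= in_itv/=; exact: h.
  by have := h i I; rewrite /= in_itv.
- exact: compact_ecball.
move=> x h; rewrite /ecball/=; apply: le_trans (enorm_le_norm x) _.
rewrite ler_wpM2l// [leLHS]mx_normrE.
apply: (big_ind (fun z => z <= _)) => [|s t sl tl|[i j] _ /=].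
- by rewrite addr_ge0.
- by rewrite ge_max sl.
rewrite ord1; have /andP[h1 h2] := h j.
have := coor_le_norm a j; have := coor_le_norm b j.
rewrite !ler_norml => /andP[_ hb] /andP[ha _].
by apply/andP; split; have := normr_ge0 a; have := normr_ge0 b; lra.
Qed.

Lemma loc_integrable_measurable (Omega : set V) w :
  open Omega -> loc_integrable Omega w -> measurable_fun Omega w.
Proof.
move=> oO lw; have [P [a [b [E sub]]]] := open_bigcup_box oO.
rewrite E bigcup_mkcond; apply/measurable_fun_bigcup => k.
  by case: ifP => _ //; exact: measurable_box.
case: ifPn => [kP|_]; last exact: measurable_fun_set0.
have cK : compact (cbox (a k) (b k)) by exact: compact_cbox.
apply: (@measurable_funS _ _ _ _ (cbox (a k) (b k))).
- exact: measurable_cbox.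
- by move=> x h i; have /andP[/ltW -> /ltW ->] := h i.
apply/measurable_EFinP; apply: measurable_int.
by apply: lw => //; apply: sub; rewrite inE in kP.
Qed.

Lemma test_mul_integrable (Omega : set V) w f : open Omega ->
  loc_integrable Omega w -> C1 f -> compact (Defs.support f) -> Defs.support f `<=` Omega ->
  mu.-integrable Omega (fun x => (w x * f x)%:E).
Proof.
move=> oO lw [cf _] ck fO; have Iw := lw _ ck fO.
have bf := compact_support_bsupp ck.
have [M M0 fM] := continuous_bsupp_bounded cf bf.
have mS : measurable (Defs.support f) by exact: compact_measurable_rV.
have : mu.-integrable (Defs.support f) (fun x => (w x * f x)%:E).
  apply: (@le_integrable _ _ _ _ _ mS _ (fun x => M%:E * (w x)%:E)%E).
  - apply/measurable_EFinP; apply: measurable_funM.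
      by apply/measurable_EFinP; exact: measurable_int Iw.
    by apply: measurable_funTS; exact: continuous_measurable_rV.
  - move=> x _; rewrite abseM /= -EFinM lee_fin normrM mulrC ler_wpM2r// (ger0_norm (ltW M0)).
    exact: fM.
  - exact: integrableZl.
move=> /integrable_mkcond => /(_ mS) I1.
apply/(integrable_mkcond _ (open_measurable_rV oO)).
rewrite (_ : _ \_ _ = (fun x => (w x * f x)%:E) \_ (Defs.support f))//.
apply/funext => x; rewrite !patchE.
case: (boolP (x \in Defs.support f)) => [/set_mem/fO/mem_set ->//|/negP xS].
case: ifP => // _; rewrite (@support_out _ _ f x) ?mulr0// => Sx.
by apply: xS; rewrite inE.
Qed.

(** Inside the box each factor is exp(-1/((k+1) d)), with d the distance to a face. Hence the
    product is smooth with support in the closed box, has values in [0, 1] and tends to the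
    indicator of the open box. *)
Definition bump (a b : V) (k : nat) (x : V) : R :=
  \prod_(i < n) (flat 0 (k.+1%:R * (x ord0 i - a ord0 i)) *
                 flat 0 (k.+1%:R * (b ord0 i - x ord0 i))).

Lemma bump_test (a b : V) k (Omega : set V) : cbox a b `<=` Omega ->
  test_function Omega (bump a b k).
Proof.
move=> abO.
have sS : Defs.support (bump a b k) `<=` cbox a b.
  have cl : closed (cbox a b) by apply: compact_closed => //; exact: compact_cbox.
  rewrite [X in _ `<=` X](closure_id _).1//.
  apply: closure_subset => x /=; rewrite /bump prodf_seq_neq0 => /allP h i.
  have := h i (mem_index_enum i); rewrite /= mulf_eq0 negb_or => /andP[].
  rewrite /flat; case: ifPn => [h1 _|_]; last by rewrite eqxx.
  case: ifPn => [h2 _|_]; last by rewrite eqxx.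
  move: h1 h2; rewrite !pmulr_rgt0 ?ltr0n// !subr_gt0 => h1 h2.
  by rewrite !ltW.
split.
- apply: sm_smooth; rewrite /bump.
  have smp (s : seq 'I_n) : sm (fun x : V => \prod_(i <- s) (flat 0 (k.+1%:R * (x ord0 i - a ord0 i)) *
                 flat 0 (k.+1%:R * (b ord0 i - x ord0 i)))).
    elim: s => [|i s IH].
      rewrite (_ : (fun x => _) = fun=> 1); first exact: sm_cst.
      by apply/funext => x; rewrite big_nil.
    under eq_fun do rewrite big_cons.
    apply: sm_M => //; apply: sm_M; apply: sm_flat; apply: sm_M; try exact: sm_cst.
      by apply: sm_D; [exact: sm_coor|exact: sm_cst].
    apply: sm_D; first exact: sm_cst.
    under eq_fun do rewrite -mulN1r.
    by apply: sm_M; [exact: sm_cst|exact: sm_coor].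
  exact: smp.
- apply: subclosed_compact sS; [exact: closed_closure|exact: compact_cbox].
- exact: subset_trans sS abO.
Qed.

Lemma bump_bounds (a b : V) k x : 0 <= bump a b k x <= 1.
Proof.
apply/andP; split; first by apply: prodr_ge0 => i _; rewrite mulr_ge0// flat_ge0.
by apply: prodr_ile1 => i _; rewrite mulr_ge0 ?flat_ge0//= mulr_ile1 ?flat_ge0 ?flat0_le1.
Qed.

(** From exp(-s) >= 1 - s. The argument may move with k, as needed in [damp_cvg]. *)
Lemma flat0_cvg (y_ : nat -> R) (y : R) : 0 < y -> (\forall k \near \oo, y <= y_ k) ->
  flat 0 (k.+1%:R * y_ k) @[k --> \oo] --> (1 : R).
Proof.
move=> y0 yk.
apply: (@squeeze_cvgr _ _ _ _ (fun k => 1 - y^-1 * k.+1%:R^-1) (cst 1)); last 2 first.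
- rewrite -[X in _ --> X]subr0 -[X in _ --> _ - X](mulr0 y^-1).
  by apply: cvgB; [exact: cvg_cst|apply: cvgMr; exact: cvg_harmonic].
- exact: cvg_cst.
near=> k; rewrite flat0_le1 andbT.
have yy : y <= y_ k by near: k.
have yk0 : 0 < y_ k by exact: lt_le_trans yy.
rewrite /flat pmulr_rgt0 ?ltr0n// yk0 expr0 invr1 mul1r.
apply: le_trans (expR_ge1Dx _); rewrite lerD2l lerN2 invfM mulrC.
by rewrite ler_pM2r ?invr_gt0 ?ltr0n// lef_pV2 ?posrE.
Unshelve. all: by end_near. Qed.

Lemma bump_cvg (a b : V) x : bump a b k x @[k --> \oo] --> (\1_(box a b) x : R).
Proof.
have [xb|xb] := pselect (box a b x).
  rewrite indicE mem_set// -[X in _ --> X](_ : \prod_(i < n) (1 * 1) = 1).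
    rewrite /bump; apply: (@cvg_big R _ *%R 1 xpredT (@mul_continuous R) nat \oo _
       (fun i k => flat 0 (k.+1%:R * (x ord0 i - a ord0 i)) *
       flat 0 (k.+1%:R * (b ord0 i - x ord0 i))) (fun=> 1 * 1)).
    move=> i _; have /andP[h1 h2] := xb i.
    by apply: cvgM; [apply: (@flat0_cvg _ (x ord0 i - a ord0 i))|
      apply: (@flat0_cvg _ (b ord0 i - x ord0 i))]; rewrite ?subr_gt0//; exact: nearW.
  by rewrite mul1r big1.
rewrite indicE memNset//.
have [i hi] : exists i, ~~ (a ord0 i < x ord0 i < b ord0 i).
  by apply: contrapT => h; apply: xb => i; apply: contrapT => /negP hi; apply: h; exists i.
rewrite (_ : (fun k => bump a b k x) = cst 0); first exact: cvg_cst.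
apply/funext => k; rewrite /bump (bigD1 i)//= /flat.
move: hi; rewrite negb_and => /orP[h|h].
  by rewrite ifF ?mul0r// pmulr_rgt0 ?ltr0n// subr_gt0 (negbTE h).
by rewrite [X in (_ * X) * _]ifF ?mulr0 ?mul0r// pmulr_rgt0 ?ltr0n// subr_gt0 (negbTE h).
Qed.

(** Test against [bump a b k] and let k grow; |w| dominates on the compact closed box. *)
Lemma test_integral_box (Omega : set V) w (a b : V) : open Omega ->
  loc_integrable Omega w ->
  (forall f, test_function Omega f -> (\int[mu]_(x in Omega) (w x * f x)%:E = 0)%E) ->
  cbox a b `<=` Omega -> (\int[mu]_(x in box a b) (w x)%:E = 0)%E.
Proof.
move=> oO lw w0 abO.
have mO := open_measurable_rV oO.
have mw := loc_integrable_measurable oO lw.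
have mb := @measurable_box R n a b; have mcb := @measurable_cbox R n a b.
have Iw : mu.-integrable (cbox a b) (EFin \o w) by apply: lw => //; exact: compact_cbox.
have E k : (\int[mu]_(x in cbox a b) (w x * bump a b k x)%:E = 0)%E.
  rewrite -(w0 _ (bump_test k abO)) integral_mkcond [RHS]integral_mkcond.
  apply: eq_integral => x _; rewrite !patchE.
  case: (boolP (x \in cbox a b)) => [/set_mem/abO/mem_set ->//|/negP xS].
  case: ifP => // _; rewrite (_ : bump a b k x = 0) ?mulr0//.
  rewrite /bump; apply: contrapT => /eqP; rewrite prodf_seq_neq0 => /allP h.
  apply: xS; rewrite inE => i; have := h i (mem_index_enum i).
  rewrite /= mulf_eq0 negb_or => /andP[].
  rewrite /flat; case: ifPn => [h1 _|_]; last by rewrite eqxx.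
  case: ifPn => [h2 _|_]; last by rewrite eqxx.
  by move: h1 h2; rewrite !pmulr_rgt0 ?ltr0n// !subr_gt0 => h1 h2; rewrite !ltW.
have mbk k : measurable_fun setT (bump a b k).
  by apply: continuous_measurable_rV; have [+ _ _] := bump_test k abO => /smooth_C1[].
have mwK : measurable_fun (cbox a b) w by apply/measurable_EFinP; exact: measurable_int Iw.
have h : (\int[mu]_(x in cbox a b) (w x * bump a b k x)%:E @[k --> \oo] -->
    \int[mu]_(x in cbox a b) (w x * \1_(box a b) x)%:E)%E.
  have [|||||_ _ //] := @dominated_convergence _ _ R mu (cbox a b) mcb
    (fun k x => (w x * bump a b k x)%:E) (fun x => (w x * \1_(box a b) x)%:E)
    (fun x => `|w x|%:E).
  - move=> k; apply/measurable_EFinP; apply: measurable_funM => //.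
    exact: measurable_funTS.
  - by apply/measurable_EFinP; apply: measurable_funM => //; exact: measurable_indic.
  - apply: aeW => x _; apply: cvg_EFin; first exact: nearW.
    by apply: cvgMr; exact: bump_cvg.
  - exact: integrable_norm.
  - apply: aeW => x k _; rewrite lee_fin normrM -[leRHS]mulr1 ler_wpM2l//.
    by have /andP[b0 b1] := bump_bounds a b k x; rewrite ger0_norm.
have {}h : (\int[mu]_(x in cbox a b) (w x * \1_(box a b) x)%:E = 0)%E.
  rewrite -(cvg_lim _ h)//; apply: lim_near_cst => //; exact: nearW E.
rewrite -[RHS]h integral_mkcond [RHS]integral_mkcond; apply: eq_integral => x _.
rewrite !patchE indicE; case: (boolP (x \in box a b)) => [/set_mem xb|_].
  by rewrite mem_set ?mulr1// => i; have /andP[/ltW -> /ltW ->] := xb i.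
by rewrite mulr0; case: ifP.
Qed.

Lemma fundamental (Omega : set V) w : open Omega ->
  loc_integrable Omega w ->
  (forall f, test_function Omega f -> (\int[mu]_(x in Omega) (w x * f x)%:E = 0)%E) ->
  {ae mu, forall x, Omega x -> w x = 0}.
Proof.
move=> oO lw w0; have [P [a [b [E sub]]]] := open_bigcup_box oO.
have H k : {ae mu, forall x, P k -> box (a k) (b k) x -> w x = 0}.
  have [kP|kP] := pselect (P k); last by apply: aeW => x /kP.
  have : ae_eq mu (box (a k) (b k)) (EFin \o w) (cst 0%E).
    apply: integral_boxes_eq0.
      apply: (@integrableS _ _ _ mu (cbox (a k) (b k))).
      - exact: measurable_cbox.
      - exact: measurable_box.
      - by move=> x h i; have /andP[/ltW -> /ltW ->] := h i.
      - by apply: lw; [exact: compact_cbox|exact: sub].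
    move=> c d cd; apply: (@test_integral_box Omega) => //; apply: subset_trans (sub _ kP).
    move=> x h i; have /andP[h1 h2] := h i; have [h3 h4] := cd i.
    by rewrite (le_trans h3)//= (le_trans h2).
  by apply: filterS => x h _ xb; have /eqP := h xb; rewrite eqe => /eqP.
have /ae_foralln := H; apply: filterS => x h Ox.
by move: Ox; rewrite E => -[k Pk bx]; exact: h bx.
Qed.

End fundamental_lemma.

(** * Limits of integrals *)

Section cvg0.
Context {R : realType}.
Implicit Types u v : nat -> \bar R.

(** Turns convergence to 0 into inequalities between extended reals, so that infinite early terms
    need no separate care. *)
Lemma ecvg0P u : (forall k, (0 <= u k)%E) ->
  (u @ \oo --> 0%E) <-> (forall e : R, 0 < e -> \forall k \near \oo, (u k <= e%:E)%E).
Proof.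
move=> u0; split=> [cu e e0|h].
  have /fine_cvgP[fu cu'] := cu.
  have := @cvgr_dist_lt _ _ _ _ _ _ _ cu' e e0.
  move=> h; near=> k.
  have fk : u k \is a fin_num by near: k.
  rewrite -(fineK fk) lee_fin.
  have : `|0 - fine (u k)| < e by near: k; exact: h.
  by rewrite sub0r normrN => /ltW; apply: le_trans; exact: ler_norm.
apply/fine_cvgP; split.
  have := h 1 ltr01; apply: filterS => k uk.
  by rewrite ge0_fin_numE// (le_lt_trans uk)// ltry.
apply/cvgrPdist_le => e e0; have := h e e0; apply: filterS => k uk /=.
have fk : u k \is a fin_num by rewrite ge0_fin_numE// (le_lt_trans uk)// ltry.
by rewrite sub0r normrN ger0_norm ?fine_ge0// -lee_fin fineK.
Unshelve. all: by end_near. Qed.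

Lemma ecvg0D u v : u @ \oo --> 0%E -> v @ \oo --> 0%E -> (fun k => u k + v k)%E @ \oo --> 0%E.
Proof. by move=> cu cv; rewrite -[X in _ --> X](adde0 0%E); apply: cvgeD. Qed.

Lemma ecvg0Z (c : R) u : u @ \oo --> 0%E -> (fun k => c%:E * u k)%E @ \oo --> 0%E.
Proof. by move=> cu; rewrite -[X in _ --> X](mule0 c%:E); exact: cvgeZl. Qed.

Lemma ecvg0_sum (I : Type) (s : seq I) (u : I -> nat -> \bar R) :
  (forall i, u i @ \oo --> 0%E) -> (fun k => \sum_(i <- s) u i k)%E @ \oo --> 0%E.
Proof.
move=> h; elim: s => [|i s IH].
  by under eq_fun do rewrite big_nil; exact: cvg_cst.
by under eq_fun do rewrite big_cons; exact: ecvg0D.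
Qed.

Lemma ecvg0_le u v : (forall k, (0 <= u k)%E) -> (forall k, (u k <= v k)%E) ->
  v @ \oo --> 0%E -> u @ \oo --> 0%E.
Proof.
move=> u0 uv cv; apply: (@squeeze_cvge _ _ _ _ (cst 0%E) u v) => //; last exact: cvg_cst.
by apply: nearW => k; rewrite u0 uv.
Qed.

End cvg0.

(** * Convergence in mean *)

Section L1_limits.
Context d (T : measurableType d) {R : realType} (mu : {measure set T -> \bar R}).
Variables (D : set T) (mD : measurable D).

Lemma L1_cvg_Rintegral (f_ : nat -> T -> R) (f : T -> R) :
  (forall k, mu.-integrable D (EFin \o f_ k)) -> mu.-integrable D (EFin \o f) ->
  (\int[mu]_(x in D) (`|f_ k x - f x|)%:E)%E @[k --> \oo] --> 0%E ->
  \int[mu]_(x in D) f_ k x @[k --> \oo] --> \int[mu]_(x in D) f x.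
Proof.
move=> If_ If h; apply/cvgrPdist_le => e e0.
have h0 k : (0 <= \int[mu]_(x in D) (`|f_ k x - f x|)%:E)%E.
  by apply: integral_ge0 => x _; rewrite lee_fin.
have := (ecvg0P h0).1 h e e0; apply: filterS => k hk.
rewrite distrC -RintegralB// -lee_fin; apply: le_trans hk.
apply: le_trans (_ : (\int[mu]_(x in D) `|f_ k x - f x|)%:E <= _)%E.
  rewrite lee_fin; apply: le_normr_Rintegral => //.
  by have := integrableB mD (If_ k) If.
rewrite /Rintegral fineK//; apply: integrable_fin_num => //.
by apply: integrable_norm; have := integrableB mD (If_ k) If.
Qed.

Lemma truncation_cvg0 (a : T -> R) : mu.-integrable D (EFin \o a) -> (forall x, 0 <= a x) ->
  (\int[mu]_(x in D) (Num.max (a x - k%:R) 0)%:E)%E @[k --> \oo] --> 0%E.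
Proof.
move=> Ia a0.
have ma : measurable_fun D a by apply/measurable_EFinP; exact: measurable_int Ia.
have [|||||_ _] := @dominated_convergence _ _ R mu D mD
    (fun k x => (Num.max (a x - k%:R) 0)%:E) (cst 0%E) (EFin \o a).
- move=> k; apply/measurable_EFinP; apply: measurable_maxr => //.
  by apply: measurable_funB.
- exact: measurable_cst.
- apply: aeW => x _; apply: cvg_EFin; first exact: nearW.
  apply: (@cvg_trans _ (cst (0 : R) @ \oo)); last exact: cvg_cst.
  apply: near_eq_cvg; near=> k => /=; apply/esym/max_idPr; rewrite subr_le0.
  by near: k; exact: nbhs_infty_ger.
- exact: Ia.
- apply: aeW => x k _; rewrite lee_fin ger0_norm ?le_max ?lexx ?orbT//.
  by rewrite ge_max a0 andbT lerBlDr lerDl.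
by rewrite integral0.
Unshelve. all: by end_near. Qed.

(** The factors [s_ k] are bounded by 2 and tend to 0 in mean: split [a] at a level [N]. *)
Lemma L1_mul_cvg0 (a : T -> R) (s_ : nat -> T -> R) :
  mu.-integrable D (EFin \o a) -> (forall x, 0 <= a x) ->
  (forall k, measurable_fun D (s_ k)) -> (forall k x, D x -> 0 <= s_ k x <= 2) ->
  (\int[mu]_(x in D) (s_ k x)%:E)%E @[k --> \oo] --> 0%E ->
  (\int[mu]_(x in D) (a x * s_ k x)%:E)%E @[k --> \oo] --> 0%E.
Proof.
move=> Ia a0 ms s02 hs.
have ma : measurable_fun D a by apply/measurable_EFinP; exact: measurable_int Ia.
apply/ecvg0P => [k|e e0].
  by apply: integral_ge0 => x Dx; have /andP[s0 _] := s02 k x Dx; rewrite lee_fin mulr_ge0.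
have t0 k : (0 <= \int[mu]_(x in D) (Num.max (a x - k%:R) 0)%:E)%E.
  by apply: integral_ge0 => x _; rewrite lee_fin le_max lexx orbT.
(* The excess of [a] over N is multiplied by at most 2, hence the budget e/4; below N there remains
   N times the integral of [s_ k], which the bound in [e1] keeps under e/2. *)
have [N _ /(_ N (leqnn N)) hN] := (ecvg0P t0).1 (truncation_cvg0 Ia a0) (e / 4) (divr_gt0 e0 (ltr0n _ 4)).
have h0 k : (0 <= \int[mu]_(x in D) (s_ k x)%:E)%E.
  by apply: integral_ge0 => x Dx; have /andP[s0 _] := s02 k x Dx; rewrite lee_fin.
have e1 : 0 < e / 2 / N.+1%:R by rewrite !divr_gt0.
have := (ecvg0P h0).1 hs _ e1; apply: filterS => k hk.
apply: (@le_trans _ _ (\int[mu]_(x in D) ((2 * Num.max (a x - N%:R) 0)%:E + (N%:R * s_ k x)%:E))%E).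
  apply: ge0_le_integral => //.
  - by move=> x Dx; have /andP[s0 _] := s02 k x Dx; rewrite lee_fin mulr_ge0.
  - by apply/measurable_EFinP; exact: measurable_funM.
  - apply/measurable_EFinP; apply: measurable_funD; apply: measurable_funM => //.
    by apply: measurable_maxr => //; exact: measurable_funB.
  - move=> x Dx; have /andP[s0 s2] := s02 k x Dx; rewrite lee_fin.
    have h1 : a x <= Num.max (a x - N%:R) 0 + N%:R by rewrite -lerBlDr le_max lexx.
    apply: le_trans (ler_wpM2r s0 h1) _; rewrite mulrDl lerD2r mulrC ler_wpM2r//.
    by rewrite le_max lexx orbT.
rewrite ge0_integralD//; last 4 first.
- by move=> x _; rewrite lee_fin mulr_ge0// le_max lexx orbT.
- apply/measurable_EFinP; apply: measurable_funM => //.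
  by apply: measurable_maxr => //; exact: measurable_funB.
- by move=> x Dx; have /andP[s0 _] := s02 k x Dx; rewrite lee_fin mulr_ge0.
- by apply/measurable_EFinP; exact: measurable_funM.
under eq_integral do rewrite EFinM.
rewrite ge0_integralZl//; last 2 first.
- by apply/measurable_EFinP; apply: measurable_maxr => //; exact: measurable_funB.
- by move=> x _; rewrite lee_fin le_max lexx orbT.
under [X in (_ + X)%E]eq_integral do rewrite EFinM.
rewrite ge0_integralZl//; last 2 first.
- by apply/measurable_EFinP.
- by move=> x Dx; have /andP[s0 _] := s02 k x Dx; rewrite lee_fin.
apply: (@le_trans _ _ (2%:E * (e / 4)%:E + N%:R%:E * (e / 2 / N.+1%:R)%:E)%E).
  by apply: leeD; apply: lee_wpmul2l.
rewrite -!EFinM -EFinD lee_fin.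
rewrite (_ : 2 * (e / 4) = e / 2); last by field.
rewrite [leRHS](splitr e) lerD2l.
by rewrite mulrCA ler_piMr ?divr_ge0 ?(ltW e0)// ler_pdivrMr// mul1r ler_nat.
Qed.

End L1_limits.

(** * The exterior domain and uniqueness of weak gradients *)

Section exterior.
Context {R : realType} {n : nat}.
Local Notation V := 'rV[R]_n.
Local Notation mu := (@lebesgue_rV R n).

Lemma closure_unit_ball : closure (@unit_ball R n) = ecball 1.
Proof.
apply/seteqP; split.
  rewrite [X in _ `<=` X](closure_id _).1; last exact: closed_ecball.
  by apply: closure_subset => x; rewrite /unit_ball /ecball/= => /ltW.
move=> x x1 B Bx.
have c : (fun t : R => t *: x) @ (1 : R)^'- --> x.
  rewrite -[X in _ --> X](scale1r x); apply: cvgZr_tmp.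
  by apply: cvg_at_left_filter; exact: cvg_id.
have H : \forall t \near (1 : R)^'-, 0 < t < 1 /\ B (t *: x).
  near=> t; split; last by near: t; exact: c Bx.
  apply/andP; split; last by near: t; exact: nbhs_left_lt.
  by near: t; exact: nbhs_left_gt.
have [t [/andP[t0 t1] Bt]] := filter_ex H.
exists (t *: x); split => //; rewrite /unit_ball/= enormZ gtr0_norm//.
by apply: le_lt_trans t1; rewrite ler_piMr// ltW.
Unshelve. all: by end_near. Qed.

Lemma exteriorE : @exterior R n = ~` ecball 1.
Proof. by rewrite /exterior closure_unit_ball. Qed.

Lemma exteriorP (x : V) : exterior x <-> 1 < enorm x.
Proof. by rewrite exteriorE /ecball/= ltNge; split => /negP. Qed.

Lemma open_exterior : open (@exterior R n).
Proof. by rewrite exteriorE; apply: closed_openC; exact: closed_ecball. Qed.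

Lemma measurable_exterior : measurable (@exterior R n).
Proof. by apply: open_measurable_rV; exact: open_exterior. Qed.

Lemma weak_gradient_unique (Omega : set V) (u : V -> R) (G G' : V -> V) : open Omega ->
  weak_gradient Omega u G -> weak_gradient Omega u G' ->
  {ae mu, forall x, Omega x -> G x = G' x}.
Proof.
move=> oO [_ lG hG] [_ lG' hG'].
(* Indexed by a natural number, vacuously for k >= n, so that [ae_foralln] can collect the
   coordinates. *)
have H k : {ae mu, forall x, Omega x -> forall i : 'I_n, i = k :> nat -> G x ord0 i = G' x ord0 i}.
  have [kn|kn] := ltnP k n; last first.
    by apply: aeW => x _ i ik; move: (ltn_ord i); rewrite ik ltnNge kn.
  pose i := Ordinal kn.
  have := @fundamental _ _ Omega (fun x => G x ord0 i - G' x ord0 i) oO.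
  have lB : loc_integrable Omega (fun x => G x ord0 i - G' x ord0 i).
    move=> K cK KO; have := integrableB (compact_measurable_rV cK) (lG i K cK KO) (lG' i K cK KO).
    by apply: eq_integrable => //; exact: compact_measurable_rV.
  move=> /(_ lB) H.
  have {H} : {ae mu, forall x, Omega x -> G x ord0 i - G' x ord0 i = 0}.
    apply: H => f tf; have [_ cf fO] := tf; have C1f := test_C1 tf.
    have I1 := test_mul_integrable oO (lG i) C1f cf fO.
    have I2 := test_mul_integrable oO (lG' i) C1f cf fO.
    have mO := open_measurable_rV oO.
    under eq_integral do rewrite mulrBl EFinB.
    rewrite integralB//.
    have E : \int[mu]_(x in Omega) (G x ord0 i * f x) = \int[mu]_(x in Omega) (G' x ord0 i * f x).
      by apply: oppr_inj; rewrite -hG// -hG'.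
    move: E; rewrite /Rintegral => E.
    by rewrite -[X in (X - _)%E]fineK ?integrable_fin_num// -[X in (_ - X)%E]fineK ?integrable_fin_num// E subee.
  apply: filterS => x h Ox j jk; have -> : j = i by exact/val_inj.
  by apply/eqP; rewrite -subr_eq0; apply/eqP; exact: h.
have /ae_foralln := H; apply: filterS => x h Ox.
by apply/rowP => i; exact: (h i).
Qed.

End exterior.

Section L1_more.
Context d (T : measurableType d) {R : realType} (mu : {measure set T -> \bar R}).
Variables (D : set T) (mD : measurable D).

Lemma L1_cvg_integrable (f_ : nat -> T -> R) (f : T -> R) :
  (forall k, mu.-integrable D (EFin \o f_ k)) -> measurable_fun D f ->
  (\int[mu]_(x in D) (`|f_ k x - f x|)%:E)%E @[k --> \oo] --> 0%E ->
  mu.-integrable D (EFin \o f).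
Proof.
move=> If_ mf h.
have h0 k : (0 <= \int[mu]_(x in D) (`|f_ k x - f x|)%:E)%E.
  by apply: integral_ge0 => x _; rewrite lee_fin.
have [N _ /(_ N (leqnn N)) hN] := (ecvg0P h0).1 h 1 ltr01.
have mfN : measurable_fun D (f_ N) by apply/measurable_EFinP; exact: measurable_int (If_ N).
have I1 : mu.-integrable D (EFin \o (fun x => f_ N x - f x)).
  apply/integrableP; split; first by apply/measurable_EFinP; exact: measurable_funB.
  by apply: le_lt_trans (ltry 1); exact: hN.
have := integrableB mD (If_ N) I1; apply: eq_integrable => // x _.
by rewrite /= -EFinB; congr EFin; ring.
Qed.

End L1_more.

(** * The flux identity for Sobolev functions *)

Section approximation.
Context {R : realType} {n : nat} (n_gt0 : (0 < n)%N).
Local Notation V := 'rV[R]_n.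
Local Notation mu := (@lebesgue_rV R n).

(** [Z] is the gradient of [z] on [exterior] and the constant [b] is its trace on the unit
    sphere; the latter is integrated over the unit ball along the rays. *)
Record approximates (z : V -> R) (Z : V -> V) (b : R) (z_ : nat -> V -> R) : Prop := {
  ap_C1 : forall k, C1 (z_ k);
  ap_mz : measurable_fun (@exterior R n) z;
  ap_mZ : forall i, measurable_fun (@exterior R n) (fun x => Z x ord0 i);
  ap_z : forall r, (\int[mu]_(x in exterior `&` ecball r) (`|z_ k x - z x|)%:E)%E
    @[k --> \oo] --> 0%E;
  ap_Z : forall r i, (\int[mu]_(x in exterior `&` ecball r)
    (`|partial i (z_ k) x - Z x ord0 i|)%:E)%E @[k --> \oo] --> 0%E;
  ap_b : (\int[mu]_(x in eball 1) (`|z_ k (normalize x) - b|)%:E)%E @[k --> \oo] --> 0%E }.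

Lemma continuous_bounded_ball (f : V -> R) r : continuous f ->
  exists M : R, forall x, ecball r x -> `|f x| <= M.
Proof.
move=> cf; have [r0|r0] := ltP r 0.
  by exists 0 => x /(le_trans (enorm_ge0 x)); rewrite leNgt r0.
have e0 : (ecball r : set V) !=set0 by exists (0 : V); rewrite /ecball/= enorm0.
have c0 : continuous (fun x => `|f x|) by move=> x; exact: (cvg_norm (cf x)).
have [x _ xM] := @EVT_max_rV R n (fun x => `|f x|) (ecball r) e0
  (@compact_ecball R n r) (continuous_subspaceT c0).
by exists `|f x| => y yr; apply: xM; rewrite inE.
Qed.

Let mK r : measurable (@exterior R n `&` ecball r).
Proof. by apply: measurableI; [exact: measurable_exterior|exact: measurable_ecball]. Qed.

Lemma continuous_shell_integrable (f : V -> R) r : continuous f ->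
  mu.-integrable (exterior `&` ecball r) (EFin \o f).
Proof.
move=> cf; have [M fM] := continuous_bounded_ball r cf.
apply: (@bounded_integrable _ _ _ _ M) => //.
- apply: le_lt_trans (lebesgue_rV_ecball n r); apply: le_measure; rewrite ?inE//.
  exact: measurable_ecball.
- by apply: measurable_funTS; exact: continuous_measurable_rV.
- by move=> x [_ xr]; exact: fM.
Qed.

(** Used for the difference of two functions with trace 1, which is then approximated with trace 0,
    the situation of [comparison]. *)
Lemma approxB z Z b z_ w W c w_ : approximates z Z b z_ -> approximates w W c w_ ->
  approximates (fun x => z x - w x) (fun x => Z x - W x) (b - c) (fun k x => z_ k x - w_ k x).
Proof.
move=> hz hw.
have pB k i x : is_derive x (delta_mx ord0 i) (fun x => z_ k x - w_ k x)
    (partial i (z_ k) x - partial i (w_ k) x).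
  by apply: is_deriveB; apply: derivableP; [exact: ((ap_C1 hz k).2 i).2|exact: ((ap_C1 hw k).2 i).2].
have pE k i : partial i (fun x => z_ k x - w_ k x) = fun x => partial i (z_ k) x - partial i (w_ k) x.
  by apply/funext => x; have [] := pB k i x.
have tri (D : set V) (f_ g_ : nat -> V -> R) (f g : V -> R) : measurable D ->
    (forall k, measurable_fun D (f_ k)) -> (forall k, measurable_fun D (g_ k)) ->
    measurable_fun D f -> measurable_fun D g ->
    (\int[mu]_(x in D) (`|f_ k x - f x|)%:E)%E @[k --> \oo] --> 0%E ->
    (\int[mu]_(x in D) (`|g_ k x - g x|)%:E)%E @[k --> \oo] --> 0%E ->
    (\int[mu]_(x in D) (`|(f_ k x - g_ k x) - (f x - g x)|)%:E)%E @[k --> \oo] --> 0%E.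
  move=> mD mf_ mg_ mf mg hf hg; apply: ecvg0_le (ecvg0D hf hg) => k.
    by apply: integral_ge0 => x _; rewrite lee_fin.
  rewrite -ge0_integralD//; last 2 first.
  - by apply/measurable_EFinP; apply: measurableT_comp => //; exact: measurable_funB.
  - by apply/measurable_EFinP; apply: measurableT_comp => //; exact: measurable_funB.
  apply: ge0_le_integral => //.
  - by apply/measurable_EFinP; apply: measurableT_comp => //; apply: measurable_funB; exact: measurable_funB.
  - by apply/measurable_EFinP; apply: measurable_funD;
      apply: measurableT_comp => //; exact: measurable_funB.
  - move=> x _; rewrite lee_fin (_ : _ - _ = (f_ k x - f x) - (g_ k x - g x)); last by ring.
    exact: ler_normB.
have cm (f : V -> R) D : continuous f -> measurable_fun D f.
  by move=> cf; apply: measurable_funTS; exact: continuous_measurable_rV.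
have sK r f : measurable_fun (@exterior R n) f -> measurable_fun (@exterior R n `&` ecball r) f.
  move=> mf; apply: measurable_funS mf; [exact: measurable_exterior|exact: subIsetl].
split.
- move=> k; split=> [x|i].
    exact: (cvgB ((ap_C1 hz k).1 x) ((ap_C1 hw k).1 x)).
  split=> [x|x]; last by have [] := pB k i x.
  by rewrite pE; exact: (cvgB (((ap_C1 hz k).2 i).1 x) (((ap_C1 hw k).2 i).1 x)).
- exact: measurable_funB (ap_mz hz) (ap_mz hw).
- move=> i; under eq_fun do rewrite !mxE.
  exact: measurable_funB (ap_mZ hz i) (ap_mZ hw i).
- move=> r; apply: tri => //; try by [apply: sK; exact: ap_mz hz|apply: sK; exact: ap_mz hw].
  + by move=> k; apply: cm; exact: (ap_C1 hz k).1.
  + by move=> k; apply: cm; exact: (ap_C1 hw k).1.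
  + exact: ap_z hz r.
  + exact: ap_z hw r.
- move=> r i; under eq_fun => k do (under eq_integral do rewrite pE !mxE).
  apply: tri => //; try by [apply: sK; exact: ap_mZ hz i|apply: sK; exact: ap_mZ hw i].
  + by move=> k; apply: cm; exact: ((ap_C1 hz k).2 i).1.
  + by move=> k; apply: cm; exact: ((ap_C1 hw k).2 i).1.
  + exact: ap_Z hz r i.
  + exact: ap_Z hw r i.
- apply: tri => //; [exact: measurable_eball| | |exact: ap_b hz|exact: ap_b hw].
  + move=> k; apply: measurable_funTS; apply: measurableT_comp.
      by apply: continuous_measurable_rV; exact: (ap_C1 hz k).1.
    exact: measurable_normalize.
  + move=> k; apply: measurable_funTS; apply: measurableT_comp.
      by apply: continuous_measurable_rV; exact: (ap_C1 hw k).1.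
    exact: measurable_normalize.
Qed.

Section identity.
(** [m] is a truncation applied to the values of z, [chi] a cutoff in space. The Lipschitz bound on
    [m'] makes [m' (z_ k)] converge in mean along with [z_ k]; [chi] is 1 on the unit ball, so the
    boundary term does not see it. *)
Variables (m m' : R -> R) (L : R) (chi : V -> R) (C : R).
Hypotheses (L_ge0 : 0 <= L) (dm : forall y : R, is_derive y (1 : R) m (m' y)) (cm' : continuous m')
  (m'01 : forall y, 0 <= m' y <= 1)
  (Lm' : forall a b, `|m' a - m' b| <= L * `|a - b|).
Hypotheses (C1chi : C1 chi) (bchi : bsupp chi) (chi01 : forall x, 0 <= chi x <= 1)
  (chi1 : forall x, enorm x <= 1 -> chi x = 1)
  (C_ge0 : 0 <= C) (dchi : forall x, `|edot x (gradient chi x)| <= C).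

Let cm : continuous m.
Proof.
move=> y; apply: differentiable_continuous; apply/derivable1_diffP.
by have [] := dm y.
Qed.

Let Lm a b : `|m a - m b| <= `|a - b|.
Proof.
have [t [_]] := @line_MVT R R m 1 b (a - b) (fun z => @ex_derive _ _ _ _ _ _ _ (dm z)).
rewrite [_ *: 1]mulr1 subrK => ->; rewrite (@derive_val _ _ _ _ _ _ _ (dm _)) normrM ler_piMr//.
by have /andP[h0 h1] := m'01 (t *: 1 + b); rewrite ger0_norm.
Qed.

(** For C^1 z and its gradient this is x . grad (chi m(z)) / |x|^n, expanded by the product and
    chain rules. In this form it makes sense with a weak gradient [Z]. *)
Let F (z : V -> R) (Z : V -> V) x :=
  (chi x * m' (z x) * edot x (Z x) + m (z x) * edot x (gradient chi x)) / enorm x ^+ n.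

Lemma F_C1 z : C1 z ->
  mu.-integrable exterior (EFin \o F z (gradient z)) /\
  \int[mu]_(x in exterior) F z (gradient z) x =
    - n%:R * \int[mu]_(x in eball 1) m (z (normalize x)).
Proof.
move=> C1z; pose w x := chi x * m (z x).
have pw i x : is_derive x (delta_mx ord0 i) w
    (chi x * (m' (z x) * partial i z x) + m (z x) * partial i chi x).
  apply: is_deriveM; first exact: derivableP ((C1chi.2 i).2 x).
  by exact: is_derive_comp1 (dm (z x)) (derivableP ((C1z.2 i).2 x)).
have pwE i : partial i w = fun x => chi x * (m' (z x) * partial i z x) + m (z x) * partial i chi x.
  by apply/funext => x; have [] := pw i x.
have cmz : continuous (fun x => m (z x)).
  by move=> x; exact: (@continuous_comp _ _ _ z m x (C1z.1 x) (@cm (z x))).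
have cmz' : continuous (fun x => m' (z x)).
  by move=> x; exact: (@continuous_comp _ _ _ z m' x (C1z.1 x) (@cm' (z x))).
have C1w : C1 w.
  split=> [x|i]; first exact: (cvgM (C1chi.1 x) (cmz x)).
  split=> [x|x]; last by have [] := pw i x.
  rewrite pwE.
  exact: (cvgD (cvgM (C1chi.1 x) (cvgM (cmz' x) ((C1z.2 i).1 x))) (cvgM (cmz x) ((C1chi.2 i).1 x))).
have bw : bsupp w by have [r r0 h] := bchi; exists r => // x /h cx; rewrite /w cx mul0r.
have E x : edot x (gradient w x) =
    chi x * m' (z x) * edot x (gradient z x) + m (z x) * edot x (gradient chi x).
  rewrite /edot !mulr_sumr -big_split/=; apply: eq_bigr => i _.
  by rewrite !mxE pwE; ring.
have FE x : F z (gradient z) x = edot x (gradient w x) / enorm x ^+ n by rewrite E.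
split.
  have bP : bsupp (fun x => edot x (gradient w x)).
    have [r r0 wr] := bsupp_gradient bw; exists r => // x /wr[_ g0].
    by rewrite g0 /edot big1// => i _; rewrite mxE mulr0.
  have := integrable_radial (edot_gradient_continuous C1w) bP.
  move=> /(integrableS measurableT measurable_exterior (@subsetT _ _)).
  apply: eq_integrable; first exact: measurable_exterior.
  move=> x xe; rewrite /= FE -exteriorE indicE xe mul1r.
  by rewrite mulrC.
under eq_Rintegral do rewrite FE.
rewrite [X in Rintegral _ X](exteriorE) radial_divergence//; congr (_ * _).
apply: eq_Rintegral => x _; rewrite /w chi1 ?mul1r// /normalize enormZ.
have [->|x0] := eqVneq x 0; first by rewrite enorm0 mulr0.
by rewrite normfV ger0_norm ?enorm_ge0// mulVf// gt_eqF// enorm_gt0.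
Qed.

Lemma norm_radial_le (x W : V) : exterior x ->
  `|edot x W / enorm x ^+ n| <= \sum_(i < n) `|W ord0 i|.
Proof.
move=> /exteriorP x1; have x0 : 0 < enorm x by exact: lt_trans x1.
rewrite normrM normfV [`|enorm x ^+ n|]ger0_norm ?exprn_ge0 ?enorm_ge0//.
rewrite ler_pdivrMr ?exprn_gt0//.
apply: (@le_trans _ _ ((\sum_(i < n) `|W ord0 i|) * enorm x)).
  rewrite mulr_suml; apply: le_trans (ler_norm_sum _ _ _) _; apply: ler_sum => i _.
  by rewrite normrM mulrC ler_wpM2l// coor_le_enorm.
by rewrite ler_wpM2l ?sumr_ge0// -[leLHS]expr1 ler_weXn2l// ltW.
Qed.

(** The identity [F_C1] holds for the C^1 approximants by [radial_divergence]. Both sides converge: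
    the left one because the integrands converge in mean, the right one because [m] is 1-Lipschitz
    and the trace is the constant b. *)
Lemma approx_identity z Z b z_ : approximates z Z b z_ ->
  mu.-integrable exterior (EFin \o F z Z) /\
  \int[mu]_(x in exterior) F z Z x = - n%:R * vball n * m b.
Proof.
move=> h.
have mext := @measurable_exterior R n.
have mE r f : measurable_fun (@exterior R n) f -> measurable_fun (@exterior R n `&` ecball r) f.
  by move=> mf; apply: measurable_funS mf; [exact: measurable_exterior|exact: subIsetl].
have mc (f : V -> R) D : continuous f -> measurable_fun D f.
  by move=> cf; apply: measurable_funTS; exact: continuous_measurable_rV.
have mm : measurable_fun setT m by exact: continuous_measurable_fun.
have mm' : measurable_fun setT m' by exact: continuous_measurable_fun.
have [r r0 cr] := bsupp_gradient bchi.
have mZ := ap_mZ h; have mz := ap_mz h.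
have medot (W : V -> V) D : (forall i, measurable_fun D (fun x => W x ord0 i)) ->
    measurable_fun D (fun x => edot x (W x)).
  move=> mW; apply: measurable_sum => i; apply: measurable_funM => //.
  by apply: measurable_funTS; exact: measurable_coors.
have mpow : measurable_fun setT (fun x : V => (enorm x ^+ n)^-1).
  rewrite (_ : (fun x => _) = fun x => enorm x `^ (- n%:R)).
    by apply: (measurableT_comp (measurable_powR _)); exact: measurable_enorm.
  by apply/funext => x; rewrite powR_invn// enorm_ge0.
have mF : measurable_fun exterior (F z Z).
  apply: measurable_funM; last exact: measurable_funTS.
  apply: measurable_funD; apply: measurable_funM.
  - by apply: measurable_funM; [exact: mc C1chi.1|exact: measurableT_comp].
  - exact: medot.
  - exact: measurableT_comp.
  - apply: medot => i; under eq_fun do rewrite mxE.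
    exact: mc (C1chi.2 i).1.
(* Beyond radius r both [chi] and its gradient vanish, so convergence on this bounded shell is
   enough. *)
pose K := @exterior R n `&` ecball r.
have mKK : measurable K by exact: mK.
pose a x := \sum_(i < n) `|Z x ord0 i|.
have Ia : mu.-integrable K (EFin \o a).
  rewrite (_ : EFin \o a = fun x => (\sum_(i <- index_enum 'I_n) (`|Z x ord0 i|)%:E)%E).
    apply: integrable_sum => [|i _]; first exact: mK.
    apply: integrable_norm.
    apply: (@L1_cvg_integrable _ _ _ mu K (mK r) (fun k => partial i (z_ k))) => //.
    + by move=> k; apply: continuous_shell_integrable; exact: ((ap_C1 h k).2 i).1.
    + by apply: mE; exact: mZ.
    + exact: ap_Z h r i.
  by apply/funext => x; rewrite /a/= sumEFin.
have a0 x : 0 <= a x by exact: sumr_ge0.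
have ma : measurable_fun K a by apply/measurable_EFinP; exact: measurable_int Ia.
pose s_ k x := `|m' (z_ k x) - m' (z x)|.
have s0 k x : 0 <= s_ k x by exact: normr_ge0.
have mzk k D : measurable_fun D (z_ k) by apply: mc; exact: (ap_C1 h k).1.
have ms k : measurable_fun K (s_ k).
  apply: measurableT_comp => //; apply: measurable_funB; apply: measurableT_comp => //.
  exact: mE.
have cs : (\int[mu]_(x in K) (s_ k x)%:E)%E @[k --> \oo] --> 0%E.
  apply: ecvg0_le (ecvg0Z L (ap_z h r)) => k.
    by apply: integral_ge0 => x _; rewrite lee_fin /s_.
  rewrite -ge0_integralZl//; last first.
    apply/measurable_EFinP; apply: measurableT_comp => //; apply: measurable_funB => //.
    exact: mE.
  apply: ge0_le_integral.
  - exact: mK.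
  - by move=> x _; rewrite lee_fin /s_.
  - by apply/measurable_EFinP; exact: ms.
  - apply/measurable_EFinP; apply: measurable_funM => //; apply: measurableT_comp => //.
    by apply: measurable_funB => //; exact: mE.
  - by move=> x _; rewrite -EFinM lee_fin; exact: Lm'.
have s02 k x : K x -> 0 <= s_ k x <= 2.
  move=> _; rewrite /s_ normr_ge0/=.
  have /andP[p0 p1] := m'01 (z_ k x); have /andP[q0 q1] := m'01 (z x).
  by rewrite ler_norml; apply/andP; split; lra.
have c1 := L1_mul_cvg0 (mK r) Ia a0 ms s02 cs.
have c2 : (\sum_(i <- index_enum 'I_n) \int[mu]_(x in K) (`|partial i (z_ k) x - Z x ord0 i|)%:E)%E
    @[k --> \oo] --> 0%E.
  exact: (@ecvg0_sum R _ (index_enum 'I_n) (fun i k => (\int[mu]_(x in K)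
    (`|partial i (z_ k) x - Z x ord0 i|)%:E)%E) (fun i => ap_Z h r i)).
have cF : (\int[mu]_(x in exterior) (`|F (z_ k) (gradient (z_ k)) x - F z Z x|)%:E)%E
    @[k --> \oo] --> 0%E.
  apply: ecvg0_le (ecvg0D (ecvg0D c2 c1) (ecvg0Z C (ap_z h r))) => k.
    by apply: integral_ge0 => x _; rewrite lee_fin.
  have mpk i : measurable_fun K (fun x => partial i (z_ k) x).
    by apply: mc; exact: ((ap_C1 h k).2 i).1.
  have mB i : measurable_fun K (fun x => (`|partial i (z_ k) x - Z x ord0 i|)%:E).
    apply/measurable_EFinP; apply: measurableT_comp => //; apply: measurable_funB => //.
    by apply: mE; exact: mZ.
  have mD : measurable_fun K (fun x => (`|z_ k x - z x|)%:E).
    apply/measurable_EFinP; apply: measurableT_comp => //; apply: measurable_funB => //.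
    exact: mE.
  have mas : measurable_fun K (fun x => (a x * s_ k x)%:E).
    by apply/measurable_EFinP; exact: measurable_funM.
  have mS : measurable_fun K (fun x => (\sum_(i <- index_enum 'I_n) (`|partial i (z_ k) x - Z x ord0 i|)%:E)%E).
    by apply: emeasurable_sum => i.
  cbv beta; rewrite -/K -ge0_integral_sum// -ge0_integralD//; last 2 first.
  - by move=> x _; apply: sume_ge0 => i _; rewrite lee_fin.
  - by move=> x _; rewrite lee_fin mulr_ge0.
  rewrite -ge0_integralZl// -ge0_integralD//; last 4 first.
  - by move=> x _; apply: adde_ge0; [apply: sume_ge0 => i _; rewrite lee_fin|rewrite lee_fin mulr_ge0].
  - exact: emeasurable_funD.
  - by move=> x _; rewrite -EFinM lee_fin mulr_ge0.
  - exact: measurable_funeM.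
  rewrite (_ : (\int[mu]_(x in exterior) _ = \int[mu]_(x in K) (`|F (z_ k) (gradient (z_ k)) x - F z Z x|)%:E)%E); last first.
    rewrite integral_mkcond [RHS]integral_mkcond; apply: eq_integral => x _; rewrite !patchE.
    have [xe|xe] := boolP (x \in exterior); last first.
      by case: ifP => // /set_mem[/mem_set]; rewrite (negbTE xe).
    have [xr|xr] := leP (enorm x) r.
      by rewrite mem_set//; split => //; exact: set_mem.
    rewrite memNset; last by move=> [_]; rewrite /ecball/= leNgt xr.
    have [x0 gx0] := cr x (ltW xr).
    have e0 : edot x (gradient chi x) = 0.
      by rewrite gx0 /edot big1// => i _; rewrite mxE mulr0.
    by rewrite /F x0 e0 !mul0r !mulr0 addr0 mul0r subrr normr0.
  apply: ge0_le_integral.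
  - exact: mK.
  - by move=> x _; rewrite lee_fin.
  - apply/measurable_EFinP; apply: measurableT_comp => //; apply: measurable_funB; apply: mE => //.
    have [/measurable_int + _] := F_C1 (ap_C1 h k).
    by move=> /measurable_EFinP.
  - by apply: emeasurable_funD; [exact: emeasurable_funD|exact: measurable_funeM].
  - move=> x [xe _]; rewrite sumEFin -!EFinM -!EFinD lee_fin.
    pose e W := edot x W / enorm x ^+ n.
    have eB W W' : e W - e W' = e (W - W') by rewrite /e edotBr mulrBl.
    (* Three differences: gradients, multiplied by a factor in [0, 1]; values of [m'], against the
       fixed integrable [Z], where [L1_mul_cvg0] enters; values of [m], against the bounded radial
       derivative of [chi]. *)
    have -> : F (z_ k) (gradient (z_ k)) x - F z Z x =
       chi x * m' (z_ k x) * e (gradient (z_ k) x - Z x) + chi x * ((m' (z_ k x) - m' (z x)) * e (Z x))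
       + (m (z_ k x) - m (z x)) * e (gradient chi x).
      by rewrite -eB /F /e; ring.
    have /andP[h0 h1] := chi01 x; have /andP[p0 p1] := m'01 (z_ k x).
    apply: le_trans (ler_normD _ _) _; apply: lerD.
      apply: le_trans (ler_normD _ _) _; apply: lerD.
        rewrite normrM -[leRHS]mul1r ler_pM//.
          by rewrite ger0_norm ?mulr_ge0// mulr_ile1.
        apply: le_trans (norm_radial_le _ xe) _.
        by apply: ler_sum => i _; rewrite !mxE.
      rewrite normrM -[leRHS]mul1r ler_pM//; first by rewrite ger0_norm.
      by rewrite normrM mulrC ler_pM// norm_radial_le.
    rewrite normrM mulrC ler_pM//.
    rewrite /e normrM; apply: le_trans (dchi x); rewrite ler_piMr// normfV.
    move: xe => /exteriorP x1.
    by rewrite ger0_norm ?exprn_ge0 ?enorm_ge0// invf_le1 ?exprn_ege1 ?(ltW x1)// exprn_gt0// (lt_trans ltr01).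
have IFk k := (F_C1 (ap_C1 h k)).1.
have IF : mu.-integrable exterior (EFin \o F z Z).
  exact: (L1_cvg_integrable mext IFk).
split => //.
have lim1 := L1_cvg_Rintegral mext IFk IF cF.
have Fink : (mu (eball 1) < +oo)%E by exact: lebesgue_eball1_lty.
have mB := @measurable_eball R n 1.
have bn (x : V) : eball 1 x -> ecball 1 (normalize x).
  move=> _; rewrite /ecball/= /normalize enormZ.
  have [->|x0] := eqVneq x 0; first by rewrite enorm0 mulr0.
  by rewrite normfV ger0_norm ?enorm_ge0// mulVf// gt_eqF// enorm_gt0.
have Ib : mu.-integrable (eball 1) (EFin \o (fun=> m b)).
  by apply: (@bounded_integrable _ _ _ _ `|m b|).
have Imk k : mu.-integrable (eball 1) (EFin \o (fun x => m (z_ k (normalize x)))).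
  have cmz : continuous (fun x => m (z_ k x)).
    by move=> x; exact: (@continuous_comp _ _ _ (z_ k) m x ((ap_C1 h k).1 x) (@cm (z_ k x))).
  have [M mM] := continuous_bounded_ball 1 cmz.
  apply: (@bounded_integrable _ _ _ _ M) => //; last by move=> x /bn; exact: mM.
  apply: measurableT_comp => //; apply: measurable_funTS; apply: measurableT_comp => //.
  exact: measurable_normalize.
have cb : (\int[mu]_(x in eball 1) (`|m (z_ k (normalize x)) - m b|)%:E)%E @[k --> \oo] --> 0%E.
  apply: ecvg0_le (ap_b h) => k.
    by apply: integral_ge0 => x _; rewrite lee_fin.
  have mn : measurable_fun (eball 1) (fun x : V => z_ k (normalize x)).
    by apply: measurable_funTS; apply: measurableT_comp => //; exact: measurable_normalize.
  apply: ge0_le_integral => //.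
  - apply/measurable_EFinP; apply: measurableT_comp => //; apply: measurable_funB => //.
    exact: measurableT_comp.
  - by apply/measurable_EFinP; apply: measurableT_comp => //; exact: measurable_funB.
  - by move=> x _; rewrite lee_fin.
have lim2 := L1_cvg_Rintegral mB Imk Ib cb.
have lim3 : \int[mu]_(x in exterior) F (z_ k) (gradient (z_ k)) x @[k --> \oo] -->
    - n%:R * \int[mu]_(x in eball 1) m b.
  under eq_fun => k do rewrite (F_C1 (ap_C1 h k)).2.
  exact: cvgMr.
rewrite -(cvg_lim _ lim1)// (cvg_lim _ lim3)// Rintegral_cst//.
by rewrite -mulrA; congr (_ * _); rewrite mulrC.
Qed.

End identity.
End approximation.

(** * C^1 truncations of the positive part *)

Section truncations.
Context {R : realType}.
Implicit Types t y j : R.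

Definition possqr t : R := (Num.max t 0) ^+ 2.

Lemma is_derive_possqr t : is_derive t (1 : R) possqr (2 * Num.max t 0).
Proof.
have [t0|t0|t0] := ltgtP t 0.
- rewrite mulr0.
  apply: (near_eq_is_derive _ (is_derive_cst (0 : R) t (1 : R))).
  near=> z; rewrite /possqr max_r ?expr0n//= ltW//.
  by near: z; exact: lt_nbhsl.
-
  have D : is_derive t (1 : R) (id ^+ 2 : R -> R) (2 * t).
    have D := is_deriveX 2 (is_derive_id t (1 : R)).
    by apply: (is_derive_eq D); rewrite /GRing.scale/= mulr1 expr1.
  apply: near_eq_is_derive D.
  near=> z; rewrite exprfctE /possqr max_l// ltW//.
  by near: z; exact: lt_nbhsr.
rewrite t0 mulr0; apply: is_derive_cvg; apply: norm_cvg0.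
apply: (@squeeze_cvgr _ _ _ _ (cst 0) (fun h : R => `|h|)).
- near=> h; have h0 : h != 0 by near: h; exact: nbhs_dnbhs_neq.
  rewrite normr_ge0/= addr0 [_ *: 1]mulr1 /possqr maxxx expr0n subr0.
  rewrite /GRing.scale/= normrM normfV ler_pdivrMl ?normr_gt0// -expr2 normrX lerXn2r ?nnegrE//.
  by rewrite ger0_norm ?le_max ?lexx ?orbT// ge_max ler_norm normr_ge0.
- exact: cvg_cst.
- rewrite -[X in _ --> X](normr0 R); apply: cvg_norm; exact: cvg_within.
Unshelve. all: by end_near. Qed.

Lemma max0_lip t y : `|Num.max t 0 - Num.max y 0| <= `|t - y|.
Proof.
have [t0|t0] := leP t 0; have [y0|y0] := leP y 0; rewrite ?subrr ?normr0 ?subr0 ?sub0r ?normrN//.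
- by rewrite distrC (gtr0_norm y0) (ger0_norm (_ : 0 <= y - t)) ?subr_ge0 ?(ltW (le_lt_trans t0 y0))// lerBrDr gerDl.
- by rewrite (gtr0_norm t0) (ger0_norm (_ : 0 <= t - y)) ?subr_ge0 ?(ltW (le_lt_trans y0 t0))// lerBrDr gerDl.
Qed.

(** For j > 0, [clamp j] is the ramp that rises from 0 at 0 to 1 at 1/j, written with positive
    parts, and [softpos j] is its primitive: a C^1 function tending to the positive part as j grows,
    while its derivative tends to the indicator of y > 0. *)
Definition clamp j y : R := j * (Num.max y 0 - Num.max (y - j^-1) 0).
Definition softpos j y : R := j / 2 * (possqr y - possqr (y - j^-1)).

Lemma is_derive_softpos j y : is_derive y (1 : R) (softpos j) (clamp j y).
Proof.
have D2 : is_derive y (1 : R) (fun y => possqr (y - j^-1)) (2 * Num.max (y - j^-1) 0).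
  apply: (is_derive_line _ (is_derive_possqr (y - j^-1))) => h.
  by rewrite addrA.
have := is_deriveZ (j / 2) (is_deriveB (is_derive_possqr y) D2).
move=> D; apply: (is_derive_eq D); rewrite /clamp /GRing.scale/=.
by rewrite -mulrBr mulrA divfK.
Qed.

Lemma clamp_continuous j : continuous (clamp j).
Proof.
have c (f : R -> R) : continuous f -> continuous (fun y => Num.max (f y) 0) by exact: continuous_max0.
move=> y; apply: cvgMr; apply: cvgB.
  by apply: (c id) => z; exact: cvg_id.
by apply: (c (fun y => y - j^-1)) => z; apply: cvgB; [exact: cvg_id|exact: cvg_cst].
Qed.

Lemma clamp_lip j a b : 0 < j -> `|clamp j a - clamp j b| <= (2 * j) * `|a - b|.
Proof.
move=> j0; rewrite /clamp -mulrBr normrM (gtr0_norm j0) mulrAC mulrC ler_pM2r//.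
rewrite (_ : _ - _ = (Num.max a 0 - Num.max b 0) - (Num.max (a - j^-1) 0 - Num.max (b - j^-1) 0)); last by ring.
apply: le_trans (ler_normB _ _) _; rewrite mulr_natl mulr2n lerD ?max0_lip//.
by apply: le_trans (max0_lip _ _) _; rewrite opprB addrA subrK.
Qed.

Lemma clamp01 j y : 0 < j -> 0 <= clamp j y <= 1.
Proof.
move=> j0; have jV : 0 < j^-1 by rewrite invr_gt0.
have jj : j * j^-1 = 1 by rewrite mulfV// gt_eqF.
rewrite /clamp; set i := j^-1 in jV jj *.
by have [h1|h1] := leP y 0; have [h2|h2] := leP (y - i) 0; apply/andP; split; nra.
Qed.

Lemma clamp_le0 j y : 0 < j -> y <= 0 -> clamp j y = 0.
Proof.
move=> j0 y0; have jV : 0 < j^-1 by rewrite invr_gt0.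
by rewrite /clamp !max_r ?subrr ?mulr0//; lra.
Qed.

Lemma clamp_eq1 j y : 0 < j -> j^-1 <= y -> clamp j y = 1.
Proof.
move=> j0 y0; have jV : 0 < j^-1 by rewrite invr_gt0.
rewrite /clamp !max_l ?subr_ge0//; last exact: le_trans (ltW jV) y0.
by rewrite opprB addrC subrK mulfV// gt_eqF.
Qed.

Lemma softpos_le0 j y : 0 < j -> y <= 0 -> softpos j y = 0.
Proof.
move=> j0 y0; have jV : 0 < j^-1 by rewrite invr_gt0.
by rewrite /softpos /possqr !max_r ?subrr ?mulr0//; lra.
Qed.

Lemma softpos_ge j y : 0 < j -> j^-1 <= y -> softpos j y = y - j^-1 / 2.
Proof.
move=> j0 y0; have jV : 0 < j^-1 by rewrite invr_gt0.
rewrite /softpos /possqr !max_l ?subr_ge0//; last exact: le_trans (ltW jV) y0.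
by field; rewrite gt_eqF.
Qed.

Lemma softpos_bounds j y : 0 < j -> 0 <= softpos j y <= Num.max y 0.
Proof.
move=> j0; have jV : 0 < j^-1 by rewrite invr_gt0.
have jj : j * j^-1 = 1 by rewrite mulfV// gt_eqF.
have [y0|y0] := leP y 0; first by rewrite softpos_le0// lexx.
have [h|h] := leP j^-1 y; first by rewrite softpos_ge//; apply/andP; split; lra.
rewrite /softpos /possqr (max_l (ltW y0)) max_r ?subr_le0 ?(ltW h)//.
rewrite expr0n/= subr0; set i := j^-1 in h jV jj *.
have h2 : j * y <= 1 by rewrite -jj ler_pM2l// ltW.
by apply/andP; split; nra.
Qed.

Lemma softpos_gt0 j y : 0 < j -> 0 < y -> 0 < softpos j y.
Proof.
move=> j0 y0; have jV : 0 < j^-1 by rewrite invr_gt0.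
have [h|h] := leP j^-1 y; first by rewrite softpos_ge//; lra.
rewrite /softpos /possqr (max_l (ltW y0)) max_r ?subr_le0 ?(ltW h)//.
by rewrite expr0n/= subr0 mulr_gt0 ?divr_gt0 ?exprn_gt0.
Qed.

End truncations.

Section continuous_arithmetic.
Context {R : realType} {T : topologicalType}.
Implicit Types f g : T -> R.

Lemma cont_cst (c : R) : continuous (fun _ : T => c).
Proof. exact: cst_continuous. Qed.

Lemma cont_sub f g : continuous f -> continuous g -> continuous (fun x => f x - g x).
Proof. by move=> cf cg x; exact: (cvgB (cf x) (cg x)). Qed.

Lemma cont_mul f g : continuous f -> continuous g -> continuous (fun x => f x * g x).
Proof. by move=> cf cg x; exact: (cvgM (cf x) (cg x)). Qed.

Lemma cont_opp f : continuous f -> continuous (fun x => - f x).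
Proof. by move=> cf x; exact: (cvgN (cf x)). Qed.

Lemma cont_comp (F : R -> R) f : continuous F -> continuous f -> continuous (fun x => F (f x)).
Proof. by move=> cF cf x; exact: (@continuous_comp _ _ _ f F x (cf x) (cF (f x))). Qed.

End continuous_arithmetic.

(** * Radial cutoffs *)

Section cutoff.
Context {R : realType} {n : nat}.
Local Notation V := 'rV[R]_n.
Implicit Types x : V.

Lemma is_derive_sqr_enorm x i :
  is_derive x (delta_mx ord0 i) (fun x : V => enorm x ^+ 2) (2 * x ord0 i).
Proof.
have e1 : enorm (delta_mx ord0 i : V) ^+ 2 = 1.
  rewrite sqr_enorm (bigD1 i)//= big1 ?addr0 => [|j ji]; first by rewrite mxE !eqxx expr1n.
  by rewrite mxE (negbTE ji) andbF expr0n.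
have e2 : edot x (delta_mx ord0 i) = x ord0 i.
  rewrite /edot (bigD1 i)//= big1 ?addr0 => [|j ji]; first by rewrite mxE !eqxx mulr1.
  by rewrite mxE (negbTE ji) andbF mulr0.
apply: is_derive_cvg.
apply: (@cvg_trans _ ((fun h : R => h + 2 * x ord0 i) @ (0 : R)^')).
  apply: near_eq_cvg; near=> h => /=.
  have h0 : h != 0 by near: h; exact: nbhs_dnbhs_neq.
  rewrite -!edotxx edotDr ![edot (_ + _) _]edotC !edotDr !edotZr !edotZl !edotxx e1.
  by rewrite [edot (delta_mx _ _) _]edotC e2 /GRing.scale/=; field.
have H : h + 2 * x ord0 i @[h --> (0 : R)^'] --> 0 + 2 * x ord0 i.
  by apply: cvgD; [exact: cvg_within|exact: cvg_cst].
by rewrite add0r in H; exact: H.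
Unshelve. all: by end_near. Qed.

(** Unlike a function of [|x|/A], this is constant on the unit ball; [x . grad] of it is
    nonpositive and bounded independently of [A]. *)
Definition cutoff (A : R) x : R := possqr (1 - possqr ((enorm x ^+ 2 - 1) / A)).

(** The derivative of the cutoff with respect to |x|^2. The inner [possqr] makes it vanish at the
    unit sphere, the outer one where |x|^2 reaches 1 + A, so both transitions are C^1. *)
Let dcutoff A x : R := - (4 * Num.max (1 - possqr ((enorm x ^+ 2 - 1) / A)) 0 *
  Num.max ((enorm x ^+ 2 - 1) / A) 0 / A).

Lemma is_derive_cutoff A x i :
  is_derive x (delta_mx ord0 i) (cutoff A) (dcutoff A x * (2 * x ord0 i)).
Proof.
have D1 : is_derive x (delta_mx ord0 i) (fun x : V => (enorm x ^+ 2 - 1) / A) (A^-1 * (2 * x ord0 i)).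
  have D := is_deriveZ A^-1 (is_deriveB (is_derive_sqr_enorm x i) (is_derive_cst (1 : R) x (delta_mx ord0 i))).
  rewrite (_ : (fun x => _) = A^-1 \*: ((fun x : V => enorm x ^+ 2) - cst 1)); last first.
    by apply/funext => y; rewrite /GRing.scale/= mulrC.
  by apply: (is_derive_eq D); rewrite subr0.
have D2 := is_derive_comp1 (is_derive_possqr ((enorm x ^+ 2 - 1) / A)) D1.
have D3 : is_derive x (delta_mx ord0 i) (fun x : V => 1 - possqr ((enorm x ^+ 2 - 1) / A))
    (- (2 * Num.max ((enorm x ^+ 2 - 1) / A) 0 * (A^-1 * (2 * x ord0 i)))).
  have D := is_deriveB (is_derive_cst (1 : R) x (delta_mx ord0 i)) D2.
  by apply: (is_derive_eq D); rewrite sub0r.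
have D4 := is_derive_comp1 (is_derive_possqr (1 - possqr ((enorm x ^+ 2 - 1) / A))) D3.
by apply: (is_derive_eq D4); rewrite /dcutoff; ring.
Qed.

Lemma cutoff_C1 A : C1 (cutoff A).
Proof.
have cpos : continuous (@possqr R).
  move=> t; apply: differentiable_continuous; apply/derivable1_diffP.
  by have [] := is_derive_possqr t.
have c1 : continuous (fun x : V => (enorm x ^+ 2 - 1) / A).
  apply: cont_mul; last exact: cont_cst.
  apply: cont_sub; last exact: cont_cst.
  exact: sqr_enorm_continuous.
have c2 : continuous (fun x : V => 1 - possqr ((enorm x ^+ 2 - 1) / A)).
  apply: cont_sub; first exact: cont_cst.
  exact: (cont_comp cpos c1).
split; first exact: (cont_comp cpos c2).
move=> i; split; last by move=> x; have [] := is_derive_cutoff A x i.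
rewrite (_ : partial i (cutoff A) = fun x => dcutoff A x * (2 * x ord0 i)); last first.
  by apply/funext => x; have [] := is_derive_cutoff A x i.
apply: cont_mul; last first.
  by apply: cont_mul; [exact: cont_cst|exact: coors_continuous].
apply: cont_opp; apply: cont_mul; last exact: cont_cst.
apply: cont_mul; last exact: continuous_max0.
by apply: cont_mul; [exact: cont_cst|exact: continuous_max0].
Qed.

Lemma edot_gradient_cutoff A x : edot x (gradient (cutoff A) x) =
  - (8 * Num.max (1 - possqr ((enorm x ^+ 2 - 1) / A)) 0 *
  Num.max ((enorm x ^+ 2 - 1) / A) 0 * (enorm x ^+ 2 / A)).
Proof.
transitivity (\sum_(i < n) 2 * dcutoff A x * x ord0 i ^+ 2).
  apply: eq_bigr => i _; rewrite mxE /partial (@derive_val _ _ _ _ _ _ _ (is_derive_cutoff A x i)).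
  by ring.
by rewrite -mulr_sumr -sqr_enorm /dcutoff; ring.
Qed.

Lemma possqr01 (t : R) : t <= 1 -> 0 <= possqr t <= 1.
Proof.
move=> t1; rewrite /possqr sqr_ge0/= exprn_ile1//; first by rewrite le_max lexx orbT.
by rewrite ge_max t1 ler01.
Qed.

Lemma cutoff01 A x : 0 <= cutoff A x <= 1.
Proof. by apply: possqr01; rewrite gerDl oppr_le0 sqr_ge0. Qed.

Lemma cutoff1 A x : 0 < A -> enorm x <= 1 -> cutoff A x = 1.
Proof.
move=> A0 x1; rewrite /cutoff /possqr [X in 1 - X ^+ 2]max_r.
  by rewrite expr0n/= subr0 max_l// expr1n.
rewrite pmulr_lle0 ?invr_gt0// subr_le0 exprn_ile1//; exact: enorm_ge0.
Qed.

Lemma cutoff_bsupp A : 0 < A -> bsupp (cutoff A).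
Proof.
move=> A0; exists (1 + A) => [|x xA]; first by rewrite addr_gt0.
have h : 1 <= (enorm x ^+ 2 - 1) / A.
  rewrite ler_pdivlMr// mul1r lerBrDr.
  apply: (@le_trans _ _ ((1 + A) ^+ 2)); first by nra.
  by rewrite lerXn2r ?nnegrE ?enorm_ge0// addr_ge0// ltW.
rewrite /cutoff /possqr [X in 1 - X ^+ 2]max_l ?(le_trans ler01)//.
by rewrite max_r ?expr0n// subr_le0 exprn_ege1.
Qed.

Lemma cutoff_gradient_le0 A x : 0 < A -> edot x (gradient (cutoff A) x) <= 0.
Proof.
move=> A0; have h (t : R) : 0 <= Num.max t 0 by rewrite le_max lexx orbT.
have h2 : 0 <= enorm x ^+ 2 / A by rewrite divr_ge0 ?sqr_ge0// ltW.
by rewrite edot_gradient_cutoff oppr_le0 mulr_ge0// mulr_ge0// mulr_ge0.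
Qed.

(** Strictness is what allows [comparison] to exclude the points where the truncated function is
    positive. *)
Lemma cutoff_gradient_lt0 A x : 0 < A -> 1 < enorm x -> enorm x ^+ 2 < 1 + A ->
  edot x (gradient (cutoff A) x) < 0.
Proof.
move=> A0 x1 xA; have h0 : 0 < (enorm x ^+ 2 - 1) / A.
  by rewrite divr_gt0// subr_gt0 exprn_egt1.
have h1 : (enorm x ^+ 2 - 1) / A < 1 by rewrite ltr_pdivrMr// mul1r ltrBlDl.
have h2 : possqr ((enorm x ^+ 2 - 1) / A) < 1.
  by rewrite /possqr max_l ?(ltW h0)// exprn_ilt1// ltW.
have h3 : 0 < enorm x ^+ 2 / A by rewrite divr_gt0// exprn_gt0// (lt_trans ltr01).
rewrite edot_gradient_cutoff oppr_lt0 mulr_gt0// mulr_gt0// ?lt_max ?h0//.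
by rewrite mulr_gt0// lt_max subr_gt0 h2.
Qed.

(** Where the gradient does not vanish, |x|^2 < 1 + A <= 2 A; the bound is then 8 times two factors
    at most 1 times |x|^2 / A <= 2. *)
Lemma cutoff_gradient_bound A x : 1 <= A -> `|edot x (gradient (cutoff A) x)| <= 16.
Proof.
move=> A1; have A0 : 0 < A by exact: lt_le_trans A1.
rewrite ler0_norm ?cutoff_gradient_le0// edot_gradient_cutoff opprK.
set s := (enorm x ^+ 2 - 1) / A.
have q0 : 0 <= possqr s by exact: sqr_ge0.
have [s1|s1] := leP 1 s.
  rewrite [Num.max (1 - _) 0]max_r ?mulr0 ?mul0r// subr_le0 /possqr.
  by rewrite max_l ?(le_trans ler01)// exprn_ege1.
have xA : enorm x ^+ 2 / A <= 2.
  rewrite ler_pdivrMr//; move: s1; rewrite /s ltr_pdivrMr// mul1r => s1.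
  by lra.
have x0 : 0 <= enorm x ^+ 2 / A by rewrite divr_ge0 ?sqr_ge0// ltW.
have m1 : 0 <= Num.max (1 - possqr s) 0 <= 1 by rewrite le_max lexx orbT/= ge_max ler01 andbT; lra.
have m2 : 0 <= Num.max s 0 <= 1 by rewrite le_max lexx orbT/= ge_max ler01 andbT ltW.
move: m1 m2; set a := Num.max (1 - _) _; set b := Num.max s 0 => /andP[a0 a1] /andP[b0 b1].
have ab : 0 <= a * b <= 1 by rewrite mulr_ge0// mulr_ile1.
by move: ab; rewrite -mulrA => /andP[ab0 ab1]; nra.
Qed.

Lemma cutoff_cvg x : cutoff k.+1%:R x @[k --> \oo] --> (1 : R) /\
  edot x (gradient (cutoff k.+1%:R) x) @[k --> \oo] --> (0 : R).
Proof.
have c0 (c : R) : c / k.+1%:R @[k --> \oo] --> (0 : R).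
  by rewrite -[X in _ --> X](mulr0 c); apply: cvgMr; exact: cvg_harmonic.
have cpos : continuous (@possqr R).
  move=> t; apply: differentiable_continuous; apply/derivable1_diffP.
  by have [] := is_derive_possqr t.
have p0 : possqr (0 : R) = 0 by rewrite /possqr maxxx expr0n.
have p1 : possqr (1 : R) = 1 by rewrite /possqr max_l// expr1n.
have cm : continuous (fun t : R => Num.max t 0) by apply: (continuous_max0 (f := id)) => t; exact: cvg_id.
have c1 : 1 - possqr ((enorm x ^+ 2 - 1) / k.+1%:R) @[k --> \oo] --> 1 - possqr (0 : R).
  by apply: cvgB; [exact: cvg_cst|exact: (cvg_comp _ _ (c0 _) (cpos 0))].
rewrite p0 subr0 in c1.
split; first by have := cvg_comp _ _ c1 (cpos 1); rewrite p1.
under eq_fun do rewrite edot_gradient_cutoff.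
have H : - (8 * Num.max (1 - possqr ((enorm x ^+ 2 - 1) / k.+1%:R)) 0 *
  Num.max ((enorm x ^+ 2 - 1) / k.+1%:R) 0 * (enorm x ^+ 2 / k.+1%:R)) @[k --> \oo] -->
  - (8 * Num.max (1 : R) 0 * Num.max (0 : R) 0 * 0).
  apply: cvgN; apply: cvgM; last exact: c0.
  apply: cvgM; last exact: (cvg_comp _ _ (c0 _) (cm 0)).
  by apply: cvgMr; exact: (cvg_comp _ _ c1 (cm 1)).
by rewrite mulr0 oppr0 in H.
Qed.

End cutoff.

(** * Traces *)

Section Lp_tools.
Context d (T : measurableType d) {R : realType} (mu : {measure set T -> \bar R}).
Variables (p : R) (p_gt1 : 1 < p).

Let p_gt0 : 0 < p. Proof. exact: lt_trans p_gt1. Qed.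

Lemma powR_Lnorm_restrict (D : set T) (f : T -> R) :
  ('N[mu]_p%:E[EFin \o (f \_ D)] `^ p = \int[mu]_(x in D) (`|f x| `^ p)%:E)%E.
Proof.
rewrite poweR_Lnorm ?gt_eqF// [RHS]integral_mkcond; apply: eq_integral => x _.
rewrite /= !patchE; case: ifP => _ //.
by rewrite -[X in `|X|]/(0 : R) normr0 powR0 ?gt_eqF.
Qed.

Lemma Lnorm_cvg0 (D : set T) (f_ : nat -> T -> R) :
  ('N[mu]_p%:E[EFin \o (f_ k \_ D)])%E @[k --> \oo] --> 0%E <->
  (\int[mu]_(x in D) (`|f_ k x| `^ p)%:E)%E @[k --> \oo] --> 0%E.
Proof.
have I0 k : (0 <= \int[mu]_(x in D) (`|f_ k x| `^ p)%:E)%E.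
  by apply: integral_ge0 => x _; rewrite lee_fin powR_ge0.
have N0 k : (0 <= 'N[mu]_p%:E[EFin \o (f_ k \_ D)])%E by exact: Lnorm_ge0.
have NE k : ('N[mu]_p%:E[EFin \o (f_ k \_ D)] =
    (\int[mu]_(x in D) (`|f_ k x| `^ p)%:E) `^ p^-1)%E.
  by rewrite -powR_Lnorm_restrict -poweRrM mulfV ?gt_eqF// poweRe1.
have pos (x : \bar R) : (0 <= x)%E -> x \in `[0%E, +oo%E].
  by move=> x0; rewrite in_itv/=; apply/andP; split => //; exact: leey.
split=> [h|h].
- apply/ecvg0P => // e e0.
  have e1 : 0 < e `^ p^-1 by exact: powR_gt0.
  have := (ecvg0P N0).1 h _ e1; apply: filterS => k hk.
  rewrite -powR_Lnorm_restrict.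
  have := @gt0_ler_poweR _ p (ltW p_gt0) _ _ (pos _ (N0 k)) (pos _ _) hk.
  rewrite poweR_EFin -powRrM mulVf ?gt_eqF// powRr1 ?(ltW e0)//; apply.
  by rewrite lee_fin ltW.
- apply/ecvg0P => // e e0.
  have e1 : 0 < e `^ p by exact: powR_gt0.
  have := (ecvg0P I0).1 h _ e1; apply: filterS => k hk.
  rewrite NE.
  have pV : 0 <= p^-1 by rewrite invr_ge0 ltW.
  have := @gt0_ler_poweR _ p^-1 pV _ _ (pos _ (I0 k)) (pos _ _) hk.
  rewrite poweR_EFin -powRrM mulfV ?gt_eqF// powRr1 ?(ltW e0)//; apply.
  by rewrite lee_fin ltW.
Qed.

(** Either y <= e, or (y/e)^(p-1) >= 1. On sets of finite measure this elementary bound turns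
    control of p-th powers into control in L^1. *)
Lemma young_split (e y : R) : 0 < e -> 0 <= y -> y <= e + (e `^ (p - 1))^-1 * y `^ p.
Proof.
move=> e0 y0; have [ye|ye] := leP y e.
  by rewrite ler_wpDr// mulr_ge0 ?invr_ge0 ?powR_ge0.
have y1 : 0 < y by exact: lt_trans ye.
rewrite ler_wpDl ?(ltW e0)// ler_pdivlMl ?powR_gt0//.
have -> : y `^ p = y `^ (p - 1) * y.
  have := powRD (x := y) (r := p - 1) (s := 1); rewrite subrK powRr1//; apply.
  by rewrite gt_eqF ?implybT.
by rewrite ler_wpM2r// ge0_ler_powR ?nnegrE ?subr_ge0 ?(ltW p_gt1) ?(ltW e0) ?(ltW ye).
Qed.

Lemma Lp_L1_integrable (D : set T) (f : T -> R) : measurable D -> (mu D < +oo)%E ->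
  measurable_fun D f -> (\int[mu]_(x in D) (`|f x| `^ p)%:E < +oo)%E ->
  mu.-integrable D (EFin \o f).
Proof.
move=> mD Doo mf foo; apply/integrableP; split; first exact/measurable_EFinP.
have mfp : measurable_fun D (fun x => `|f x| `^ p).
  by apply: (measurableT_comp (measurable_powR _)); exact: measurableT_comp.
apply: (@le_lt_trans _ _ (\int[mu]_(x in D) (1%:E + (`|f x| `^ p)%:E))%E).
  apply: ge0_le_integral => //.
  - by apply: measurableT_comp => //; exact/measurable_EFinP.
  - by apply: emeasurable_funD => //; exact/measurable_EFinP.
  - move=> x _; rewrite lee_fin; have := young_split ltr01 (normr_ge0 (f x)).
    by rewrite powR1 invr1 mul1r.
rewrite ge0_integralD//; last exact/measurable_EFinP.
by rewrite integral_cst// mul1e lte_add_pinfty.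
Qed.

Lemma Lp_L1_cvg0 (D : set T) (f_ : nat -> T -> R) : measurable D -> (mu D < +oo)%E ->
  (forall k, measurable_fun D (f_ k)) ->
  (\int[mu]_(x in D) (`|f_ k x| `^ p)%:E)%E @[k --> \oo] --> 0%E ->
  (\int[mu]_(x in D) (`|f_ k x|)%:E)%E @[k --> \oo] --> 0%E.
Proof.
move=> mD Doo mf h; apply/ecvg0P => [k|e e0].
  by apply: integral_ge0 => x _; rewrite lee_fin.
have I0 k : (0 <= \int[mu]_(x in D) (`|f_ k x| `^ p)%:E)%E.
  by apply: integral_ge0 => x _; rewrite lee_fin powR_ge0.
have Df : mu D \is a fin_num by rewrite ge0_fin_numE.
have m0 : 0 <= fine (mu D) by rewrite fine_ge0.
pose m := fine (mu D).
(* Then t times the measure of [D] is at most e/2, the added 1 covering a null [D]; the factor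
   t^(p-1) in [e1] cancels the coefficient from [young_split]. *)
pose t := e / 2 / (m + 1).
have m1 : 0 < m + 1 by rewrite ltr_wpDl.
have t0 : 0 < t by rewrite !divr_gt0.
have c0 : 0 < t `^ (p - 1) by exact: powR_gt0.
have e1 : 0 < e / 2 * t `^ (p - 1) by rewrite mulr_gt0// divr_gt0.
have := (ecvg0P I0).1 h _ e1; apply: filterS => k hk.
have mfp : measurable_fun D (fun x => `|f_ k x| `^ p).
  by apply: (measurableT_comp (measurable_powR _)); exact: measurableT_comp.
apply: (@le_trans _ _ (\int[mu]_(x in D) (t%:E + (t `^ (p - 1))^-1%:E * (`|f_ k x| `^ p)%:E))%E).
  apply: ge0_le_integral => //.
  - by apply/measurable_EFinP; exact: measurableT_comp.
  - by apply: emeasurable_funD => //; apply: measurable_funeM; exact/measurable_EFinP.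
  - by move=> x _; rewrite -EFinM -EFinD lee_fin; exact: young_split.
rewrite ge0_integralD//; last 3 first.
- by move=> x _; rewrite lee_fin ltW.
- by move=> x _; rewrite -EFinM lee_fin mulr_ge0 ?powR_ge0// invr_ge0 ltW.
- by apply: measurable_funeM; exact/measurable_EFinP.
rewrite integral_cst// ge0_integralZl//; last 2 first.
- exact/measurable_EFinP.
- by rewrite lee_fin invr_ge0 ltW.
apply: (@le_trans _ _ (t%:E * m%:E + (t `^ (p - 1))^-1%:E * (e / 2 * t `^ (p - 1))%:E)%E).
  apply: leeD; first by rewrite /m fineK.
  by apply: lee_wpmul2l => //; rewrite lee_fin invr_ge0 ltW.
rewrite -!EFinM -EFinD lee_fin [X in _ + X]mulrC mulfK ?gt_eqF//.
have tm : t * m <= e / 2.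
  by rewrite /t mulrAC ler_pdivrMr// ler_wpM2l ?lerDl// divr_ge0// ltW.
by rewrite [leRHS](splitr e) lerD2r.
Qed.

End Lp_tools.

Lemma ecball0 {R : realType} {n : nat} : ecball 0 = [set 0] :> set 'rV[R]_n.
Proof.
apply/seteqP; split => x; last by move=> ->; rewrite /ecball/= enorm0.
by rewrite /ecball/= => x0; apply/eqP; rewrite -[_ == _]negbK -enorm_gt0 -leNgt.
Qed.

(** * From the trace to the flux over the positivity set *)

Section trace.
Context {R : realType} {n : nat} (n_gt0 : (0 < n)%N) (p : R) (p_gt1 : 1 < p).
Local Notation V := 'rV[R]_n.
Local Notation mu := (@lebesgue_rV R n).
Local Notation ext := (@exterior R n).

Let mext : measurable ext. Proof. exact: measurable_exterior. Qed.

(** The surface measure is n times the image under [normalize] of Lebesgue measure on the ball. The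
    factor n >= 1 is dropped, and the only point of the ball not sent to the sphere is the origin,
    where [normalize] takes the value 0. *)
Lemma surface_ge (g : V -> R) : measurable_fun setT g -> (forall x, 0 <= g x) ->
  (\int[mu]_(x in eball 1) (g (normalize x))%:E <=
   \int[surface_measure]_(x in unit_sphere) (g x)%:E)%E.
Proof.
move=> mg g0.
have mS : measurable (@unit_sphere R n).
  rewrite (_ : unit_sphere = enorm @^-1` [set 1%R])//.
  by rewrite -[X in measurable X]setTI; exact: measurable_enorm.
have mN := @measurable_normalize R n.
have mB : measurable (@unit_ball R n) by exact: measurable_unit_ball.
have mgE : measurable_fun setT (fun x => (g x)%:E) by exact/measurable_EFinP.
have mgN : measurable_fun setT (fun x => (g (normalize x))%:E).
  by apply/measurable_EFinP; exact: measurableT_comp mN.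
have mNS : measurable (normalize @^-1` unit_sphere : set V).
  by rewrite -[X in measurable X]setTI; exact: mN.
have g0E x : (0 <= (g x)%:E)%E by rewrite lee_fin.
rewrite ge0_integral_mscale//; last exact: measurable_funTS.
apply: (@le_trans _ _ (\int[@cone_measure R n]_(x in unit_sphere) (g x)%:E)%E); last first.
  rewrite -[leLHS]mul1e; apply: lee_wpmul2r; first by apply: integral_ge0.
  by rewrite lee_fin ler1n.
pose nu := mrestr mu mB.
have -> : (\int[@cone_measure R n]_(x in unit_sphere) (g x)%:E =
    \int[pushforward nu normalize]_(x in unit_sphere) (g x)%:E)%E.
  by apply: eq_measure_integral => A mA _; rewrite /= /pushforward /nu /mrestr setIC.
rewrite ge0_integral_pushforward//; last exact: measurable_funTS.
apply: (@le_trans _ _ (\int[nu]_(x in (normalize @^-1` unit_sphere) `&` unit_ball) (g (normalize x))%:E)%E); last first.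
  apply: ge0_subset_integral => //; first exact: measurableI.
  exact: measurable_funTS.
have -> : (\int[nu]_(x in (normalize @^-1` unit_sphere) `&` unit_ball) (g (normalize x))%:E =
    \int[mu]_(x in (normalize @^-1` unit_sphere) `&` unit_ball) (g (normalize x))%:E)%E.
  apply: eq_measure_integral => A mA AS; rewrite /nu /= /mrestr; congr (mu _).
  by apply/seteqP; split => [x []//|x Ax]; split=> //; have [] := AS _ Ax.
rewrite (@ge0_negligible_integral _ _ _ mu (eball 1) [set 0])//.
- apply: ge0_subset_integral => //.
  + by apply: measurableD => //; rewrite -ecball0; exact: measurable_ecball.
  + exact: measurableI.
  + exact: measurable_funTS.
  + move=> x [xb x0]; split => //; rewrite /unit_sphere/= /normalize enormZ.
    have xn0 : x != 0 by apply/eqP.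
    by rewrite normfV ger0_norm ?enorm_ge0// mulVf// gt_eqF// enorm_gt0.
- by rewrite -ecball0; exact: measurable_ecball.
- exact: measurable_funTS.
- exact: lebesgue_rV_set0.
Qed.

Lemma Lp_onP (Omega : set V) (f : V -> R) : measurable Omega -> Lp_on p Omega f ->
  measurable_fun Omega f /\ (\int[mu]_(x in Omega) (`|f x| `^ p)%:E < +oo)%E.
Proof.
move=> mO; rewrite /Lp_on => /andP[]; rewrite !inE/= => mf nf; split.
  exact/(measurable_restrictT _ mO).
by rewrite -powR_Lnorm_restrict//; exact: poweR_lty.
Qed.

Lemma wgradP (Omega : set V) (v : V -> R) : sobolev p Omega v ->
  weak_gradient Omega v (wgrad Omega v).
Proof. by move=> [_ [G hG _]]; rewrite /wgrad; case: xgetP => [G' _ //|/(_ G)]. Qed.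

(** [wgrad] is some weak gradient, perhaps not the one in L^p that [sobolev] provides; uniqueness
    almost everywhere transfers the bound. *)
Lemma wgrad_Lp (Omega : set V) (v : V -> R) i : open Omega -> sobolev p Omega v ->
  measurable_fun Omega (fun x => wgrad Omega v x ord0 i) /\
  (\int[mu]_(x in Omega) (`|wgrad Omega v x ord0 i| `^ p)%:E < +oo)%E.
Proof.
move=> oO sv; have mO := open_measurable_rV oO; have wg := wgradP sv.
have mw : measurable_fun Omega (fun x => wgrad Omega v x ord0 i).
  by have [_ lw _] := wg; exact: loc_integrable_measurable (lw i).
split=> //; have [_ [G hG GLp]] := sv; have [mG Goo] := Lp_onP mO (GLp i).
have mp (f : V -> R) : measurable_fun Omega f -> measurable_fun Omega (fun x => (`|f x| `^ p)%:E).
  move=> mf; apply/measurable_EFinP; apply: (measurableT_comp (measurable_powR _)).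
  exact: measurableT_comp.
rewrite (@ge0_ae_eq_integral _ _ _ mu Omega _ (fun x => (`|G x ord0 i| `^ p)%:E))//.
- exact: mp.
- exact: mp.
- by have := weak_gradient_unique oO wg hG; apply: filterS => x h Ox; rewrite h.
Qed.

(** The sequence that defines the trace serves: on bounded shells convergence in L^p gives
    convergence in mean, and [surface_ge] carries the convergence on the sphere over to the ball. *)
Lemma trace_approx (v : V -> R) : sobolev p ext v -> has_trace p v (cst 1) ->
  exists v_, approximates v (wgrad ext v) 1 v_.
Proof.
move=> sv [v_ [tv h0 h1 hb]]; exists v_.
have [mv voo] := Lp_onP mext sv.1.
have mK r : measurable (ext `&` ecball r).
  by apply: measurableI => //; exact: measurable_ecball.
have Koo r : (mu (ext `&` ecball r) < +oo)%E.
  apply: le_lt_trans (lebesgue_rV_ecball n r); apply: le_measure; rewrite ?inE//.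
  exact: measurable_ecball.
have mc (f : V -> R) D : continuous f -> measurable_fun D f.
  by move=> cf; apply: measurable_funTS; exact: continuous_measurable_rV.
have L1 (f_ : nat -> V -> R) (f : V -> R) r : (forall k, continuous (f_ k)) -> measurable_fun ext f ->
    Lp_cvg mu p ext f_ f ->
    (\int[mu]_(x in ext `&` ecball r) (`|f_ k x - f x|)%:E)%E @[k --> \oo] --> 0%E.
  move=> cf mf /(Lnorm_cvg0 _ p_gt1 _ _).1 h.
  have mfk k : measurable_fun ext (fun x => f_ k x - f x) by apply: measurable_funB => //; exact: mc.
  apply: (@Lp_L1_cvg0 _ _ _ mu p p_gt1 (ext `&` ecball r) (fun k x => f_ k x - f x)) => //.
  - exact: Koo.
  - by move=> k; apply: measurable_funS (mfk k) => //; exact: subIsetl.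
  -
  apply: ecvg0_le h => k.
    by apply: integral_ge0 => x _; rewrite lee_fin powR_ge0.
  apply: ge0_subset_integral => //.
  - apply/measurable_EFinP; apply: (measurableT_comp (measurable_powR _)).
    exact: measurableT_comp (mfk k).
have C1v k : C1 (v_ k) by exact: test_C1 (tv k).
split=> //.
- by move=> i; have [] := wgrad_Lp i open_exterior sv.
- by move=> r; apply: L1 => // k; exact: (C1v k).1.
- move=> r i; apply: (L1 (fun k => partial i (v_ k))) => //.
  + by move=> k; exact: ((C1v k).2 i).1.
  + by have [] := wgrad_Lp i open_exterior sv.
- have mn k : measurable_fun (eball 1) (fun x : V => v_ k (normalize x) - 1).
    apply: measurable_funB => //; apply: measurable_funTS; apply: measurableT_comp.
      by apply: continuous_measurable_rV; exact: (C1v k).1.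
    exact: measurable_normalize.
  apply: (@Lp_L1_cvg0 _ _ _ mu p p_gt1 (eball 1) (fun k x => v_ k (normalize x) - 1)) => //.
  + exact: measurable_eball.
  + exact: lebesgue_eball1_lty.
  move: hb => /(Lnorm_cvg0 _ p_gt1 _ _).1; apply: ecvg0_le => k.
    by apply: integral_ge0 => x _; rewrite lee_fin powR_ge0.
  apply: (surface_ge (g := fun x => `|v_ k x - 1| `^ p)) => [|x]; last exact: powR_ge0.
  apply: (measurableT_comp (measurable_powR _)); apply: measurableT_comp => //.
  by apply: measurable_funB => //; exact: mc (C1v k).1.
Qed.

Lemma measurable_positivity (v : V -> R) : measurable_fun ext v -> measurable (positivity_set v).
Proof.
move=> mv; have := mv mext _ (measurable_itv `]0, +oo[).
by rewrite (_ : _ @^-1` _ = [set x | 0 < v x])//; apply/seteqP; split => x /=; rewrite in_itv/= andbT.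
Qed.

(** [approx_identity] with truncations and cutoffs that sharpen and widen together, both with
    parameter k+1. The ramp is 0 off the positivity set and tends to 1 on it, the term with the
    gradient of the cutoff disappears, and [softpos] at the trace 1 tends to 1. The value is minus
    the area of the unit sphere. *)
Lemma flux (v : V -> R) (Z : V -> V) v_ : approximates v Z 1 v_ ->
  (forall i, mu.-integrable (positivity_set v) (EFin \o (fun x => Z x ord0 i))) ->
  mu.-integrable (positivity_set v) (EFin \o v) ->
  \int[mu]_(x in positivity_set v) (edot x (Z x) / enorm x ^+ n) = - n%:R * vball n.
Proof.
move=> h IZ Iv; have mA := measurable_positivity (ap_mz h).
pose A := positivity_set v.
pose j k : R := k.+1%:R.
have j0 k : 0 < j k by rewrite ltr0n.
have j1 k : 1 <= j k by rewrite ler1n.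
have id k := approx_identity n_gt0 (mulr_ge0 (ler0n _ 2) (ltW (j0 k)))
  (fun y => is_derive_softpos (j k) y) (@clamp_continuous _ (j k)) (fun y => clamp01 y (j0 k))
  (fun a b => clamp_lip a b (j0 k)) (cutoff_C1 (j k)) (cutoff_bsupp (j0 k))
  (fun x => cutoff01 (j k) x) (fun x => cutoff1 (j0 k)) (ler0n _ 16)
  (fun x => cutoff_gradient_bound x (j1 k)) h.
pose F k x := (cutoff (j k) x * clamp (j k) (v x) * edot x (Z x) +
   softpos (j k) (v x) * edot x (gradient (cutoff (j k)) x)) / enorm x ^+ n.
have idI k : mu.-integrable ext (EFin \o F k) by have [+ _] := id k.
have idE k : \int[mu]_(x in ext) F k x = - n%:R * vball n * softpos (j k) 1.
  by have [_ +] := id k.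
have sA : A `<=` ext by exact: subIsetl.
have IFA k : mu.-integrable A (EFin \o F k) by exact: integrableS (idI k).
have FA k : \int[mu]_(x in A) F k x = \int[mu]_(x in ext) F k x.
  rewrite Rintegral_mkcond [RHS]Rintegral_mkcond; apply: eq_Rintegral => x _; rewrite !patchE.
  have [xe|xe] := boolP (x \in ext); last first.
    by rewrite ifF//; apply/negbTE/negP => /set_mem/sA/mem_set; exact/negP.
  case: ifPn => // xA; have vx : v x <= 0.
    rewrite leNgt; apply/negP => vx; move/negP: xA; apply; rewrite inE; split => //.
    exact: set_mem.
  by rewrite /F clamp_le0// softpos_le0// mulr0 !mul0r addr0 mul0r.
(* A common bound for all [F k]: the first term by [norm_radial_le], the second by the uniform
   constant of [cutoff_gradient_bound]. *)
pose g x := \sum_(i < n) `|Z x ord0 i| + 16 * v x.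
have Ig : mu.-integrable A (EFin \o g).
  apply: (@eq_integrable _ _ _ _ _ mA
    (fun x => (\sum_(i <- index_enum 'I_n) (`|Z x ord0 i|)%:E) + 16%:E * (v x)%:E)%E).
    by move=> x _; rewrite sumEFin.
  apply: integrableD => //; last exact: integrableZl.
  apply: integrable_sum => // i _; exact: integrable_norm.
have mZA i : measurable_fun A (fun x => Z x ord0 i) by apply/measurable_EFinP; exact: measurable_int (IZ i).
have mG : measurable_fun A (fun x => edot x (Z x) / enorm x ^+ n).
  apply: measurable_funM.
    apply: measurable_sum => i; apply: measurable_funM => //.
    by apply: measurable_funTS; exact: measurable_coors.
  apply: measurable_funTS; rewrite (_ : (fun x => _) = fun x => enorm x `^ (- n%:R)).
    by apply: (measurableT_comp (measurable_powR _)); exact: measurable_enorm.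
  by apply/funext => x; rewrite powR_invn// enorm_ge0.
have cj : (j k)^-1 @[k --> \oo] --> (0 : R) by exact: cvg_harmonic.
have [|||||IG _ lim1] := @dominated_convergence _ _ R mu A mA (fun k x => (F k x)%:E)
    (fun x => (edot x (Z x) / enorm x ^+ n)%:E) (EFin \o g).
- by move=> k; exact: measurable_int (IFA k).
- exact/measurable_EFinP.
- apply: aeW => x [xe vx]; apply: cvg_EFin; first exact: nearW.
  have [c1 c2] := cutoff_cvg x.
  have cc : clamp (j k) (v x) @[k --> \oo] --> (1 : R).
    apply: (@cvg_trans _ (cst (1 : R) @ \oo)); last exact: cvg_cst.
    apply: near_eq_cvg; near=> k => /=; rewrite clamp_eq1//.
    by near: k; apply: (cvgr_le (0 : R)) => //; exact: vx.
  have cs : softpos (j k) (v x) @[k --> \oo] --> v x - 0 / 2.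
    apply: (@cvg_trans _ ((fun k => v x - (j k)^-1 / 2) @ \oo)); last first.
      by apply: cvgB; [exact: cvg_cst|exact: cvgMl].
    apply: near_eq_cvg; near=> k => /=; rewrite softpos_ge//.
    by near: k; apply: (cvgr_le (0 : R)) => //; exact: vx.
  have := cvgM (cvgD (cvgM (cvgM c1 cc) (cvg_cst (edot x (Z x)))) (cvgM cs c2)) (cvg_cst (enorm x ^+ n)^-1).
  by rewrite mul1r mul1r mulr0 addr0 => H; apply: H.
- exact: Ig.
- apply: aeW => x k [xe vx]; rewrite lee_fin.
  rewrite /F mulrDl; apply: le_trans (ler_normD _ _) _; apply: lerD.
    rewrite -mulrA normrM -[leRHS]mul1r ler_pM//; last exact: norm_radial_le.
    have /andP[a0 a1] := cutoff01 (j k) x; have /andP[b0 b1] := clamp01 (v x) (j0 k).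
    have -> : `|cutoff (j k) x * clamp (j k) (v x)| = cutoff (j k) x * clamp (j k) (v x).
      by rewrite ger0_norm// mulr_ge0.
    exact: (mulr_ile1 a0 b0 a1 b1).
  rewrite -mulrA normrM mulrC ler_pM//; last first.
    have /andP[a0 a1] := softpos_bounds (v x) (j0 k).
    by rewrite ger0_norm// (le_trans a1)// max_l// ltW.
  rewrite normrM -[leRHS]mulr1 ler_pM//.
    by apply: cutoff_gradient_bound; rewrite ler1n.
  move: xe => /exteriorP x1; rewrite normfV.
  by rewrite ger0_norm ?exprn_ge0 ?enorm_ge0// invf_le1 ?exprn_ege1 ?(ltW x1)// exprn_gt0// (lt_trans ltr01).
have lim2 : \int[mu]_(x in A) F k x @[k --> \oo] --> \int[mu]_(x in A) (edot x (Z x) / enorm x ^+ n).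
  have fG : (\int[mu]_(x in A) (edot x (Z x) / enorm x ^+ n)%:E)%E \is a fin_num.
    exact: integrable_fin_num.
  by move: lim1; rewrite -(fineK fG) => /fine_cvgP[].
have lim3 : \int[mu]_(x in A) F k x @[k --> \oo] --> - n%:R * vball n * 1.
  under eq_fun do rewrite FA idE; apply: cvgMr.
  rewrite -[X in _ --> X]subr0 -[X in _ - X](mul0r (2^-1 : R)).
  apply: (@cvg_trans _ ((fun k => 1 - (j k)^-1 / 2) @ \oo)); last first.
    by apply: cvgB; [exact: cvg_cst|exact: cvgMl].
  apply: near_eq_cvg; near=> k => /=; rewrite softpos_ge//.
  by rewrite invf_le1// ler1n.
by rewrite -(cvg_lim _ lim2)// (cvg_lim _ lim3)// mulr1.
Unshelve. all: by end_near.
Qed.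

End trace.

(** * Continuous representatives and weak gradients *)

Section open_sets.
Context {R : realType}.

Lemma lebesgue_rV_box_gt0 n (a b : 'rV[R]_n) : (forall i, a ord0 i < b ord0 i) ->
  (0 < lebesgue_rV n (box a b))%E.
Proof.
elim: n a b => [|n IH] a b ab /=.
  by rewrite diracE (_ : _ \in _) ?lte_fin//; apply/mem_set => -[].
rewrite /lebesgue_step.
pose A := `]a ord0 ord0, b ord0 ord0[%classic.
pose B := box (rsubmx (a : 'rV_(1 + n))) (rsubmx (b : 'rV_(1 + n))).
apply: (@lt_le_trans _ _ ((@lebesgue_measure R \x lebesgue_rV n)%E (A `*` B))).
  rewrite product_measure1E; [|exact: measurable_itv|exact: measurable_box].
  have Ap : (0 < @lebesgue_measure R A)%E.
    by rewrite /A lebesgue_measure_itv/= lte_fin ab -EFinB lte_fin subr_gt0.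
  by apply: mule_gt0; [exact: Ap|apply: IH => i; rewrite !mxE].
apply: le_measure; rewrite ?inE.
- by apply: measurableX; [exact: measurable_itv|exact: measurable_box].
- by rewrite -[X in measurable X]setTI; apply: measurable_cons_rV => //; exact: measurable_box.
move=> [t y] /= [hA hB] i.
rewrite /cons_rV.
case: (splitP (i : 'I_(1 + n))) => j ij.
  have -> : i = lshift n (ord0 : 'I_1) :> 'I_(1 + n) by apply/val_inj; rewrite /= ij ord1.
  rewrite (@row_mxEl _ 1 1 n) mxE eqxx mulr1n; move: hA; rewrite /A/= in_itv/=.
  by have -> : ord0 = lshift n (ord0 : 'I_1) :> 'I_(1 + n) by exact/val_inj.
have -> : i = rshift 1 j :> 'I_(1 + n) by exact/val_inj.
by have := hB j; rewrite (@row_mxEr _ 1 1 n) !mxE.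
Qed.

Lemma open_lebesgue_rV_gt0 n (O : set 'rV[R]_n) : open O -> O !=set0 ->
  (0 < lebesgue_rV n O)%E.
Proof.
move=> oO [x Ox]; have [P [a [b [E _]]]] := open_bigcup_box oO.
have := Ox; rewrite E => -[k Pk kx].
apply: (@lt_le_trans _ _ (lebesgue_rV n (box (a k) (b k)))).
  by apply: lebesgue_rV_box_gt0 => i; have /andP[] := kx i; exact: lt_trans.
apply: le_measure; rewrite ?inE.
- exact: measurable_box.
- by rewrite -E; exact: open_measurable_rV.
- by move=> y ky; exists k.
Qed.

(** The points of [O] where f and g differ form an open set, and nonempty open sets have positive
    measure. *)
Lemma ae_eq_continuous n (O : set 'rV[R]_n) (f g : 'rV[R]_n -> R) : open O ->
  {within O, continuous f} -> {within O, continuous g} ->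
  {ae (lebesgue_rV n), forall x, O x -> f x = g x} -> forall x, O x -> f x = g x.
Proof.
move=> oO cf cg [N [mN N0 fN]] x Ox; apply/eqP; rewrite -subr_eq0; apply/negP => /negP d0.
pose W := O `&` [set x | f x - g x != 0].
have oW : open W.
  rewrite openE => y [Oy dy]; rewrite /interior.
  have fy : f @ y --> f y by move: cf; rewrite continuous_open_subspace// => /(_ _ (mem_set Oy)).
  have gy : g @ y --> g y by move: cg; rewrite continuous_open_subspace// => /(_ _ (mem_set Oy)).
  have c : (fun z => f z - g z) @ y --> f y - g y by exact: (cvgB fy gy).
  near=> z; split; first by near: z; exact: open_nbhs_nbhs.
  by near: z; apply: cvgr_neq0 dy; exact: c.
have := @open_lebesgue_rV_gt0 n W oW (ex_intro _ x (conj Ox d0)).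
rewrite lt_neqAle => /andP[/negP + _]; apply; rewrite eq_sym -measure_le0 -N0.
apply: le_measure; rewrite ?inE//; first exact: open_measurable_rV.
by move=> y [Oy /negP dy]; apply: fN => /= h; apply: dy; rewrite h// subrr.
Unshelve. all: by end_near. Qed.

End open_sets.

Section dominated_Lp.
Context d (T : measurableType d) {R : realType} (mu : {measure set T -> \bar R}).

Lemma bounded_Lp_cvg0 (p M : R) (D K : set T) (f_ : nat -> T -> R) (f : T -> R) : 0 < p ->
  measurable D -> measurable K -> K `<=` D -> (mu K < +oo)%E ->
  (forall k, measurable_fun D (f_ k)) -> measurable_fun D f ->
  (forall k x, D x -> `|f_ k x| <= M) -> (forall x, D x -> `|f x| <= M) ->
  (forall k x, D x -> ~ K x -> f_ k x = 0) -> (forall x, D x -> ~ K x -> f x = 0) ->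
  (forall x, D x -> f_ k x @[k --> \oo] --> f x) ->
  (\int[mu]_(x in D) (`|f_ k x - f x| `^ p)%:E)%E @[k --> \oo] --> 0%E.
Proof.
move=> p0 mD mK KD Koo mf mf0 fM f0M fK f0K cf.
have m_ k : measurable_fun D (fun x => `|f_ k x - f x| `^ p).
  apply: (measurableT_comp (measurable_powR _)); apply: measurableT_comp => //.
  exact: measurable_funB.
have [|||||_ _ +] := @dominated_convergence _ _ R mu D mD
    (fun k x => (`|f_ k x - f x| `^ p)%:E) (cst 0%E)
    (fun x => (((M + M) `^ p) * \1_K x)%:E).
- by move=> k; exact/measurable_EFinP.
- exact: measurable_cst.
- apply: aeW => x Dx; apply: cvg_EFin; first exact: nearW.
  have c : `|f_ k x - f x| @[k --> \oo] --> (0 : R).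
    rewrite -(normr0 R) -(subrr (f x)); apply: cvg_norm; apply: cvgB; [exact: cf|exact: cvg_cst].
  rewrite (_ : (0 : R) = 0 `^ p); last by rewrite powR0// gt_eqF.
  apply/cvgrPdist_le => e e0; have e1 : 0 < e `^ p^-1 by exact: powR_gt0.
  have /cvgrPdist_le/(_ _ e1) := c; apply: filterS => k.
  rewrite sub0r normrN normr_id => h; rewrite powR0 ?gt_eqF// sub0r normrN ger0_norm ?powR_ge0//.
  have E : e = (e `^ p^-1) `^ p by rewrite -powRrM mulVf ?gt_eqF// powRr1// ltW.
  rewrite [leRHS]E.
  by rewrite ge0_ler_powR ?(ltW p0)// nnegrE// ltW.
- have E : (fun x => (((M + M) `^ p) * \1_K x)%:E) = (fun x => ((M + M) `^ p)%:E * (\1_K x)%:E)%E.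
    by apply/funext => x; rewrite EFinM.
  rewrite E; apply: integrableZl => //; apply/integrableP; split.
    by apply/measurable_EFinP; exact: measurable_indic.
  have -> : (fun x => `|(\1_K x)%:E|)%E = (fun x : T => (\1_K x)%:E : \bar R).
    by apply/funext => x; rewrite gee0_abs// lee_fin indicE.
  by rewrite integral_indic// setIidl.
- apply: aeW => x k Dx; rewrite lee_fin ger0_norm ?powR_ge0//.
  have [xK|xK] := pselect (K x).
    rewrite indicE mem_set// mulr1 ge0_ler_powR ?(ltW p0)// ?nnegrE//.
      by rewrite addr_ge0// (le_trans _ (f0M _ Dx)).
    by apply: le_trans (ler_normB _ _) _; rewrite lerD ?fM ?f0M.
  by rewrite fK// f0K// subrr normr0 powR0 ?gt_eqF// mulr_ge0 ?powR_ge0// indicE.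
rewrite integral0; apply: cvg_trans; apply: near_eq_cvg; apply: nearW => k.
by apply: eq_integral.
Qed.

End dominated_Lp.

(** * Weak gradients as limits of classical ones *)

Section weak_derivatives.
Context {R : realType} {n : nat}.
Local Notation V := 'rV[R]_n.
Local Notation mu := (@lebesgue_rV R n).
Local Notation ext := (@exterior R n).

Lemma is_derive_partial (f : V -> R) i x : C1 f ->
  is_derive x (delta_mx ord0 i) f (partial i f x).
Proof. by move=> [_ /(_ i)[_ /(_ x)]] h; exact: DeriveDef. Qed.

Lemma partialM (f g : V -> R) i x : C1 f -> C1 g ->
  partial i (fun x => f x * g x) x = f x * partial i g x + partial i f x * g x.
Proof.
move=> cf cg; have df := is_derive_partial i x cf; have dg := is_derive_partial i x cg.
have := is_deriveM df dg; rewrite /partial => /(@derive_val _ _ _ _ _ _ _) ->.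
by rewrite [_ *: 'D__ f x]mulrC.
Qed.

Lemma C1M (f g : V -> R) : C1 f -> C1 g -> C1 (fun x => f x * g x).
Proof.
move=> cf cg; split; first by apply: cont_mul; [exact: cf.1|exact: cg.1].
move=> i; split.
  rewrite (_ : partial i _ = fun x => f x * partial i g x - - (partial i f x * g x)).
    apply: cont_sub; first by apply: cont_mul; [exact: cf.1|exact: (cg.2 i).1].
    by apply: cont_opp; apply: cont_mul; [exact: (cf.2 i).1|exact: cg.1].
  by apply/funext => x; rewrite partialM// opprK.
by move=> x; apply: derivableM; [exact: (cf.2 i).2|exact: (cg.2 i).2].
Qed.

Lemma partial_out (Omega : set V) (f : V -> R) i x : test_function Omega f -> ~ Omega x ->
  partial i f x = 0.
Proof.
move=> [_ _ fO] xO; have xs : ~ Defs.support f x by move=> /fO.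
have oS : open (~` Defs.support f) by apply: closed_openC; exact: closed_closure.
by apply: derive_val; apply: (is_derive_near0 _ oS xs) => y; exact: support_out.
Qed.

Lemma test_functionS (Omega Omega' : set V) (f : V -> R) : Omega `<=` Omega' ->
  test_function Omega f -> test_function Omega' f.
Proof. by move=> s [sf cf fO]; split => //; exact: subset_trans s. Qed.

Lemma Rintegral_supp (D D' : set V) (g : V -> R) : D `<=` D' ->
  (forall x, ~ D x -> g x = 0) ->
  \int[mu]_(x in D) g x = \int[mu]_(x in D') g x.
Proof.
move=> DD g0; rewrite Rintegral_mkcond [RHS]Rintegral_mkcond; apply: eq_Rintegral => x _.
rewrite !patchE; case: ifPn => [/set_mem/DD/mem_set ->//|xD].
by case: ifPn => // _; rewrite g0// => /mem_set; exact/negP.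
Qed.

Lemma weak_gradientS (Omega Omega' : set V) (u : V -> R) G : Omega `<=` Omega' ->
  weak_gradient Omega' u G -> weak_gradient Omega u G.
Proof.
move=> s [lu lG h]; split => [K cK KO|i K cK KO|f i tf].
- by apply: lu => //; exact: subset_trans s.
- by apply: lG => //; exact: subset_trans s.
- have := h f i (test_functionS s tf).
  have tO x : ~ Omega x -> f x = 0.
    by have [_ _ fO] := tf => xO; apply: support_out => /fO.
  rewrite (Rintegral_supp s) => [->|x xO]; last by rewrite (partial_out i tf xO) mulr0.
  by rewrite (Rintegral_supp s)// => x xO; rewrite tO// mulr0.
Qed.

Lemma shell_integrable (g_ : nat -> V -> R) (g : V -> R) r : (forall k, continuous (g_ k)) ->
  measurable_fun ext g ->
  (\int[mu]_(x in ext `&` ecball r) (`|g_ k x - g x|)%:E)%E @[k --> \oo] --> 0%E ->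
  mu.-integrable (ext `&` ecball r) (EFin \o g).
Proof.
move=> cg mg h; have mK : measurable (ext `&` ecball r).
  by apply: measurableI; [exact: measurable_exterior|exact: measurable_ecball].
apply: (@L1_cvg_integrable _ _ _ mu _ mK g_) => //.
  by move=> k; exact: continuous_shell_integrable.
by apply: measurable_funS mg; [exact: measurable_exterior|exact: subIsetl].
Qed.

Lemma shell_cvg (g_ : nat -> V -> R) (g phi : V -> R) : (forall k, continuous (g_ k)) ->
  measurable_fun ext g ->
  (forall r, (\int[mu]_(x in ext `&` ecball r) (`|g_ k x - g x|)%:E)%E @[k --> \oo] --> 0%E) ->
  continuous phi -> bsupp phi ->
  \int[mu]_(x in ext) (g_ k x * phi x) @[k --> \oo] --> \int[mu]_(x in ext) (g x * phi x).
Proof.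
move=> cg mg h cphi [r r0 phir].
have mK : measurable (ext `&` ecball r).
  by apply: measurableI; [exact: measurable_exterior|exact: measurable_ecball].
have E (f : V -> R) : \int[mu]_(x in ext) (f x * phi x) = \int[mu]_(x in ext `&` ecball r) (f x * phi x).
  rewrite Rintegral_mkcond [RHS]Rintegral_mkcond; apply: eq_Rintegral => x _.
  rewrite !patchE; have [xe|xe] := boolP (x \in ext); last first.
    by rewrite ifF//; apply/negbTE/negP => /set_mem[/mem_set xe' _]; rewrite xe' in xe.
  case: ifPn => // xr; have -> : phi x = 0; last by rewrite mulr0.
  apply: phir; rewrite leNgt; apply/negP => /ltW xr'.
  by move/negP: xr; apply; rewrite inE; split => //; exact: set_mem.
under eq_fun do rewrite E; rewrite E.
have [M phiM] := continuous_bounded_ball r cphi.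
have M0 : 0 <= M by apply: le_trans (phiM 0 _) => //; rewrite /ecball/= enorm0 ltW.
have mg' : measurable_fun (ext `&` ecball r) g.
  by apply: measurable_funS mg; [exact: measurable_exterior|exact: subIsetl].
have mgk k : measurable_fun (ext `&` ecball r) (g_ k).
  by apply: measurable_funTS; exact: continuous_measurable_rV.
have mphi : measurable_fun (ext `&` ecball r) phi.
  by apply: measurable_funTS; exact: continuous_measurable_rV.
have Ik k : mu.-integrable (ext `&` ecball r) (EFin \o (fun x => g_ k x * phi x)).
  by apply: continuous_shell_integrable; exact: cont_mul.
have lim : (\int[mu]_(x in ext `&` ecball r) (`|g_ k x * phi x - g x * phi x|)%:E)%E
    @[k --> \oo] --> 0%E.
  apply: ecvg0_le (ecvg0Z M (h r)) => k; first by apply: integral_ge0 => x _; rewrite lee_fin.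
  have mB : measurable_fun (ext `&` ecball r) (fun x => (`|g_ k x - g x|)%:E).
    by apply/measurable_EFinP; apply: measurableT_comp => //; exact: measurable_funB.
  rewrite -ge0_integralZl//; apply: ge0_le_integral => //.
  - apply/measurable_EFinP; apply: measurableT_comp => //.
    by apply: measurable_funB; exact: measurable_funM.
  - exact: measurable_funeM.
  - by move=> x [_ xr]; rewrite -EFinM lee_fin -mulrBl normrM mulrC ler_wpM2r// phiM.
apply: (L1_cvg_Rintegral mK Ik _ lim).
by apply: (L1_cvg_integrable mK Ik _ lim); exact: measurable_funM.
Qed.

(** [integral_partial] applied to the product of [z_ k] with the test function is integration by
    parts; both terms pass to the limit on a shell containing the support. *)
Lemma approximates_weak_gradient z Z b z_ : approximates z Z b z_ -> weak_gradient ext z Z.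
Proof.
move=> h.
have loc (g_ : nat -> V -> R) (g : V -> R) : (forall k, continuous (g_ k)) -> measurable_fun ext g ->
    (forall r, (\int[mu]_(x in ext `&` ecball r) (`|g_ k x - g x|)%:E)%E @[k --> \oo] --> 0%E) ->
    loc_integrable ext g.
  move=> cg mg hg K cK Ke; have [r r0 Kr] := compact_sub_ecball cK.
  apply: integrableS (shell_integrable cg mg (hg r)) => //.
  - by apply: measurableI; [exact: measurable_exterior|exact: measurable_ecball].
  - exact: compact_measurable_rV.
  - by move=> x Kx; split; [exact: Ke|exact: Kr].
have cz k : continuous (z_ k) by exact: (ap_C1 h k).1.
have cZ i k : continuous (partial i (z_ k)) by exact: ((ap_C1 h k).2 i).1.
split=> [|i|f i tf].
- exact: (loc _ _ cz (ap_mz h) (ap_z h)).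
- exact: (loc _ _ (cZ i) (ap_mZ h i) (fun r => ap_Z h r i)).
have C1f := test_C1 tf; have bf := test_bsupp tf.
have bp : bsupp (partial i f).
  have [r r0 hr] := bsupp_gradient bf; exists r => // x xr.
  by have := congr1 (fun v : V => v ord0 i) (hr x xr).2; rewrite !mxE.
have l1 := shell_cvg cz (ap_mz h) (ap_z h) (C1f.2 i).1 bp.
have l2 := shell_cvg (g_ := fun k => partial i (z_ k)) (cZ i) (ap_mZ h i) (fun r => ap_Z h r i) C1f.1 bf.
apply/eqP; rewrite -addr_eq0; apply/eqP; apply: cvg_unique (cvgD l1 l2) _ => //.
rewrite (_ : _ + _ = cst 0); first exact: cvg_cst.
apply/funext => k /=.
have Cp : C1 (fun x => z_ k x * f x) by apply: C1M => //; exact: ap_C1 h k.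
have bzf : bsupp (fun x => z_ k x * f x).
  by have [r r0 hr] := bf; exists r => // x xr; rewrite hr// mulr0.
have := integral_partial i Cp bzf.
have I1 : mu.-integrable ext (EFin \o (fun x => z_ k x * partial i f x)).
  apply: integrableS (@continuous_bsupp_integrable _ _ (fun x => z_ k x * partial i f x) _ _) => //.
  - exact: measurable_exterior.
  - by apply: cont_mul => //; exact: (C1f.2 i).1.
  - by have [r r0 hr] := bp; exists r => // x xr; rewrite hr// mulr0.
have I2 : mu.-integrable ext (EFin \o (fun x => partial i (z_ k) x * f x)).
  apply: integrableS (@continuous_bsupp_integrable _ _ (fun x => partial i (z_ k) x * f x) _ _) => //.
  - exact: measurable_exterior.
  - by apply: cont_mul => //; exact: C1f.1.
  - by have [r r0 hr] := bf; exists r => // x xr; rewrite hr// mulr0.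
move=> E0; transitivity (\int[mu]_(x in ext) (z_ k x * partial i f x) +
    \int[mu]_(x in ext) (partial i (z_ k) x * f x)) => //.
rewrite -RintegralD//; last exact: measurable_exterior.
transitivity (\int[mu]_(x in ext) partial i (fun x => z_ k x * f x) x).
  by apply: eq_Rintegral => x _; rewrite partialM//; exact: ap_C1 h k.
rewrite (@Rintegral_supp ext setT)//; first by rewrite /Rintegral E0.
move=> x xe; rewrite partialM//; last exact: ap_C1 h k.
rewrite (partial_out i tf xe) mulr0 add0r.
by have [_ _ fO] := tf; rewrite (support_out (x := x) (f := f)) ?mulr0// => /fO.
Qed.

End weak_derivatives.

(** * The radial solution *)

Section damped_identity.
Context {R : realType}.

(** A smooth approximation of the positive part of [y] as [K] grows. *)
Definition damp (K y : R) : R := y * flat 0 (K * y).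
Definition damp' (K y : R) : R := flat 0 (K * y) + K * y * flat 2 (K * y).

Lemma is_derive_damp K y : is_derive y (1 : R) (damp K) (damp' K y).
Proof.
have d1 : is_derive y (1 : R) (fun y => K * y) K.
  by apply: (is_derive_eq (is_deriveZ K (is_derive_id y (1 : R)))); rewrite /GRing.scale/= mulr1.
have d3 : is_derive y (1 : R) (fun y => flat 0 (K * y)) (flat 2 (K * y) * K).
  have df := is_derive_flat 0 (K * y); rewrite mul0r subr0 in df.
  by apply: (is_derive_eq (@is_derive1_comp _ _ _ _ _ _ df d1)); rewrite /GRing.scale/= mulrC.
apply: (is_derive_eq (is_deriveM (is_derive_id y (1 : R)) d3)).
by rewrite /damp' /GRing.scale/=; ring.
Qed.

Lemma damp_le0 K y : 0 < K -> y <= 0 -> damp K y = 0.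
Proof. by move=> K0 y0; rewrite /damp /flat pmulr_rgt0// ltNge y0/= mulr0. Qed.

Lemma damp'_le0 K y : 0 < K -> y <= 0 -> damp' K y = 0.
Proof. by move=> K0 y0; rewrite /damp' /flat pmulr_rgt0// ltNge y0/= mulr0 addr0. Qed.

Lemma damp_bounds K y : 0 < K -> 0 <= damp K y <= Num.max 0 y.
Proof.
move=> K0; have [y0|y0] := leP y 0; first by rewrite damp_le0// lexx.
rewrite /damp mulr_ge0 ?flat_ge0 ?(ltW y0)//= ler_piMr ?flat0_le1// ltW//.
Qed.

Lemma tflat2_bounds (t : R) : 0 <= t * flat 2 t <= 1.
Proof.
rewrite /flat; case: ifPn => t0; last by rewrite mulr0 lexx ler01.
have -> : t * (t ^- 2 * expR (- t^-1)) = t^-1 * expR (- t^-1).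
  by rewrite mulrA; congr (_ * _); rewrite expr2 invfM mulrA mulfV ?mul1r// gt_eqF.
rewrite mulr_ge0 ?expR_ge0 ?invr_ge0 ?(ltW t0)//= expRN ler_pdivrMr ?expR_gt0// mul1r.
by apply: le_trans (expR_ge1Dx _); rewrite lerDr.
Qed.

Lemma tflat2_le (t : R) : 0 < t -> t * flat 2 t <= t^-1.
Proof.
move=> t0; rewrite /flat t0.
have -> : t * (t ^- 2 * expR (- t^-1)) = t^-1 * expR (- t^-1).
  by rewrite mulrA; congr (_ * _); rewrite expr2 invfM mulrA mulfV ?mul1r// gt_eqF.
by rewrite ler_piMr ?invr_ge0 ?(ltW t0)// -expR0 ler_expR oppr_le0 invr_ge0 ltW.
Qed.

Lemma damp'_bounds K y : 0 <= damp' K y <= 2.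
Proof.
have /andP[a b] := tflat2_bounds (K * y).
by rewrite /damp' addr_ge0 ?flat_ge0//= -[leRHS]/(1 + 1) lerD// flat0_le1.
Qed.

Lemma damp_cvg (y_ : nat -> R) (y : R) : 0 < y -> y_ @ \oo --> y ->
  damp k.+1%:R (y_ k) @[k --> \oo] --> y /\ damp' k.+1%:R (y_ k) @[k --> \oo] --> (1 : R).
Proof.
move=> y0 cy.
have y20 : 0 < y / 2 by rewrite divr_gt0.
have yy : \forall k \near \oo, y / 2 <= y_ k.
  by apply: (cvgr_ge y) => //; rewrite ltr_pdivrMr// mulr_natr mulr2n ltrDl.
have c1 := flat0_cvg y20 yy.
split; first by rewrite -[X in _ --> X]mulr1; exact: (cvgM cy c1).
rewrite -[X in _ --> X]addr0; apply: cvgD; first exact: c1.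
apply: (@squeeze_cvgr _ _ _ _ (cst 0) (fun k => (y / 2)^-1 * k.+1%:R^-1)); last 2 first.
- exact: cvg_cst.
- by rewrite -[X in _ --> X](mulr0 (y / 2)^-1); apply: cvgMr; exact: cvg_harmonic.
near=> k; have h : y / 2 <= y_ k by near: k.
have h0 : 0 < y_ k by exact: lt_le_trans h.
have /andP[-> _] /= := tflat2_bounds (k.+1%:R * y_ k).
apply: le_trans (tflat2_le _) _; first by rewrite mulr_gt0// ltr0n.
by rewrite invfM mulrC ler_pM2r ?invr_gt0 ?ltr0n// lef_pV2 ?posrE.
Unshelve. all: by end_near. Qed.

End damped_identity.

Lemma powRD_gt0 (R : realType) (x a b : R) : 0 < x -> x `^ (a + b) = x `^ a * x `^ b.
Proof. by move=> x0; apply: powRD; apply/implyP => _; rewrite gt_eqF. Qed.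

(** The primitive is a power, except for b = 1, where it is the logarithm. With b = (al+1)/2 and al
    = (n-1)/(p-1) the exception is the case n = p. *)
Lemma power_primitive (R : realType) (b : R) : exists L : R -> R,
  [/\ L 1 = 0, forall s : R, 0 < s -> is_derive s (1 : R) L (s `^ (- b)) &
   forall n (f : 'rV[R]_n -> R), sm f -> (forall x, 0 < f x) -> sm (fun x => L (f x))].
Proof.
have [->|b1] := eqVneq b 1.
  exists (@ln R); split; first exact: ln1.
    by move=> s s0; rewrite powR_inv1 ?ltW//; exact: is_derive1_ln.
  by move=> n f sf f0; exact: sm_ln.
have c0 : 1 - b != 0 by rewrite subr_eq0 eq_sym.
exists (fun s => (1 - b)^-1 * s `^ (1 - b) - (1 - b)^-1); split.
- by rewrite powR1 mulr1 subrr.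
- move=> s s0.
  apply: (is_derive_eq (is_deriveB (is_deriveZ (1 - b)^-1 (is_derive1_powR (1 - b) s0))
    (is_derive_cst ((1 - b)^-1) s (1 : R)))).
  by rewrite /GRing.scale/= subr0 mulrA mulVf// mul1r; congr (_ `^ _); ring.
- move=> n f sf f0.
  have := sm_D (sm_M (sm_cst ((1 - b)^-1)) (sm_pow (1 - b) sf f0)) (sm_cst (- (1 - b)^-1)).
  by [].
Qed.

Lemma sm_sqr_enorm (R : realType) n (c : R) : sm (fun x : 'rV[R]_n => enorm x ^+ 2 + c).
Proof.
apply: sm_D; last exact: sm_cst.
have h (s : seq 'I_n) : sm (fun x : 'rV[R]_n => \sum_(i <- s) x ord0 i ^+ 2).
  elim: s => [|i s IH].
    by rewrite (_ : (fun x => _) = fun=> 0); [exact: sm_cst|apply/funext => x; rewrite big_nil].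
  rewrite (_ : (fun x => _) = fun x : 'rV[R]_n => x ord0 i * x ord0 i + \sum_(i <- s) x ord0 i ^+ 2).
    by apply: sm_D IH; apply: sm_M; exact: sm_coor.
  by apply/funext => x; rewrite big_cons expr2.
rewrite (_ : (fun x => _) = fun x : 'rV[R]_n => \sum_(i < n) x ord0 i ^+ 2); first exact: h.
by apply/funext => x; rewrite sqr_enorm.
Qed.

Lemma measurable_enorm_comp (R : realType) n (D : set 'rV[R]_n) (W : 'rV[R]_n -> 'rV[R]_n) :
  (forall i, measurable_fun D (fun x => W x ord0 i)) -> measurable_fun D (fun x => enorm (W x)).
Proof.
move=> mW; rewrite (_ : (fun x => _) = fun x => (\sum_(i < n) W x ord0 i ^+ 2) `^ 2^-1).
  apply: (measurableT_comp (measurable_powR _)).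
  by apply: measurable_sum => i; apply: measurable_funX; exact: mW.
by apply/funext => x; rewrite powR12_sqrt// sumr_ge0// => i _; rewrite sqr_ge0.
Qed.

Lemma measurable_edot_comp (R : realType) n (D : set 'rV[R]_n) (W Z : 'rV[R]_n -> 'rV[R]_n) :
  (forall i, measurable_fun D (fun x => W x ord0 i)) ->
  (forall i, measurable_fun D (fun x => Z x ord0 i)) ->
  measurable_fun D (fun x => edot (W x) (Z x)).
Proof. by move=> mW mZ; apply: measurable_sum => i; exact: measurable_funM. Qed.

Lemma bounded_Lp_on (R : realType) n (p M : R) (D K : set 'rV[R]_n) (f : 'rV[R]_n -> R) :
  1 < p -> measurable D -> measurable K -> K `<=` D -> (lebesgue_rV n K < +oo)%E ->
  measurable_fun D f -> (forall x, D x -> `|f x| <= M) -> (forall x, D x -> ~ K x -> f x = 0) ->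
  Lp_on p D f.
Proof.
move=> p1 mD mK KD Koo mf fM fK; have p0 : 0 < p by exact: lt_trans p1.
have Ioo : (\int[lebesgue_rV n]_(x in D) (`|f x| `^ p)%:E < +oo)%E.
  apply: (@le_lt_trans _ _ (\int[lebesgue_rV n]_(x in D) ((M `^ p)%:E * (\1_K x)%:E))%E).
    apply: ge0_le_integral => //.
    - by apply/measurable_EFinP; apply: (measurableT_comp (measurable_powR _)); exact: measurableT_comp.
    - by apply: measurable_funeM; apply/measurable_EFinP; exact: measurable_indic.
    - move=> x Dx; rewrite -EFinM lee_fin; have [xK|xK] := pselect (K x).
        have M0 : 0 <= M by apply: le_trans (fM _ Dx).
        by rewrite indicE mem_set// mulr1 ge0_ler_powR ?(ltW p0)// ?nnegrE// fM.
      by rewrite fK// normr0 powR0 ?gt_eqF// mulr_ge0 ?powR_ge0// indicE.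
  rewrite ge0_integralZl//; last 2 first.
  - by apply/measurable_EFinP; exact: measurable_indic.
  - by rewrite lee_fin powR_ge0.
  by rewrite integral_indic// setIidl// lte_mul_pinfty// lee_fin powR_ge0.
rewrite /Lp_on; apply/andP; rewrite !inE/=; split; first exact/(measurable_restrictT _ mD).
rewrite /finite_norm ltey; apply/negP => /eqP N; have := powR_Lnorm_restrict (lebesgue_rV n) p1 D f.
by rewrite N poweRyr ?gt_eqF// => E; move: Ioo; rewrite -E ltxx.
Qed.

(** * The radial profile, its approximants and its admissibility *)

Section profile.
Context {R : realType} {n : nat} (n_gt0 : (0 < n)%N) (p : R) (p_gt1 : 1 < p).
Local Notation V := 'rV[R]_n.
Local Notation mu := (@lebesgue_rV R n).
Local Notation ext := (@exterior R n).
(** Since [L 1 = 0], the relation [kapL] makes [pot] equal to 1 at 1 and to 0 at r^2, the boundary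
    values on the two spheres. The numbers al and r are tied to n, p and the volume constraint by
    [alE] and [rE] below. *)
Variables (L : R -> R) (al r kap : R).
Hypotheses (al0 : 0 <= al) (L1 : L 1 = 0)
  (dL : forall s : R, 0 < s -> is_derive s (1 : R) L (s `^ (- ((al + 1) / 2))))
  (smL : forall f : V -> R, sm f -> (forall x, 0 < f x) -> sm (fun x => L (f x)))
  (r1 : 1 < r) (kap0 : 0 < kap) (kapL : kap * L (r ^+ 2) = 1).

(** The radial solution as a function of [|x|^2]: since [al = (n-1)/(p-1)], the map
    [x |-> L (|x|^2)] is p-harmonic. *)
Definition pot s := 1 - kap * L s.
Definition pot' s := - (kap * s `^ (- ((al + 1) / 2))).

Lemma L_lt a c : 0 < a -> a < c -> L a < L c.
Proof.
move=> a0 ac; have [||z] := @MVT R L (fun s => s `^ (- ((al + 1) / 2))) a c ac.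
- by move=> x /[!in_itv]/= /andP[ax _]; apply: dL; exact: lt_trans ax.
- apply: derivable_within_continuous => x /[!in_itv]/= /andP[ax _].
  by have [] := dL (lt_le_trans a0 ax).
rewrite in_itv/= => /andP[az _] E.
by rewrite -subr_gt0 E mulr_gt0 ?subr_gt0// powR_gt0// (lt_trans a0).
Qed.

Lemma pot_gt0 s : 0 < s -> (0 < pot s) = (s < r ^+ 2).
Proof.
move=> s0; have r20 : 0 < r ^+ 2 by rewrite exprn_gt0// (lt_trans ltr01).
rewrite /pot subr_gt0 -kapL ltr_pM2l//; have [h|h|->] := ltgtP s (r ^+ 2).
- exact: L_lt.
- by apply/negbTE; rewrite -leNgt ltW// L_lt.
- by rewrite ltxx.
Qed.

Lemma pot_lt1 s : 1 < s -> pot s < 1.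
Proof. by move=> s1; rewrite /pot ltrBlDr ltrDl mulr_gt0// -L1 L_lt. Qed.

Lemma is_derive_pot (s : R) : 0 < s -> is_derive s (1 : R) pot (pot' s).
Proof.
move=> s0; apply: (is_derive_eq (is_deriveB (is_derive_cst (1 : R) s (1 : R)) (is_deriveZ kap (dL s0)))).
by rewrite sub0r.
Qed.

Lemma pot_continuous (s : R) : 0 < s -> {for s, continuous pot}.
Proof.
move=> s0; apply/differentiable_continuous; apply/derivable1_diffP.
by have [] := is_derive_pot s0.
Qed.

Lemma pot'_continuous (s : R) : 0 < s -> {for s, continuous pot'}.
Proof.
move=> s0; apply/differentiable_continuous; apply/derivable1_diffP.
by have [+ _] := is_deriveN (is_deriveZ kap (is_derive1_powR (- ((al + 1) / 2)) s0)).
Qed.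

Lemma norm_pot'_le s : 1 <= s -> `|pot' s| <= kap.
Proof.
move=> s1; rewrite normrN ger0_norm ?mulr_ge0 ?powR_ge0 ?(ltW kap0)// ler_piMr ?(ltW kap0)//.
by rewrite -[leRHS](powRr0 s) ler_powR// oppr_le0 divr_ge0// addr_ge0.
Qed.

(** The inner maximum only makes the function continuous at the origin. *)
Definition radial_sol (x : V) : R := Num.max 0 (pot (Num.max 1 (enorm x ^+ 2))).
Local Notation U := radial_sol.

(** The chain rule through |x|^2 gives 2 [pot'] (|x|^2) x, whence the factor 2 and the exponent
    -(al+1). *)
Definition radial_grad (x : V) : V :=
  if 0 < U x then - (2 * kap * enorm x `^ (- (al + 1))) *: x else 0.
Local Notation DU := radial_grad.

Let pow_gt1 (x : V) : ext x -> 1 < enorm x ^+ 2.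
Proof. by move=> /exteriorP x1; rewrite exprn_egt1. Qed.

Lemma radial_sol_continuous : continuous U.
Proof.
move=> x; have cm : continuous (fun x : V => Num.max (enorm x ^+ 2 - 1) 0 - -1).
  apply: cont_sub; last exact: cont_cst.
  have c0 : continuous (fun x : V => enorm x ^+ 2 - 1).
    by apply: cont_sub; [exact: sqr_enorm_continuous|exact: cont_cst].
  exact: (continuous_max0 c0).
have E y : U y = Num.max (pot (Num.max (enorm y ^+ 2 - 1) 0 - -1)) 0.
  by rewrite /U maxC opprK; congr (Num.max (pot _) _); rewrite addr_maxl subrK add0r maxC.
rewrite (_ : U = fun y => Num.max (pot (Num.max (enorm y ^+ 2 - 1) 0 - -1)) 0); last exact/funext.
have c1 : continuous (fun y : V => pot (Num.max (enorm y ^+ 2 - 1) 0 - -1)).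
  move=> y; have m1 : 0 < Num.max (enorm y ^+ 2 - 1) 0 - -1.
    by rewrite opprK (lt_le_trans ltr01)// lerDr le_max lexx orbT.
  exact: (continuous_comp (cm y) (pot_continuous m1)).
by have := continuous_max0 c1; apply.
Qed.

Lemma radial_solE x : ext x -> U x = Num.max 0 (pot (enorm x ^+ 2)).
Proof. by move=> /pow_gt1/ltW x1; rewrite /U (max_r x1). Qed.

Lemma radial_sol_gt0 x : ext x -> (0 < U x) = (enorm x < r).
Proof.
move=> ex; rewrite radial_solE// lt_max ltxx/= pot_gt0; last exact: lt_trans (pow_gt1 ex).
by rewrite ltr_sqr// nnegrE ?enorm_ge0// (le_trans ler01)// ltW.
Qed.

Lemma radial_sol_bounds x : ext x -> 0 <= U x <= 1.
Proof.
by move=> ex; rewrite radial_solE// le_max lexx/= ge_max ler01 ltW// pot_lt1// pow_gt1.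
Qed.

(** The added 1/(k+1) keeps the argument of [L] positive at the origin, so that the approximants
    stay in the class [sm]. As [pot] is decreasing, the shift only lowers it, and the approximants
    vanish for |x| >= r. *)
Definition shift k (x : V) : R := enorm x ^+ 2 + k.+1%:R^-1.
Definition radial_approx k (x : V) : R := damp k.+1%:R (pot (shift k x)).
Local Notation u_ := radial_approx.

Let shift0 k x : 0 < shift k x.
Proof. by rewrite /shift ltr_wpDl ?sqr_ge0// invr_gt0. Qed.

Let k0 (k : nat) : 0 < k.+1%:R :> R. Proof. by rewrite ltr0n. Qed.

Lemma radial_approx_sm k : sm (u_ k).
Proof.
have s1 : sm (shift k) by exact: sm_sqr_enorm.
have s2 : sm (fun x => pot (shift k x)).
  rewrite (_ : (fun x => _) = fun x => 1 + (- kap) * L (shift k x)).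
    by apply: sm_D; [exact: sm_cst|apply: sm_M; [exact: sm_cst|exact: smL]].
  by apply/funext => x; rewrite /pot mulNr.
by apply: sm_M => //; apply: sm_flat; apply: sm_M => //; exact: sm_cst.
Qed.

Lemma partial_radial_approx k i x :
  partial i (u_ k) x = damp' k.+1%:R (pot (shift k x)) * (pot' (shift k x) * (2 * x ord0 i)).
Proof.
apply: derive_val.
apply: (is_derive_comp1 (is_derive_damp _ _)).
apply: (is_derive_comp1 (is_derive_pot (shift0 k x))).
by apply: (is_derive_eq (is_deriveD (is_derive_sqr_enorm x i) (is_derive_cst (k.+1%:R^-1 : R) x _))); rewrite addr0.
Qed.

Lemma pot_shift_le0 k x : r <= enorm x -> pot (shift k x) <= 0.
Proof.
move=> rx; rewrite leNgt pot_gt0// -leNgt (@le_trans _ _ (enorm x ^+ 2))//.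
  by rewrite ler_sqr ?nnegrE ?enorm_ge0// (le_trans ler01)// ltW.
by rewrite lerDl invr_ge0 ltW.
Qed.

Lemma radial_approx_out k x : r <= enorm x -> u_ k x = 0.
Proof. by move=> rx; apply: damp_le0 => //; exact: pot_shift_le0. Qed.

Lemma partial_radial_approx_out k i x : r <= enorm x -> partial i (u_ k) x = 0.
Proof. by move=> rx; rewrite partial_radial_approx damp'_le0 ?mul0r// pot_shift_le0. Qed.

Lemma radial_approx_test k : test_function setT (u_ k).
Proof.
split=> //; first by apply: sm_smooth; exact: radial_approx_sm.
apply: (@subclosed_compact _ _ (ecball r)) => //; first exact: closed_closure.
  by exact: compact_ecball.
rewrite [X in _ `<=` X](closure_id _).1; last exact: closed_ecball.
apply: closure_subset => x /= ux; rewrite /ecball/= leNgt; apply/negP => /ltW rx.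
by move: ux; rewrite radial_approx_out// eqxx.
Qed.

Lemma radial_approx_C1 k : C1 (u_ k).
Proof. exact: test_C1 (radial_approx_test k). Qed.

Let r0 : 0 < r. Proof. exact: lt_trans r1. Qed.

(** For |x| < r a partial derivative is at most 2 kap (2 r), from [damp'] <= 2, |[pot']| <= kap and
    |2 x_i| <= 2 r; the added 1 covers the values. *)
Definition radial_bound := 4 * kap * r + 1.
Local Notation M := radial_bound.

Let M1 : 1 <= M. Proof. by rewrite /M lerDr !mulr_ge0// ltW. Qed.

Lemma radial_approx_bound k x : ext x -> `|u_ k x| <= M.
Proof.
move=> ex; have /andP[a b] := damp_bounds (pot (shift k x)) (k0 k).
rewrite ger0_norm//; apply: le_trans M1; apply: le_trans b _.
rewrite ge_max ler01 ltW// pot_lt1// (lt_le_trans (pow_gt1 ex))//.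
by rewrite lerDl invr_ge0 ltW.
Qed.

Lemma partial_radial_approx_bound k i x : ext x -> `|partial i (u_ k) x| <= M.
Proof.
move=> ex; have [rx|rx] := leP r (enorm x).
  by rewrite partial_radial_approx_out// normr0 (le_trans ler01).
have /andP[a b] := damp'_bounds k.+1%:R (pot (shift k x)).
rewrite partial_radial_approx !normrM (ger0_norm a) (ger0_norm (ler0n _ 2)).
apply: (@le_trans _ _ (2 * (kap * (2 * r)))); last first.
  by rewrite /M (_ : 2 * _ = 4 * kap * r) ?lerDl//; ring.
apply: (ler_pM a _ b); first by rewrite mulr_ge0// mulr_ge0.
apply: (ler_pM (normr_ge0 _)); first by rewrite mulr_ge0.
  apply: norm_pot'_le; rewrite (le_trans (ltW (pow_gt1 ex)))// lerDl invr_ge0 ltW//.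
by rewrite ler_wpM2l// (le_trans (coor_le_enorm _ _))// ltW.
Qed.

Let shift_cvg x : shift k x @[k --> \oo] --> enorm x ^+ 2.
Proof.
rewrite -[X in _ --> X]addr0; apply: cvgD; first exact: cvg_cst.
exact: cvg_harmonic.
Qed.

Let e20 x : ext x -> 0 < enorm x ^+ 2.
Proof. by move=> /pow_gt1; exact: lt_trans. Qed.

Let pot_cvg x : ext x -> pot (shift k x) @[k --> \oo] --> pot (enorm x ^+ 2).
Proof. by move=> ex; apply: continuous_cvg; [exact: (pot_continuous (e20 ex))|exact: shift_cvg]. Qed.

Lemma radial_approx_cvg x : ext x -> u_ k x @[k --> \oo] --> U x.
Proof.
move=> ex; rewrite radial_solE//; have [h|h] := leP (pot (enorm x ^+ 2)) 0.
  rewrite (_ : (fun k => _) = cst 0); first exact: cvg_cst.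
  apply/funext => k; apply: damp_le0 => //; rewrite leNgt pot_gt0// -leNgt.
  have {}h : ~~ (0 < pot (enorm x ^+ 2)) by rewrite -leNgt.
  move: h; rewrite pot_gt0 ?e20// -leNgt => h; apply: le_trans h _.
  by rewrite lerDl invr_ge0 ltW.
exact: (damp_cvg h (pot_cvg ex)).1.
Qed.

Lemma partial_radial_approx_cvg i x : ext x ->
  partial i (u_ k) x @[k --> \oo] --> DU x ord0 i.
Proof.
move=> ex; under eq_fun do rewrite partial_radial_approx.
rewrite /DU radial_solE// lt_max ltxx/=; case: ifPn => h; last first.
  rewrite mxE (_ : (fun k => _) = cst 0); first exact: cvg_cst.
  apply/funext => k; rewrite damp'_le0 ?mul0r// leNgt pot_gt0// -leNgt.
  move: h; rewrite pot_gt0 ?e20// -leNgt => h; apply: le_trans h _.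
  by rewrite lerDl invr_ge0 ltW.
have c1 := (damp_cvg h (pot_cvg ex)).2.
have c2 : pot' (shift k x) @[k --> \oo] --> pot' (enorm x ^+ 2).
  by apply: continuous_cvg; [exact: (pot'_continuous (e20 ex))|exact: shift_cvg].
have := cvgM c1 (cvgM c2 (cvg_cst (2 * x ord0 i))).
rewrite (_ : 1 * _ = (- (2 * kap * enorm x `^ (- (al + 1))) *: x) ord0 i) => [H|]; first by apply: H.
rewrite mxE mul1r /pot' -powR_mulrn ?enorm_ge0// -powRrM.
rewrite (_ : 2%:R * - ((al + 1) / 2) = - (al + 1)); last by field.
by ring.
Qed.

Lemma radial_grad_bound i x : ext x -> `|DU x ord0 i| <= M.
Proof.
move=> ex; have c := @partial_radial_approx_cvg i x ex.
apply: (cvgr_to_le (cvg_norm c)).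
by apply: nearW => k; exact: partial_radial_approx_bound.
Qed.

Lemma measurable_radial_grad i : measurable_fun ext (fun x => DU x ord0 i).
Proof.
apply: (@measurable_fun_cvg _ _ _ _ (fun k => partial i (u_ k))) => //.
  move=> k; apply: measurable_funTS; apply: continuous_measurable_rV.
  exact: ((radial_approx_C1 k).2 i).1.
by move=> x ex; exact: partial_radial_approx_cvg.
Qed.

Lemma measurable_radial_sol : measurable_fun ext U.
Proof. by apply: measurable_funTS; apply: continuous_measurable_rV; exact: radial_sol_continuous. Qed.

Let K := ext `&` ecball r.

Let mK : measurable K.
Proof. by apply: measurableI; [exact: measurable_exterior|exact: measurable_ecball]. Qed.

Let Koo : (mu K < +oo)%E.
Proof.
apply: le_lt_trans (lebesgue_rV_ecball n r); apply: le_measure; rewrite ?inE//.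
  exact: measurable_ecball.
exact: subIsetr.
Qed.

Let outK x : ext x -> ~ K x -> r <= enorm x.
Proof. by move=> ex nK; rewrite leNgt; apply/negP => /ltW h; apply: nK. Qed.

Lemma radial_sol_out x : ext x -> r <= enorm x -> U x = 0.
Proof.
move=> ex rx; apply/eqP; rewrite eq_le (andP (radial_sol_bounds ex)).1 andbT.
by rewrite leNgt radial_sol_gt0// -leNgt.
Qed.

Lemma radial_grad_out x : ext x -> r <= enorm x -> DU x = 0.
Proof. by move=> ex rx; rewrite /DU radial_sol_out// ltxx. Qed.

Lemma radial_sol_Lp_cvg q : 0 < q ->
  (\int[mu]_(x in ext) (`|u_ k x - U x| `^ q)%:E)%E @[k --> \oo] --> 0%E.
Proof.
move=> q0; apply: (@bounded_Lp_cvg0 _ _ _ mu q M ext K) => //.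
- exact: measurable_exterior.
- by exact: subIsetl.
- by move=> k; apply: measurable_funTS; apply: continuous_measurable_rV; exact: (radial_approx_C1 k).1.
- exact: measurable_radial_sol.
- by move=> k x ex; exact: radial_approx_bound.
- by move=> x ex; have /andP[a b] := radial_sol_bounds ex; rewrite ger0_norm// (le_trans b).
- by move=> k x ex nK; rewrite radial_approx_out// outK.
- by move=> x ex nK; rewrite radial_sol_out// outK.
- by move=> x ex; exact: radial_approx_cvg.
Qed.

Lemma radial_grad_Lp_cvg q i : 0 < q ->
  (\int[mu]_(x in ext) (`|partial i (u_ k) x - DU x ord0 i| `^ q)%:E)%E @[k --> \oo] --> 0%E.
Proof.
move=> q0; apply: (@bounded_Lp_cvg0 _ _ _ mu q M ext K (fun k => partial i (u_ k)) (fun x => DU x ord0 i)) => //.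
- exact: measurable_exterior.
- by exact: subIsetl.
- by move=> k; apply: measurable_funTS; apply: continuous_measurable_rV; exact: ((radial_approx_C1 k).2 i).1.
- exact: measurable_radial_grad.
- by move=> k x ex; exact: partial_radial_approx_bound.
- by move=> x ex; exact: radial_grad_bound.
- by move=> k x ex nK; rewrite partial_radial_approx_out// outK.
- by move=> x ex nK; rewrite radial_grad_out ?mxE// outK.
- by move=> x ex; exact: partial_radial_approx_cvg.
Qed.

(** The approximants are constant on the unit sphere, so the integral is a number tending to 0 times
    a finite area. *)
Lemma radial_sphere_cvg q : 0 < q ->
  (\int[surface_measure]_(x in unit_sphere) (`|u_ k x - 1| `^ q)%:E)%E @[k --> \oo] --> 0%E.
Proof.
move=> q0; pose c k := damp k.+1%:R (pot (1 + k.+1%:R^-1)).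
have mS : measurable (@unit_sphere R n).
  rewrite (_ : unit_sphere = enorm @^-1` [set 1%R])//.
  by rewrite -[X in measurable X]setTI; exact: measurable_enorm.
have E k : (\int[surface_measure]_(x in unit_sphere) (`|u_ k x - 1| `^ q)%:E)%E =
    ((`|c k - 1| `^ q)%:E * @surface_measure R n unit_sphere)%E.
  transitivity (\int[surface_measure]_(x in unit_sphere) (cst (`|c k - 1| `^ q)%:E (x : V)))%E.
    apply: eq_integral => x /set_mem; rewrite /unit_sphere/= => x1.
    by rewrite /radial_approx /shift x1 expr1n.
  by rewrite integral_cst.
have Soo : (@surface_measure R n unit_sphere < +oo)%E.
  rewrite /surface_measure/= /mscale/=; apply: lte_mul_pinfty => //.
  change (mu (unit_ball `&` normalize @^-1` unit_sphere) < +oo)%E.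
  apply: (@le_lt_trans _ _ (mu (eball 1))); last exact: lebesgue_eball1_lty.
  apply: le_measure; rewrite ?inE; last exact: subIsetl.
    apply: measurableI; first exact: measurable_unit_ball.
    by rewrite -[X in measurable X]setTI; apply: measurable_normalize.
  exact: measurable_eball.
have Sfin : @surface_measure R n unit_sphere = (fine (@surface_measure R n unit_sphere))%:E.
  by rewrite fineK// ge0_fin_numE.
have cc : c k @[k --> \oo] --> (1 : R).
  have p1 : pot 1 = 1 by rewrite /pot L1 mulr0 subr0.
  have h : pot (1 + k.+1%:R^-1) @[k --> \oo] --> (1 : R).
    have c1 : (1 + k.+1%:R^-1 : R) @[k --> \oo] --> (1 : R).
      by rewrite -[X in _ --> X]addr0; apply: cvgD; [exact: cvg_cst|exact: cvg_harmonic].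
    by rewrite -[X in _ --> X]p1; apply: continuous_cvg; [exact: (pot_continuous ltr01)|exact: c1].
  exact: (damp_cvg ltr01 h).1.
apply/ecvg0P => [k|e e0].
  by apply: integral_ge0 => x _; rewrite lee_fin powR_ge0.
set S := fine _ in Sfin.
have S0 : 0 <= S by rewrite fine_ge0.
have e1 : 0 < (e / (S + 1)) `^ q^-1 by rewrite powR_gt0// divr_gt0// ltr_wpDl.
have /cvgrPdist_le/(_ _ e1) := cc; apply: filterS => k hk.
rewrite E Sfin -EFinM lee_fin distrC in hk *.
have : `|c k - 1| `^ q <= e / (S + 1).
  have E1 : e / (S + 1) = ((e / (S + 1)) `^ q^-1) `^ q.
    by rewrite -powRrM mulVf ?gt_eqF// powRr1// divr_ge0 ?addr_ge0// ltW.
  by rewrite E1 ge0_ler_powR ?(ltW q0)// nnegrE// ltW.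
move=> h; apply: (@le_trans _ _ (e / (S + 1) * S)); first by rewrite ler_wpM2r.
by rewrite mulrAC ler_pdivrMr ?ltr_wpDl// ler_wpM2l ?(ltW e0)// lerDl.
Qed.

Lemma radial_approximates : approximates U DU 1 u_.
Proof.
have m1 (f g : V -> R) : measurable_fun ext f -> continuous g ->
    measurable_fun ext (fun x => (`|g x - f x| `^ 1)%:E).
  move=> mf cg; apply/measurable_EFinP; apply: (measurableT_comp (measurable_powR _)).
  apply: measurableT_comp => //; apply: measurable_funB => //.
  by apply: measurable_funTS; exact: continuous_measurable_rV.
have key (g_ : nat -> V -> R) (f : V -> R) s : (forall k, continuous (g_ k)) -> measurable_fun ext f ->
    (\int[mu]_(x in ext) (`|g_ k x - f x| `^ 1)%:E)%E @[k --> \oo] --> 0%E ->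
    (\int[mu]_(x in ext `&` ecball s) (`|g_ k x - f x|)%:E)%E @[k --> \oo] --> 0%E.
  move=> cg mf; apply: ecvg0_le => k; first by apply: integral_ge0 => x _; rewrite lee_fin.
  under eq_integral do rewrite -[`|_|]powRr1//.
  apply: ge0_subset_integral => //; first [exact: subIsetl|exact: measurable_exterior|
    exact: (m1 _ _ mf (cg k))|by apply: measurableI; [exact: measurable_exterior|exact: measurable_ecball]].
have C1u := radial_approx_C1.
split=> //.
- exact: measurable_radial_sol.
- exact: measurable_radial_grad.
- move=> s; apply: key; [by move=> k; exact: (C1u k).1|exact: measurable_radial_sol|].
  exact: radial_sol_Lp_cvg.
- move=> s i; apply: (key (fun k => partial i (u_ k)) (fun x => DU x ord0 i)).
  + by move=> k; exact: ((C1u k).2 i).1.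
  + exact: measurable_radial_grad.
  + exact: radial_grad_Lp_cvg.
- apply: ecvg0_le (radial_sphere_cvg ltr01) => k.
    by apply: integral_ge0 => x _; rewrite lee_fin.
  under eq_integral do rewrite -[`|_|]powRr1//.
  apply: (surface_ge n_gt0 (g := fun x => `|u_ k x - 1| `^ 1)) => [|x]; last exact: powR_ge0.
  apply: (measurableT_comp (measurable_powR _)); apply: measurableT_comp => //.
  by apply: measurable_funB => //; apply: continuous_measurable_rV; exact: (C1u k).1.
Qed.

Lemma radial_weak_gradient : weak_gradient ext U DU.
Proof. exact: approximates_weak_gradient radial_approximates. Qed.

Lemma radial_sobolev : sobolev p ext U.
Proof.
have mext := @measurable_exterior R n.
split; last exists DU.
- apply: (@bounded_Lp_on _ _ p M ext K) => //.
  + by exact: subIsetl.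
  + exact: measurable_radial_sol.
  + by move=> x ex; have /andP[a b] := radial_sol_bounds ex; rewrite ger0_norm// (le_trans b).
  + by move=> x ex nK; rewrite radial_sol_out// outK.
- exact: radial_weak_gradient.
- move=> i; apply: (@bounded_Lp_on _ _ p M ext K) => //.
  + by exact: subIsetl.
  + exact: measurable_radial_grad.
  + by move=> x ex; exact: radial_grad_bound.
  + by move=> x ex nK; rewrite /coors/= radial_grad_out ?mxE// outK.
Qed.

Lemma wgrad_radial (Omega : set V) : open Omega -> Omega `<=` ext ->
  weak_gradient Omega U (wgrad Omega U) /\
  {ae mu, forall x, Omega x -> wgrad Omega U x = DU x}.
Proof.
move=> oO Oe; have hD := weak_gradientS Oe radial_weak_gradient.
have hw : weak_gradient Omega U (wgrad Omega U).
  by rewrite /wgrad; case: xgetP => [G' _ //|/(_ DU)].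
by split=> //; exact: weak_gradient_unique hw hD.
Qed.

Lemma radial_has_trace : has_trace p U (cst 1).
Proof.
have p0 : 0 < p by exact: lt_trans p_gt1.
have mext := @measurable_exterior R n.
exists u_; split.
- exact: radial_approx_test.
- by apply/(Lnorm_cvg0 _ p_gt1 _ _).2; exact: radial_sol_Lp_cvg.
- move=> i; apply/(Lnorm_cvg0 _ p_gt1 _ _).2.
  have [[_ lw _] aew] := wgrad_radial open_exterior (@subset_refl _ ext).
  have mw : measurable_fun ext (fun x => wgrad ext U x ord0 i).
    by apply: loc_integrable_measurable; [exact: open_exterior|exact: lw].
  rewrite (_ : (fun k => _) = fun k =>
    (\int[mu]_(x in ext) (`|partial i (u_ k) x - DU x ord0 i| `^ p)%:E)%E).
    exact: radial_grad_Lp_cvg.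
  apply/funext => k.
  have mk : measurable_fun ext (partial i (u_ k)).
    by apply: measurable_funTS; apply: continuous_measurable_rV; exact: ((radial_approx_C1 k).2 i).1.
  have mp (f : V -> R) : measurable_fun ext f ->
      measurable_fun ext (fun x => (`|partial i (u_ k) x - f x| `^ p)%:E).
    move=> mf; apply/measurable_EFinP; apply: (measurableT_comp (measurable_powR _)).
    by apply: measurableT_comp => //; exact: measurable_funB.
  apply: ge0_ae_eq_integral => //.
  + exact: mp.
  + by apply: mp; exact: measurable_radial_grad.
  + by apply: filterS aew => x h ex; rewrite /coors/= h.
- by apply/(Lnorm_cvg0 _ p_gt1 _ _).2; exact: radial_sphere_cvg.
Qed.

Lemma positivity_radial : positivity_set U = eball r `\` ecball 1.
Proof.
apply/seteqP; split => x [a b].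
  by split; [rewrite /eball/= -radial_sol_gt0|move: a; rewrite exteriorE].
have ex : ext x by rewrite exteriorE.
by split => //=; rewrite radial_sol_gt0.
Qed.

Lemma open_positivity_radial : open (positivity_set U).
Proof.
rewrite positivity_radial setDE -exteriorE; apply: openI; last exact: open_exterior.
exact: open_eball.
Qed.

(** The length of [radial_grad] on the positivity set, continued by the same formula so that it can
    also be integrated over the positivity set of a competitor. *)
Definition slope (x : V) : R := 2 * kap * enorm x `^ (- al).

Lemma slope_gt0 (x : V) : 0 < enorm x -> 0 < slope x.
Proof. by move=> x0; rewrite /slope !mulr_gt0// powR_gt0. Qed.

Let pow_step (t : R) : 0 < t -> t `^ (- (al + 1)) * t = t `^ (- al).
Proof.
move=> t0; have := powRD_gt0 (- (al + 1)) 1 t0.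
by rewrite powRr1 ?ltW// (_ : - (al + 1) + 1 = - al); last by ring.
Qed.

Let pos_enorm x : positivity_set U x -> 0 < enorm x.
Proof. by move=> [/exteriorP x1 _]; exact: lt_trans x1. Qed.

Lemma radial_gradE x : positivity_set U x -> DU x = - (slope x / enorm x) *: x.
Proof.
move=> h; have x0 := pos_enorm h; have [_ ux] := h; rewrite /DU ifT//; congr (- _ *: _).
by rewrite /slope -(pow_step x0) mulrA mulfK// gt_eqF.
Qed.

Lemma enorm_radial_grad x : positivity_set U x -> enorm (DU x) = slope x.
Proof.
move=> h; have x0 := pos_enorm h; rewrite radial_gradE// enormZ normrN ger0_norm.
  by rewrite divfK// gt_eqF.
by rewrite divr_ge0// ltW// slope_gt0.
Qed.

Lemma edot_radial_grad x : positivity_set U x -> edot x (DU x) = - (enorm x * slope x).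
Proof.
move=> h; have x0 := pos_enorm h; rewrite radial_gradE// edotZr edotxx.
by field; rewrite gt_eqF.
Qed.

Hypotheses (alE : al * (p - 1) = n%:R - 1) (rE : (r ^+ n - 1) * vball n = 1).

(** By [alE], the power [slope] ^(p-1) is a constant times |x|^(1-n). The free numerator q serves
    for x . grad of test functions and of competitors alike. *)
Lemma slope_weight (x : V) (q : R) : 0 < enorm x ->
  slope x `^ (p - 1) * (q / enorm x) = (2 * kap) `^ (p - 1) * (q / enorm x ^+ n).
Proof.
move=> x0; rewrite /slope powRM ?powR_ge0 ?mulr_ge0 ?(ltW kap0)// -mulrA; congr (_ * _).
rewrite -powRrM mulNr alE mulrCA; congr (_ * _).
rewrite -powR_invn ?enorm_ge0// -powR_inv1 ?enorm_ge0//.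
have := powRD_gt0 (- (n%:R - 1)) (- 1) x0.
by rewrite (_ : - (n%:R - 1) + - 1 = - n%:R :> R); last by ring.
Qed.

(** The field |DU|^(p-2) DU is a constant times x/|x|^n, so the weak equation is [radial_divergence]
    for the test function. Its boundary term is 0 because the support lies in the open exterior. *)
Lemma radial_harmonic : p_harmonic p (positivity_set U) U.
Proof.
set N := positivity_set U; move=> f tf.
have oN : open N by exact: open_positivity_radial.
have mN : measurable N by exact: open_measurable_rV.
have Ne : N `<=` ext by exact: subIsetl.
have [[_ lw _] aew] := wgrad_radial oN Ne.
have C1f := test_C1 tf; have bf := test_bsupp tf.
have mw i : measurable_fun N (fun x => wgrad N U x ord0 i).
  by apply: loc_integrable_measurable => //; exact: lw.
have mD i : measurable_fun N (fun x => DU x ord0 i).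
  by apply: measurable_funS (@measurable_radial_grad i) => //; exact: measurable_exterior.
have mg i : measurable_fun N (fun x => gradient f x ord0 i).
  under eq_fun do rewrite mxE; apply: measurable_funTS; apply: continuous_measurable_rV.
  exact: (C1f.2 i).1.
have mF (W : V -> V) : (forall i, measurable_fun N (fun x => W x ord0 i)) ->
    measurable_fun N (fun x => (enorm (W x) `^ (p - 2) * edot (W x) (gradient f x))%:E).
  move=> mW; apply/measurable_EFinP; apply: measurable_funM.
    by apply: (measurableT_comp (measurable_powR _)); exact: measurable_enorm_comp.
  exact: measurable_edot_comp.
have -> : \int[mu]_(x in N) (enorm (wgrad N U x) `^ (p - 2) * edot (wgrad N U x) (gradient f x)) =
    \int[mu]_(x in N) (enorm (DU x) `^ (p - 2) * edot (DU x) (gradient f x)).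
  rewrite /Rintegral; congr fine; apply: ae_eq_integral => //; [exact: mF|exact: mF|].
  by apply: filterS aew => x h Nx; rewrite h.
have -> : \int[mu]_(x in N) (enorm (DU x) `^ (p - 2) * edot (DU x) (gradient f x)) =
    \int[mu]_(x in N) (- (2 * kap) `^ (p - 1) * (edot x (gradient f x) / enorm x ^+ n)).
  apply: eq_Rintegral => x /set_mem Nx; have x0 := pos_enorm Nx.
  rewrite enorm_radial_grad// radial_gradE// edotZl [RHS]mulNr -slope_weight//.
  have s0 := slope_gt0 x0.
  have -> : slope x `^ (p - 1) = slope x `^ (p - 2) * slope x.
    have := powRD_gt0 (p - 2) 1 s0.
    by rewrite powRr1 ?ltW// (_ : p - 2 + 1 = p - 1); last by ring.
  by field; rewrite gt_eqF.
have f0 x : ~ N x -> edot x (gradient f x) = 0.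
  by move=> nN; rewrite /edot big1// => i _; rewrite mxE (partial_out i tf nN) mulr0.
rewrite (Rintegral_supp Ne); last by move=> x nN; rewrite f0// mul0r mulr0.
have cg := edot_gradient_continuous C1f.
have bg : bsupp (fun x => edot x (gradient f x)).
  have [s s0 hs] := bsupp_gradient bf; exists s => // x xs.
  by rewrite (hs x xs).2 /edot big1// => i _; rewrite mxE mulr0.
have I1 : mu.-integrable ext (EFin \o (fun x => edot x (gradient f x) / enorm x ^+ n)).
  apply: (@eq_integrable _ _ _ _ _ (@measurable_exterior R n)
    (fun x => (\1_(~` ecball 1) x * (enorm x) ^- n * edot x (gradient f x))%:E)).
    by move=> x xe /=; rewrite -exteriorE indicE xe mul1r mulrC.
  by apply: integrableS (integrable_radial cg bg) => //; exact: measurable_exterior.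
rewrite RintegralZl//; last exact: measurable_exterior.
have := radial_divergence n_gt0 C1f bf; rewrite -exteriorE => ->.
have -> : \int[mu]_(x in eball 1) f (normalize x) = \int[mu]_(x in eball 1) (cst 0 x : R).
  apply: eq_Rintegral => x _; have [_ _ fN] := tf; apply: support_out => /fN[/exteriorP + _].
  rewrite enormZ normfV ger0_norm ?enorm_ge0//; have [->|x0] := eqVneq x 0.
    by rewrite enorm0 mulr0 ltr10.
  by rewrite mulVf ?ltxx// gt_eqF// enorm_gt0.
by rewrite Rintegral_cst ?mul0r ?mulr0//; exact: measurable_eball.
Qed.

Lemma radial_admissible : admissible p (cst 1) U.
Proof.
split; [exact: radial_sobolev|exact: radial_has_trace|exact: open_positivity_radial|
  exact: radial_harmonic|].
by rewrite positivity_radial lebesgue_annulus// rE.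
Qed.

Lemma radial_sol_symmetric : radially_symmetric U.
Proof. by exists (fun t => Num.max 0 (pot (Num.max 1 (t ^+ 2)))). Qed.

Lemma radial_free_boundary : free_boundary U = sphere 0 r.
Proof.
rewrite /free_boundary; have := open_positivity_radial; rewrite openE => oN.
apply/seteqP; split => x.
  move=> [ex [cx ix]]; rewrite /sphere/= subr0.
  have nx : ~ positivity_set U x by move=> /oN.
  apply/eqP; rewrite eq_le; apply/andP; split; last first.
    rewrite leNgt; apply/negP => xr; apply: nx; split => //=.
    by rewrite radial_sol_gt0.
  have : closure (ecball r) x.
    by move: cx; apply: closure_subset => y; rewrite positivity_radial => -[/ltW].
  by rewrite -(closure_id _).1//; exact: closed_ecball.
rewrite /sphere/= subr0 => xr; have ex : ext x by apply/exteriorP; rewrite xr.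
split=> //; split; last first.
  by move=> /interior_subset[_ /=]; rewrite radial_sol_gt0// xr ltxx.
move=> B Bx.
have c : (fun t : R => t *: x) @ (1 : R)^'- --> x.
  rewrite -[X in _ --> X](scale1r x); apply: cvgZr_tmp.
  by apply: cvg_at_left_filter; exact: cvg_id.
(* The bound t < 1 puts t x inside radius r, and t > 1/r keeps it outside the closed unit ball. *)
have H : \forall t \near (1 : R)^'-, r^-1 < t < 1 /\ B (t *: x).
  near=> t; split; last by near: t; exact: c Bx.
  apply/andP; split; last by near: t; exact: nbhs_left_lt.
  by near: t; apply: nbhs_left_gt; rewrite invf_lt1.
have [t [/andP[t0 t1] Bt]] := filter_ex H.
have tp : 0 < t by apply: lt_trans t0; rewrite invr_gt0.
have te : enorm (t *: x) = t * r by rewrite enormZ gtr0_norm// xr.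
exists (t *: x); split => //.
have et : ext (t *: x) by apply/exteriorP; rewrite te -ltr_pdivrMr// mul1r.
by split => //=; rewrite radial_sol_gt0// te gtr_pMl.
Unshelve. all: by end_near. Qed.

End profile.

(** * Calibration and uniqueness *)

Section integral_tools.
Context d (T : measurableType d) {R : realType} (mu : {measure set T -> \bar R}).
Variables (D : set T) (mD : measurable D).

Lemma ae_ge0_Rintegral_eq0 (F : T -> R) : mu.-integrable D (EFin \o F) ->
  {ae mu, forall x, D x -> 0 <= F x} -> \int[mu]_(x in D) F x = 0 ->
  {ae mu, forall x, D x -> F x = 0}.
Proof.
move=> IF F0 E; have mF : measurable_fun D (EFin \o F) by exact: measurable_int IF.
have : (\int[mu]_(x in D) `|(F x)%:E| = 0)%E.
  transitivity (\int[mu]_(x in D) (F x)%:E)%E.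
    apply: ae_eq_integral => //; first exact: measurableT_comp.
    by apply: filterS F0 => x h Dx; rewrite /= ger0_norm// h.
  rewrite -[LHS]fineK; last exact: integrable_fin_num.
  by move: E; rewrite /Rintegral => ->.
move=> /(ae_eq_integral_abs mu mD mF); apply: filterS => x h Dx.
by have := h Dx => -[].
Qed.

Lemma ae_ge0_Rintegral_ge0 (F : T -> R) : mu.-integrable D (EFin \o F) ->
  {ae mu, forall x, D x -> 0 <= F x} -> 0 <= \int[mu]_(x in D) F x.
Proof.
move=> IF F0; have mF : measurable_fun D (EFin \o F) by exact: measurable_int IF.
have -> : \int[mu]_(x in D) F x = \int[mu]_(x in D) `|F x|.
  rewrite /Rintegral; congr fine; apply: ae_eq_integral => //.
    by apply/measurable_EFinP; apply: measurableT_comp => //; exact/measurable_EFinP.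
  by apply: filterS F0 => x h Dx; rewrite /= ger0_norm// h.
by apply: fine_ge0; apply: integral_ge0 => x _; rewrite lee_fin.
Qed.

Lemma integrable_indicM (A : set T) (G : T -> R) : measurable A ->
  mu.-integrable A (EFin \o G) -> mu.-integrable D (EFin \o (fun x => \1_A x * G x)).
Proof.
move=> mA; rewrite integrable_mkcond// => I.
have -> : EFin \o (fun x => \1_A x * G x) = (EFin \o G) \_ A.
  apply/funext => x; rewrite /= patchE indicE; case: ifP => xA; first by rewrite mul1r.
  by rewrite mul0r.
exact: integrableS I.
Qed.

Lemma Rintegral_indicM (A : set T) (G : T -> R) : A `<=` D ->
  \int[mu]_(x in D) (\1_A x * G x) = \int[mu]_(x in A) G x.
Proof.
move=> AD; rewrite Rintegral_mkcond [RHS]Rintegral_mkcond; apply: eq_Rintegral => x _.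
rewrite !patchE indicE; case: ifPn => [_|xD].
  by case: ifPn => xA; rewrite ?mul1r ?mul0r.
by rewrite ifF//; apply/negbTE/negP => /set_mem/AD/mem_set; exact/negP.
Qed.

End integral_tools.

(** [t] is the value at s of the tangent at h to the strictly convex y^p, and an increasing function
    of s. Equality therefore forces both y = h and s = y. It is applied with y = |grad v| and s the
    inward radial derivative, which |grad v| dominates. *)
Lemma strict_young (R : realType) (p h s y : R) : 1 < p -> 0 < h -> 0 <= y -> s <= y ->
  let t := p * h `^ (p - 1) * s - (p - 1) * h `^ p in t <= y `^ p /\ (t = y `^ p -> s = h).
Proof.
move=> p1 h0 y0 sy t; have p0 : 0 < p by exact: lt_trans p1.
have q0 : 0 < p - 1 by rewrite subr_gt0.
have c0 : 0 < p * h `^ (p - 1) by rewrite mulr_gt0// powR_gt0.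
have hp : h `^ p = h `^ (p - 1) * h.
  by have := powRD_gt0 (p - 1) 1 h0; rewrite subrK powRr1// ltW.
have mvt a b : 0 < a -> a < b -> exists2 c, a < c < b & b `^ p - a `^ p = p * c `^ (p - 1) * (b - a).
  move=> a0 ab; have [||z] := @MVT R (fun s => s `^ p) (fun s => p * s `^ (p - 1)) a b ab.
  - by move=> x /[!in_itv]/= /andP[ax _]; apply: is_derive1_powR; exact: lt_trans ax.
  - apply: derivable_within_continuous => x /[!in_itv]/= /andP[ax _].
    by have [] := is_derive1_powR p (lt_le_trans a0 ax).
  by rewrite in_itv/= => zab E; exists z.
have key : y != h -> p * h `^ (p - 1) * y - (p - 1) * h `^ p < y `^ p.
  move=> yh; have [y1|y1|y1] := ltgtP y h; last by rewrite y1 eqxx in yh.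
  (* The value y = 0 is treated apart, since [mvt] asks for a positive left endpoint. *)
  - have [->|yn] := eqVneq y 0.
      by rewrite mulr0 sub0r powR0 ?gt_eqF// oppr_lt0 mulr_gt0// powR_gt0.
    have yp : 0 < y by rewrite lt_neqAle eq_sym yn.
    have [c /andP[yc ch] E] := mvt _ _ yp y1.
    have cl : c `^ (p - 1) < h `^ (p - 1) by rewrite gt0_ltr_powR// nnegrE ltW// (lt_trans yp).
    have : p * c `^ (p - 1) * (h - y) < p * h `^ (p - 1) * (h - y).
      by rewrite ltr_pM2r ?subr_gt0// ltr_pM2l.
    by rewrite -E hp; lra.
  - have [c /andP[hc cy] E] := mvt _ _ h0 y1.
    have cl : h `^ (p - 1) < c `^ (p - 1) by rewrite gt0_ltr_powR// nnegrE ltW// (lt_trans h0).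
    have : p * h `^ (p - 1) * (y - h) < p * c `^ (p - 1) * (y - h).
      by rewrite ltr_pM2r ?subr_gt0// ltr_pM2l.
    by rewrite -E hp; lra.
have ty : t <= p * h `^ (p - 1) * y - (p - 1) * h `^ p by rewrite lerD2r ler_pM2l.
have [yh|yh] := eqVneq y h; last first.
  have := key yh => k; split; first by rewrite ltW// (le_lt_trans ty).
  by move=> E; move: k; rewrite -E ltNge ty.
have Y : p * h `^ (p - 1) * y - (p - 1) * h `^ p = y `^ p by rewrite yh hp; ring.
split; first by rewrite -Y.
rewrite -Y /t => /addIr; rewrite -yh => /mulfI; apply.
by rewrite yh gt_eqF.
Qed.

(** * The calibration argument *)

Section calibration.
Context {R : realType} {n : nat} (n_gt0 : (0 < n)%N) (p : R) (p_gt1 : 1 < p).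
Local Notation V := 'rV[R]_n.
Local Notation mu := (@lebesgue_rV R n).
Local Notation ext := (@exterior R n).

Let mext : measurable ext. Proof. exact: measurable_exterior. Qed.
Let p_gt0 : 0 < p. Proof. exact: lt_trans p_gt1. Qed.

(** [approx_identity] with [m] a truncation of the positive part: its two terms are
    nonpositive and sum to 0, and the second one vanishes only where [w <= 0]. *)
Lemma comparison (w : V -> R) (W : V -> V) w_ : approximates w W 0 w_ ->
  {ae mu, forall x, ext x -> 0 < w x -> edot x (W x) <= 0} ->
  {ae mu, forall x, ext x -> w x <= 0}.
Proof.
move=> h hW.
have H (k : nat) : {ae mu, forall x, ext x -> enorm x ^+ 2 < 1 + k.+1%:R -> w x <= 0}.
  have j0 : 0 < k.+1%:R :> R by rewrite ltr0n.
  have j1 : 1 <= k.+1%:R :> R by rewrite ler1n.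
  have l1 : (0 : R) <= 2 * 1 by rewrite mulr1.
  have [IF E] := approx_identity n_gt0 l1
    (fun y => is_derive_softpos 1 y) (@clamp_continuous _ 1) (fun y => clamp01 y ltr01)
    (fun a b => clamp_lip a b ltr01) (cutoff_C1 k.+1%:R) (cutoff_bsupp j0)
    (fun x => cutoff01 k.+1%:R x) (fun x => cutoff1 j0) (ler0n _ 16)
    (fun x => cutoff_gradient_bound x j1) h.
  (* The trace 0 makes the boundary term vanish, so [F] integrates to 0. *)
  rewrite softpos_le0// mulr0 in E.
  set F := (fun x : V => _) in IF.
  have F0 : {ae mu, forall x, ext x -> 0 <= - F x}.
    apply: filterS hW => x hx ex; rewrite oppr_ge0 /F pmulr_lle0 ?invr_gt0 ?exprn_gt0//; last first.
      by apply: lt_trans ltr01 _; exact/exteriorP.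
    have /andP[a0 a1] := cutoff01 k.+1%:R x; have /andP[b0 b1] := clamp01 (w x) (@ltr01 R).
    have /andP[s0 _] := softpos_bounds (w x) (@ltr01 R).
    rewrite -[leRHS]addr0 lerD//; last by rewrite mulr_ge0_le0// cutoff_gradient_le0.
    have [wx|wx] := leP (w x) 0; first by rewrite clamp_le0// mulr0 mul0r.
    by apply: mulr_ge0_le0; [exact: mulr_ge0|exact: hx].
  have IN : mu.-integrable ext (EFin \o (fun x => - F x)).
    have := integrableN IF; apply: eq_integrable => // x _.
  have EN : \int[mu]_(x in ext) (- F x) = 0.
    under eq_Rintegral do rewrite -mulN1r.
    by rewrite RintegralZl// E mulr0.
  have := ae_ge0_Rintegral_eq0 mext IN F0 EN.
  apply: filterS2 hW => x hx Fx ex xk; rewrite leNgt; apply/negP => wx.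
  have x0 : 1 < enorm x by exact/exteriorP.
  have /andP[a0 a1] := cutoff01 k.+1%:R x; have /andP[b0 b1] := clamp01 (w x) (@ltr01 R).
  have g0 := cutoff_gradient_lt0 j0 x0 xk.
  have s0 := softpos_gt0 ltr01 wx.
  have : F x < 0.
    rewrite /F pmulr_llt0 ?invr_gt0 ?exprn_gt0 ?(lt_trans ltr01)//.
    rewrite -[ltRHS]addr0 ler_ltD//; last by rewrite pmulr_rlt0.
    by apply: mulr_ge0_le0; [exact: mulr_ge0|exact: hx].
  by have := Fx ex => /eqP; rewrite oppr_eq0 => /eqP ->; rewrite ltxx.
have /ae_foralln := H; apply: filterS => x hx ex.
(* Each point of the exterior lies in the region where some cutoff is strictly decreasing. *)
apply: (hx (Num.truncn (enorm x ^+ 2))) => //.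
by apply: lt_le_trans (truncnS_gt _) _; rewrite lerDr.
Qed.

(** What the argument needs to know of the radial solution. By [hw], h^(p-1) = c0 |x|^(1-n); [t] is
    the level of h that separates the positivity set from the rest, and [C] makes h^p integrable on
    sets of finite measure. *)
Variables (h : V -> R) (c0 t C : R) (U : V -> R) (DU : V -> V) (u_ : nat -> V -> R).
Local Notation N := (positivity_set U).
Hypotheses (aU : approximates U DU 1 u_) (N1 : mu N = 1%E) (U0 : forall x, ext x -> 0 <= U x)
  (Ub : forall x, ext x -> U x <= 1)
  (h0 : forall x, ext x -> 0 < h x) (hC : forall x, ext x -> h x <= C) (mh : measurable_fun ext h)
  (hw : forall x q, 0 < enorm x -> h x `^ (p - 1) * (q / enorm x) = c0 * (q / enorm x ^+ n))
  (DUx : forall x, N x -> edot x (DU x) = - (enorm x * h x))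
  (DUn : forall x, N x -> enorm (DU x) = h x)
  (DU0 : forall x, ext x -> ~ N x -> DU x = 0)
  (t0 : 0 < t) (Nt : forall x, N x -> t <= h x) (Ct : forall x, ext x -> ~ N x -> h x <= t).

Let extpos x : ext x -> 0 < enorm x.
Proof. by move=> /exteriorP; exact: lt_trans. Qed.

Let NE : N `<=` ext. Proof. exact: subIsetl. Qed.
Let mN : measurable N. Proof. exact: measurable_positivity (ap_mz aU). Qed.

Let mhp (D : set V) : measurable D -> D `<=` ext -> measurable_fun D (fun x => h x `^ p).
Proof.
move=> mD De; apply: (measurableT_comp (measurable_powR _)).
exact: measurable_funS mh.
Qed.

Let Ihp (D : set V) : measurable D -> D `<=` ext -> (mu D < +oo)%E ->
  mu.-integrable D (EFin \o (fun x => h x `^ p)).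
Proof.
move=> mD De Doo; apply: (@bounded_integrable _ _ _ _ (C `^ p)) => //; first exact: mhp.
move=> x /De ex; rewrite ger0_norm ?powR_ge0//.
have C0 : 0 <= C by rewrite (le_trans _ (hC ex))// ltW// h0.
by rewrite ge0_ler_powR ?(ltW p_gt0)// ?nnegrE ?hC// ltW// h0.
Qed.

Let I := \int[mu]_(x in N) (h x `^ p).

(** [A] and the positivity set of U have the same measure, so h^p may be replaced by h^p - t^p. This
    is nonnegative on that set and nonpositive off it, and the inequality becomes pointwise between
    integrands cut by indicators. *)
Lemma bathtub (A : set V) : measurable A -> A `<=` ext -> mu A = 1%E ->
  \int[mu]_(x in A) (h x `^ p) <= I.
Proof.
move=> mA Ae A1; pose g x := h x `^ p - t `^ p.
have Ig D : measurable D -> D `<=` ext -> mu D = 1%E ->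
    mu.-integrable D (EFin \o g) /\ \int[mu]_(x in D) g x = \int[mu]_(x in D) (h x `^ p) - t `^ p.
  move=> mD De D1; have Doo : (mu D < +oo)%E by rewrite D1 ltry.
  have I1 := Ihp mD De Doo.
  have I2 : mu.-integrable D (EFin \o (fun=> t `^ p)).
    by apply: (@bounded_integrable _ _ _ _ (t `^ p)) => // x _; rewrite ger0_norm ?powR_ge0.
  split; first by have := integrableB mD I1 I2; apply: eq_integrable.
  rewrite /g RintegralB//; congr (_ - _).
  have fD : fine (mu D) = 1 by rewrite D1.
  by transitivity (t `^ p * fine (mu D)); [exact: Rintegral_cst|rewrite fD mulr1].
have [IA EA] := Ig A mA Ae A1; have [IN EN] := Ig N mN NE N1.
rewrite -(lerD2r (- t `^ p)) -EA -EN -(Rintegral_indicM mu g Ae) -(Rintegral_indicM mu g NE).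
apply: le_Rintegral => //; [exact: integrable_indicM|exact: integrable_indicM|].
move=> x ex; rewrite /g !indicE.
have [xN|xN] := pselect (N x).
  rewrite [x \in N]mem_set// mul1r; case: (x \in A); rewrite ?mul1r// mul0r subr_ge0.
  by rewrite ge0_ler_powR ?(ltW p_gt0)// ?nnegrE ?Nt ?(ltW t0)// ltW// h0.
rewrite [x \in N]memNset// mul0r; case: (x \in A); rewrite ?mul0r// mul1r subr_le0.
by rewrite ge0_ler_powR ?(ltW p_gt0)// ?nnegrE ?Ct ?(ltW t0)// ltW// h0.
Qed.

Lemma hp_split x : ext x -> h x `^ p = h x `^ (p - 1) * h x.
Proof.
by move=> ex; have := powRD_gt0 (p - 1) 1 (h0 ex); rewrite subrK powRr1// ltW// h0.
Qed.

(** Since x . DU = - |x| h, the flux integrand of U is -h^p / c0; the flux identity for U thus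
    evaluates the boundary constant common to all competitors. *)
Lemma flux_extremal : c0 * (n%:R * vball n) = I.
Proof.
have N_oo : (mu N < +oo)%E by rewrite N1 ltry.
have C1 x : N x -> C >= 0 by move=> /NE ex; rewrite (le_trans _ (hC ex))// ltW// h0.
have fl := flux n_gt0 aU.
have /fl {}fl : forall i, mu.-integrable N (EFin \o (fun x => DU x ord0 i)).
  move=> i; apply: (@bounded_integrable _ _ _ _ C) => //.
    exact: measurable_funS (ap_mZ aU i).
  move=> x Nx; apply: le_trans (coor_le_enorm _ _) _; rewrite DUn//; exact/hC/NE.
have /fl : mu.-integrable N (EFin \o U).
  apply: (@bounded_integrable _ _ _ _ 1) => //; first exact: measurable_funS (ap_mz aU).
  by move=> x /NE ex; rewrite ger0_norm ?U0 ?Ub.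
move=> E; rewrite -[n%:R * _]opprK -mulNr -E.
have IY : mu.-integrable N (EFin \o (fun x => h x `^ p)) by exact: Ihp.
(* For c0 = 0 the relation [hw] makes h^p vanish, and both sides are 0. *)
have [c00|c00] := eqVneq c0 0.
  rewrite c00 mul0r /I; transitivity (\int[mu]_(x in N) (cst 0 x : R)); first by rewrite Rintegral_cst// mul0r.
  apply: eq_Rintegral => x /set_mem Nx; rewrite hp_split; last exact: NE.
  have x0 := extpos (NE Nx); have := hw (h x * enorm x) x0.
  by rewrite c00 mul0r mulfK ?gt_eqF.
have -> : \int[mu]_(x in N) (edot x (DU x) / enorm x ^+ n) =
    \int[mu]_(x in N) (- c0^-1 * h x `^ p).
  apply: eq_Rintegral => x /set_mem Nx; have x0 := extpos (NE Nx).
  rewrite DUx// hp_split; last exact: NE.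
  have := hw (enorm x * h x) x0.
  rewrite [X in _ * X = _]mulrAC mulfV ?gt_eqF// mul1r => ->.
  by field; rewrite c00 gt_eqF// exprn_gt0.
by rewrite RintegralZl// mulNr opprK mulrA mulfV// mul1r.
Qed.

(** * An arbitrary admissible competitor *)

Section competitor.
Variables (v : V -> R).
Hypothesis adv : admissible p (cst 1) v.
Local Notation A := (positivity_set v).
Local Notation Z := (wgrad ext v).
Let e x := enorm (Z x) `^ p.

Let Ae : A `<=` ext. Proof. exact: subIsetl. Qed.
Let A1 : mu A = 1%E. Proof. by have [] := adv. Qed.
Let mv : measurable_fun ext v.
Proof. by have [sv _ _ _ _] := adv; have [] := Lp_onP p_gt1 mext sv.1. Qed.
Let mA : measurable A. Proof. exact: measurable_positivity mv. Qed.
Let mZ i : measurable_fun ext (fun x => Z x ord0 i).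
Proof. by have [sv _ _ _ _] := adv; have [] := wgrad_Lp p_gt1 i (@open_exterior R n) sv. Qed.
Let me : measurable_fun ext (fun x => (e x)%:E).
Proof.
apply/measurable_EFinP; apply: (measurableT_comp (measurable_powR _)).
exact: measurable_enorm_comp.
Qed.

Let fluxv : mu.-integrable A (EFin \o (fun x => edot x (Z x) / enorm x ^+ n)) /\
  \int[mu]_(x in A) (edot x (Z x) / enorm x ^+ n) = - n%:R * vball n.
Proof.
have [sv tv _ _ _] := adv; have [v_ av] := trace_approx n_gt0 p_gt1 sv tv.
have Aoo : (mu A < +oo)%E by rewrite A1 ltry.
have sub (f : V -> R) : measurable_fun ext f -> (\int[mu]_(x in ext) (`|f x| `^ p)%:E < +oo)%E ->
    mu.-integrable A (EFin \o f).
  move=> mf foo; apply: (Lp_L1_integrable p_gt1) => //; first exact: measurable_funS mf.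
  apply: le_lt_trans foo; apply: ge0_subset_integral => //.
  apply/measurable_EFinP; apply: (measurableT_comp (measurable_powR _)).
  exact: measurableT_comp.
have IZ i : mu.-integrable A (EFin \o (fun x => Z x ord0 i)).
  by have [m f] := wgrad_Lp p_gt1 i (@open_exterior R n) sv; exact: sub.
have Iv : mu.-integrable A (EFin \o v) by have [m f] := Lp_onP p_gt1 mext sv.1; exact: sub.
split; last by apply: (flux n_gt0 av).
have mq : measurable_fun A (fun x => edot x (Z x) / enorm x ^+ n).
  apply: measurable_funM.
    apply: measurable_edot_comp => i; first by apply: measurable_funTS; exact: measurable_coors.
    exact: measurable_funS (mZ i).
  apply: measurable_funTS; rewrite (_ : (fun x => _) = fun x : V => enorm x `^ (- n%:R)).
    by apply: (measurableT_comp (measurable_powR _)); exact: measurable_enorm.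
  by apply/funext => x; rewrite powR_invn// enorm_ge0.
have IS : mu.-integrable A (fun x => \sum_(i <- index_enum 'I_n) (`|Z x ord0 i|)%:E)%E.
  by apply: integrable_sum => // i _; exact: integrable_norm.
apply: (le_integrable mA _ _ IS); first exact/measurable_EFinP.
move=> x /Ae ex; rewrite sumEFin lee_fin [leRHS]ger0_norm ?sumr_ge0//.
exact: norm_radial_le.
Qed.

(** The lower bound of [strict_young] with s = - x . Z / |x|. By [hw] its part linear in Z is a
    constant multiple of the flux integrand, so the integral of that part is the same for all
    competitors. *)
Let G x := p * h x `^ (p - 1) * - (edot x (Z x) / enorm x) - (p - 1) * h x `^ p.

Let GE x : ext x -> G x = - (p * c0) * (edot x (Z x) / enorm x ^+ n) - (p - 1) * h x `^ p.
Proof.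
move=> /extpos x0; rewrite /G; congr (_ - _).
by rewrite mulrN mulNr -!mulrA hw.
Qed.

Let IG : mu.-integrable A (EFin \o G).
Proof.
have Aoo : (mu A < +oo)%E by rewrite A1 ltry.
have I1 := integrableZl mA (- (p * c0)) fluxv.1.
have I2 := integrableZl mA (p - 1) (Ihp mA Ae Aoo).
by have := integrableB mA I1 I2; apply: eq_integrable => // x /set_mem/Ae ex; rewrite /= GE.
Qed.

(** The linear part integrates to p I by [flux_extremal], and [bathtub] bounds the subtracted term
    by (p-1) I. *)
Let G_int : I <= \int[mu]_(x in A) G x.
Proof.
have Aoo : (mu A < +oo)%E by rewrite A1 ltry.
have I1 := integrableZl mA (- (p * c0)) fluxv.1.
have I2 := integrableZl mA (p - 1) (Ihp mA Ae Aoo).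
have -> : \int[mu]_(x in A) G x =
    \int[mu]_(x in A) (- (p * c0) * (edot x (Z x) / enorm x ^+ n) - (p - 1) * h x `^ p).
  by apply: eq_Rintegral => x /set_mem/Ae; exact: GE.
rewrite (@RintegralB _ _ _ mu A (fun x => - (p * c0) * (edot x (Z x) / enorm x ^+ n)) (fun x => (p - 1) * h x `^ p) mA I1 I2).
rewrite (@RintegralZl _ _ _ mu A _ (- (p * c0)) mA fluxv.1).
rewrite (@RintegralZl _ _ _ mu A _ (p - 1) mA (Ihp mA Ae Aoo)).
rewrite fluxv.2.
have -> : - (p * c0) * (- n%:R * vball n) = p * (c0 * (n%:R * vball n)) by ring.
rewrite flux_extremal.
have : (p - 1) * \int[mu]_(x in A) (h x `^ p) <= (p - 1) * I.
  by rewrite ler_pM2l ?subr_gt0// bathtub.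
by lra.
Qed.

(** The slack in the tangent line inequality, extended by [e] off [A]. *)
Let defect x := e x - \1_A x * G x.

(** Equality in [strict_young] fixes the radial derivative on [A]; off [A] a zero defect means a
    zero gradient, of which again only the radial part is recorded. *)
Let defect_ge0 x : ext x -> 0 <= defect x /\
  (defect x = 0 -> edot x (Z x) = if x \in A then - (enorm x * h x) else 0).
Proof.
move=> ex; have x0 := extpos ex; rewrite /defect /e indicE.
have sy : - (edot x (Z x) / enorm x) <= enorm (Z x).
  rewrite -mulNr ler_pdivrMr// mulrC; apply: le_trans (edot_le _ _).
  by rewrite -normrN ler_norm.
have [y1 y2] := strict_young p_gt1 (h0 ex) (enorm_ge0 (Z x)) sy.
case: (boolP (x \in A)) => xA.
  rewrite mul1r subr_ge0; split => // /eqP; rewrite subr_eq0 => /eqP/esym/y2 <-.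
  by field; rewrite gt_eqF.
rewrite mul0r subr0; split; first exact: powR_ge0.
move=> /powR_eq0_eq0 Z0; have := edot_le x (Z x).
by rewrite Z0 mulr0 normr_le0 => /eqP.
Qed.

Let Ie : (energy p v < +oo)%E -> mu.-integrable ext (EFin \o e).
Proof.
move=> oo; apply/integrableP; split => //.
by under eq_integral do rewrite /= ger0_norm ?powR_ge0//.
Qed.

Let defect_int : (energy p v < +oo)%E -> mu.-integrable ext (EFin \o defect) /\
  (\int[mu]_(x in ext) defect x)%:E = (energy p v - (\int[mu]_(x in A) G x)%:E)%E.
Proof.
move=> /Ie I1; have I2 := integrable_indicM mext mA IG; split.
  by have := integrableB mext I1 I2; apply: eq_integrable.
rewrite /defect RintegralB// Rintegral_indicM// EFinB; congr (_ - _)%E.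
by rewrite /Rintegral fineK//; exact: integrable_fin_num I1.
Qed.

Lemma energy_ge : (I%:E <= energy p v)%E.
Proof.
have [oo|] := ltP (energy p v) +oo%E; last by apply: le_trans; exact: leey.
have [ID E] := defect_int oo.
have D0 : 0 <= \int[mu]_(x in ext) defect x.
  by apply: (ae_ge0_Rintegral_ge0 mext ID); apply: aeW => x ex; exact: (defect_ge0 ex).1.
apply: (@le_trans _ _ (\int[mu]_(x in A) G x)%:E); first by rewrite lee_fin G_int.
by rewrite -sube_ge0 ?ltry// -E lee_fin.
Qed.

Lemma energy_eq : (energy p v <= I%:E)%E ->
  {ae mu, forall x, ext x -> edot x (Z x) = if x \in A then - (enorm x * h x) else 0}.
Proof.
move=> eI; have oo : (energy p v < +oo)%E by apply: le_lt_trans eI _; exact: ltry.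
have [ID E] := defect_int oo.
have D0 : {ae mu, forall x, ext x -> 0 <= defect x}.
  by apply: aeW => x ex; exact: (defect_ge0 ex).1.
have z : \int[mu]_(x in ext) defect x = 0.
  apply/eqP; rewrite eq_le (ae_ge0_Rintegral_ge0 mext ID D0) andbT -lee_fin E sube_le0.
  by apply: le_trans eI _; rewrite lee_fin G_int.
have := ae_ge0_Rintegral_eq0 mext ID D0 z; apply: filterS => x hx ex.
by apply: (defect_ge0 ex).2; exact: hx.
Qed.

(** The radial derivatives of U and v are known on their own positivity sets, whose relation is not.
    The sign of the radial derivative of U - v where U > v nevertheless suffices for U <= v. The
    volume constraint then identifies the two sets up to a null set, after which v - U has zero
    radial derivative and the reverse comparison applies. *)
Lemma competitor_unique : (energy p v <= I%:E)%E -> {ae mu, forall x, ext x -> v x = U x}.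
Proof.
move=> /energy_eq eq1; have [sv tv _ _ _] := adv.
have [v_ av] := trace_approx n_gt0 p_gt1 sv tv.
have UE x : ext x -> edot x (DU x) = if x \in N then - (enorm x * h x) else 0.
  move=> ex; case: ifPn => [/set_mem/DUx//|/negP xN].
  rewrite DU0//; last by move=> /mem_set.
  by rewrite -(scale0r (0 : V)) edotZr mul0r.
have xh0 x : ext x -> 0 <= enorm x * h x by move=> ex; rewrite mulr_ge0 ?enorm_ge0// ltW// h0.
have U_out x : ext x -> x \notin N -> U x = 0.
  move=> ex /negP xN; apply/eqP; rewrite eq_le U0// andbT leNgt; apply/negP => ux.
  by apply: xN; rewrite inE.
have b1 := approxB aU av; rewrite subrr in b1.
have vU : {ae mu, forall x, ext x -> U x <= v x}.
  have : {ae mu, forall x, ext x -> U x - v x <= 0}.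
    apply: (comparison b1); apply: filterS eq1 => x hx ex d0.
    (* Off the positivity set of U one has U = 0, so U > v makes v negative and x lies off [A] too.
       On it, the difference is 0 or - |x| h according to whether x is in [A]. *)
    rewrite edotBr hx// UE//; case: ifPn => xN; last first.
      rewrite sub0r ifF ?oppr0//; apply/negbTE/negP => /set_mem[_ /= vx].
      by move: d0; rewrite U_out// sub0r oppr_gt0 ltNge (ltW vx).
    by case: ifPn => _; rewrite ?subrr// subr0 oppr_le0 xh0.
  by apply: filterS => x hx ex; rewrite -subr_le0 hx.
have NA0 : mu (N `\` A) = 0%E.
  have [B [mB B0 sB]] := vU; apply/eqP; rewrite -measure_le0 -B0; apply: le_measure; rewrite ?inE//.
    exact: measurableD.
  move=> x [[ex ux] nA]; apply: sB => /= /(_ ex) vx; apply: nA; split => //=.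
  exact: lt_le_trans vx.
have NA1 : mu (N `&` A) = 1%E.
  have E : mu N = (mu (N `\` A) + mu (N `&` A))%E by exact: measureDI.
  by move: E; rewrite N1 NA0 add0e => <-.
(* [N] is contained in [A] up to a null set and both have measure 1. *)
have AN0 : mu (A `\` N) = 0%E.
  have Aoo : (mu A < +oo)%E by rewrite A1 ltry.
  have E : mu (A `\` N) = (mu A - mu (A `&` N))%E by exact: measureD.
  by rewrite E setIC A1 NA1 subee.
have aeA : {ae mu, forall x, ext x -> (x \in A) = (x \in N)}.
  have : {ae mu, forall x, ~ (A `\` N) x}.
    by exists (A `\` N); split => //; [exact: measurableD|move=> x /= /contrapT].
  apply: filterS2 vU => x vx nAN ex; apply/idP/idP => /set_mem xA; apply/mem_set.
    by apply: contrapT => xN; apply: nAN.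
  by split => //=; case: xA => _ ux; exact: lt_le_trans (vx ex).
have b2 := approxB av aU; rewrite subrr in b2.
have : {ae mu, forall x, ext x -> v x - U x <= 0}.
  apply: (comparison b2); apply: filterS2 aeA eq1 => x hA hx ex _.
  by rewrite edotBr hx// UE// hA// subrr.
apply: filterS2 vU => x h1 h2 ex; apply/eqP; rewrite eq_le h1// andbT -subr_le0.
exact: h2.
Qed.

End competitor.

(** [energy] is computed with the choice [wgrad], which agrees with [DU] almost everywhere; [DU] has
    length h on [N] and is 0 elsewhere. *)
Lemma energy_extremal : energy p U = I%:E.
Proof.
have N_oo : (mu N < +oo)%E by rewrite N1 ltry.
have mDU : measurable_fun ext (fun x => (enorm (DU x) `^ p)%:E).
  apply/measurable_EFinP; apply: (measurableT_comp (measurable_powR _)).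
  by apply: measurable_enorm_comp => i; exact: ap_mZ aU i.
transitivity (\int[mu]_(x in ext) (\1_N x * h x `^ p)%:E)%E.
  have E x : ext x -> \1_N x * h x `^ p = enorm (DU x) `^ p.
    move=> ex; rewrite indicE; have [xN|xN] := pselect (N x).
      by rewrite mem_set// mul1r DUn.
    by rewrite memNset// mul0r DU0// enorm0 powR0// gt_eqF.
  rewrite [RHS](eq_integral (fun x => (enorm (DU x) `^ p)%:E)); last first.
    by move=> x /set_mem ex; rewrite E.
  have hD := approximates_weak_gradient aU.
  have hw' : weak_gradient ext U (wgrad ext U).
    by rewrite /wgrad; case: xgetP => [G' _ //|/(_ DU)].
  have [_ lw _] := hw'; rewrite /energy; apply: ge0_ae_eq_integral => //.
  - apply/measurable_EFinP; apply: (measurableT_comp (measurable_powR _)).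
    apply: measurable_enorm_comp => i; apply: loc_integrable_measurable; first exact: open_exterior.
    exact: lw.
  - by move=> x _; rewrite lee_fin powR_ge0.
  - by move=> x _; rewrite lee_fin powR_ge0.
  - by have := weak_gradient_unique (@open_exterior R n) hw' hD; apply: filterS => x hx ex; rewrite hx.
have I2 := integrable_indicM mext mN (Ihp mN NE N_oo).
rewrite -[LHS]fineK; last exact: (integrable_fin_num mext I2).
by rewrite -/(Rintegral _ _ _) Rintegral_indicM.
Qed.

End calibration.

Theorem theorem6p1 (R : realType) (n : nat) (p : R)
    (n_gt0 : (0 < n)%N) (p_gt1 : 1 < p) :
  exists u : 'rV[R]_n -> R,
    [/\ is_solution p (cst 1) u,
        forall v, is_solution p (cst 1) v ->
          forall x, exterior x -> v x = u x,
        forall v, is_minimizer p (cst 1) v ->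
          ae_eq (lebesgue_rV n) exterior v u,
        radially_symmetric u &
        exists (c : 'rV[R]_n) (r : R), 0 < r /\ free_boundary u = sphere c r].
Proof.
have q0 : 0 < p - 1 by rewrite subr_gt0.
(* The exponent for which a gradient of length |x|^-al has (p-1)-th power |x|^(1-n), the decay of a
   divergence free radial field. *)
pose al := (n%:R - 1) / (p - 1).
have al0 : 0 <= al by rewrite divr_ge0 ?(ltW q0)// subr_ge0 ler1n.
have alE : al * (p - 1) = n%:R - 1 by rewrite divfK// gt_eqF.
have [L [L1 dL /(_ n) smL]] := power_primitive ((al + 1) / 2).
have v0 : 0 < vball n :> R by exact: vball_gt0.
(* Solves (r^n - 1) [vball n] = 1, the volume constraint for the annulus. *)
pose r : R := (1 + (vball n)^-1) `^ n%:R^-1.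
have rn : r ^+ n = 1 + (vball n)^-1.
  rewrite -powR_mulrn ?powR_ge0// -powRrM mulVf ?pnatr_eq0 ?gt_eqF// ?lt0n_neq0//.
  by rewrite powRr1// addr_ge0// invr_ge0 ltW.
have rE : (r ^+ n - 1) * vball n = 1 by rewrite rn; field; rewrite gt_eqF.
have r1 : 1 < r.
  rewrite ltNge; apply/negP => h; have := exprn_ile1 n (powR_ge0 _ _ : 0 <= r) h.
  by rewrite rn gerDl leNgt invr_gt0 v0.
have r0 : 0 < r by exact: lt_trans r1.
have Lr : 0 < L (r ^+ 2) by rewrite -L1; apply: (L_lt dL) => //; rewrite exprn_egt1.
pose kap := (L (r ^+ 2))^-1.
have kap0 : 0 < kap by rewrite invr_gt0.
have kapL : kap * L (r ^+ 2) = 1 by rewrite mulVf// gt_eqF.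
have k20 : 0 < 2 * kap by rewrite mulr_gt0.
pose U := @radial_sol R n L kap.
pose DU := @radial_grad R n L al kap.
pose h := @slope R n al kap.
have adm : admissible p (cst 1) U.
  exact: (radial_admissible n_gt0 p_gt1 al0 L1 dL smL r1 kap0 kapL alE rE).
have aU : approximates U DU 1 (radial_approx L kap).
  exact: (radial_approximates n_gt0 al0 L1 dL smL r1 kap0 kapL).
(* Monotone in the weak sense: for n = 1 the exponent al is 0 and h is constant. *)
have mono a b : 0 < a -> a <= b -> b `^ (- al) <= a `^ (- al).
  move=> a0 ab; have b0 : 0 < b by exact: lt_le_trans ab.
  by rewrite !powRN lef_pV2 ?posrE ?powR_gt0// ge0_ler_powR// nnegrE ltW.
have pos x : @exterior R n x -> 0 < enorm x by move=> /exteriorP; exact: lt_trans.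
have bnd x : @exterior R n x -> 0 <= U x <= 1.
  exact: (radial_sol_bounds L1 dL kap0).
have Ugt x : @exterior R n x -> (0 < U x) = (enorm x < r).
  exact: (radial_sol_gt0 dL r1 kap0 kapL).
have N1 : lebesgue_rV n (positivity_set U) = 1%E by have [] := adm.
have U0 x : @exterior R n x -> 0 <= U x by move=> /bnd/andP[].
have Ub x : @exterior R n x -> U x <= 1 by move=> /bnd/andP[].
have h0 x : @exterior R n x -> 0 < h x by move=> /pos x0; rewrite mulr_gt0// powR_gt0.
have hC x : @exterior R n x -> h x <= 2 * kap.
  move=> /exteriorP x1; rewrite /h /slope ler_piMr ?(ltW k20)//.
  by have := mono _ _ ltr01 (ltW x1); rewrite powR1.
have mh : measurable_fun (@exterior R n) h.
  apply: measurable_funTS; apply: measurable_funM; first exact: measurable_cst.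
  by apply: (measurableT_comp (measurable_powR _)); exact: measurable_enorm.
have hw (x : 'rV[R]_n) q : 0 < enorm x ->
    h x `^ (p - 1) * (q / enorm x) = (2 * kap) `^ (p - 1) * (q / enorm x ^+ n).
  exact: (slope_weight kap0 alE).
have DUx x : positivity_set U x -> edot x (DU x) = - (enorm x * h x).
  exact: edot_radial_grad.
have DUn x : positivity_set U x -> enorm (DU x) = h x.
  exact: enorm_radial_grad.
have DU0 x : @exterior R n x -> ~ positivity_set U x -> DU x = 0.
  by move=> ex nN; rewrite /DU /radial_grad ifF//; apply/negbTE/negP => ux; apply: nN.
(* The value of h on the free boundary |x| = r. *)
pose t := 2 * kap * r `^ (- al).
have t0 : 0 < t by rewrite mulr_gt0// powR_gt0.
have Nt x : positivity_set U x -> t <= h x.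
  by move=> [ex /=]; rewrite Ugt// => xr; rewrite /t /h /slope ler_pM2l// mono ?pos// ltW.
have Ct x : @exterior R n x -> ~ positivity_set U x -> h x <= t.
  move=> ex nN; rewrite /t /h /slope ler_pM2l// mono// leNgt -Ugt//.
  by apply/negP => ux; apply: nN.
have EU : energy p U = (\int[lebesgue_rV n]_(x in positivity_set U) (h x `^ p))%:E.
  exact: (energy_extremal p_gt1 aU N1 h0 hC mh DUn DU0).
have min (v : 'rV[R]_n -> R) : admissible p (cst 1) v -> (energy p U <= energy p v)%E.
  by move=> adv; have := energy_ge n_gt0 p_gt1 aU N1 U0 Ub h0 hC mh hw DUx DUn t0 Nt Ct adv; rewrite -EU.
have uniq (v : 'rV[R]_n -> R) : is_minimizer p (cst 1) v -> {ae (lebesgue_rV n), forall x, exterior x -> v x = U x}.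
  move=> [adv /(_ _ adm)]; rewrite EU => le.
  exact: (competitor_unique n_gt0 p_gt1 aU N1 U0 Ub h0 hC mh hw DUx DUn DU0 t0 Nt Ct adv le).
have cU : {within exterior, continuous U}.
  by apply: continuous_subspaceT => x; exact: (radial_sol_continuous dL).
exists U; split.
- by split.
- move=> v [vmin cv]; apply: ae_eq_continuous => //; first exact: open_exterior.
  exact: uniq.
- by move=> v vmin; exact: uniq.
- exact: radial_sol_symmetric.
- exists 0, r; split => //.
  exact: (radial_free_boundary dL r1 kap0 kapL).
Qed.
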